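(* Let $n\geq 2$, let $A=A(x)$ be a smooth matrix-valued function on $\mathbb{R}^n$ such that the $n\times n$ matrix $A(x)$ is invertible for every $x\in\mathbb{R}^n$, let $f\in(\mathcal{E}'(\mathbb{R}^n))^n$ be a compactly supported covector-valued distribution, and let $V\subset\mathbb{R}^n$ be a nonempty open set. Assume that $\mathrm{d}(Af)|_V=0$. Then $X_Af$ vanishes on all lines intersecting $V$ if and only if $f=A^{-1}(\mathrm{d}\psi)$ for some $\psi\in\mathcal{E}'(\mathbb{R}^n)$.
   Context: $\mathcal{E}'(\mathbb{R}^n)$ is the space of compactly supported distributions on $\mathbb{R}^n$. $f\in(\mathcal{E}'(\mathbb{R}^n))^n$ means $f=(f_1,\dots,f_n)$ with each $f_i\in\mathcal{E}'(\mathbb{R}^n)$, with pairing $\langle f,\varphi\rangle=\sum_i\langle f_i,\varphi_i\rangle$. One-forms are identified with vector fields. The exterior derivative of a covector-valued distribution $g$ is given, in the sense of distributions, by $(\mathrm{d}g)_{ij}=\partial_i g_j-\partial_j g_i$. For a scalar distribution $\psi$, $\mathrm{d}\psi=(\partial_1\psi,\dots,\partial_n\psi)$. $\mathrm{d}g|_V=0$ means that all components $(\mathrm{d}g)_{ij}$ vanish as distributions on $V$. For a smooth matrix field $A$ and a covector-valued distribution $f$, $Af$ is defined by $\langle Af,\varphi\rangle=\langle f,A^T\varphi\rangle$, where $(A^T\varphi)(x)=A(x)^T\varphi(x)$ (so $(Af)_i=\sum_jA_{ij}f_j$). $A^{-1}$ denotes the pointwise inverse matrix field, acting in the same way. Let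 $\Gamma=\{(z,\theta):\theta\in S^{n-1},\ z\in\theta^\perp\}$ be the manifold of oriented lines, where $(z,\theta)$ represents $t\mapsto z+t\theta$, with measure $dz\,d\theta$. The X-ray transform of a smooth compactly supported one-form $f$ is $X_1f(z,\theta)=\int_{\mathbb{R}}f(z+t\theta)\cdot\theta\,dt$, and its adjoint, acting on $\psi\in C^\infty(\Gamma)$, is $(X_1^*\psi)_i(x)=\int_{S^{n-1}}\theta_i\,\psi(x-(x\cdot\theta)\theta,\theta)\,d\theta$. For $f\in(\mathcal{E}'(\mathbb{R}^n))^n$, $X_1f\in\mathcal{E}'(\Gamma)$ is defined by $\langle X_1f,\varphi\rangle=\langle f,X_1^*\varphi\rangle$ for $\varphi\in C^\infty(\Gamma)$. The generalized X-ray transform is $X_Af=X_1(Af)$. ''$X_Af$ vanishes on all lines intersecting $V$'' means that the distribution $X_Af$ vanishes on the open subset of $\Gamma$ consisting of the lines that meet $V$, i.e. $\langle X_Af,\varphi\rangle=0$ for every $\varphi\in C_c^\infty(\Gamma)$ supported in that open subset. *)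

(* Defs.v *)
From HB Require Import structures.
From mathcomp Require Import all_boot all_order all_algebra.
From mathcomp Require Import all_classical all_reals all_analysis.
Set Implicit Arguments.
Unset Strict Implicit.
Unset Printing Implicit Defensive.
Import Order.TTheory GRing.Theory Num.Theory.
Import numFieldNormedType.Exports.
Local Open Scope classical_set_scope.
Local Open Scope ring_scope.

(* R^n is 'rV[R]_n; its library norm is the sup norm, so the Euclidean
   structure is given by dot. *)

Section Smooth.
Context {R : realType}.

Definition partial n (i : 'I_n) (g : 'rV[R]_n -> R) : 'rV[R]_n -> R :=
  fun x => 'D_(delta_mx 0 i) g x.

Definition partials n (s : seq 'I_n) (g : 'rV[R]_n -> R) : 'rV[R]_n -> R :=
  foldr (@partial n) g s.

(* Meaningful for open U. *)
Definition smooth_on n (U : set 'rV[R]_n) (g : 'rV[R]_n -> R) : Prop :=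
  forall (s : seq 'I_n) (x : 'rV[R]_n), U x ->
    {for x, continuous (partials s g)} /\
    forall i : 'I_n, derivable (partials s g) x (delta_mx 0 i).

Definition smooth n (g : 'rV[R]_n -> R) : Prop := smooth_on setT g.

(* C^oo functions on an embedded submanifold S of R^m: near every point of S,
   g agrees on S with a smooth function of the ambient space. The values of g
   off S are irrelevant. *)
Definition smooth_rel m (S : set 'rV[R]_m) (g : 'rV[R]_m -> R) : Prop :=
  forall p, S p -> exists (U : set 'rV[R]_m) (G : 'rV[R]_m -> R),
    [/\ open U, U p, smooth_on U G & forall q, S q -> U q -> G q = g q].

(* g is in C_c^oo(S) with support in W. For S closed in R^m, the closure in R^m
   of a subset of S is its closure in S. *)
Definition test_rel m (S W : set 'rV[R]_m) (g : 'rV[R]_m -> R) : Prop :=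
  let supp := closure (S `&` [set p | g p != 0]) in
  [/\ smooth_rel S g, compact supp & supp `<=` W].

Definition test_on n (V : set 'rV[R]_n) (g : 'rV[R]_n -> R) : Prop :=
  let supp := closure [set x | g x != 0] in
  [/\ smooth g, compact supp & supp `<=` V].

End Smooth.

Section Distributions.
Context {R : realType}.

(* The C^oo(R^n) seminorm p_{K,m}. *)
Definition seminorm n (K : set 'rV[R]_n) (m : nat) (g : 'rV[R]_n -> R) : R :=
  sup [set r | exists (s : seq 'I_n) (x : 'rV[R]_n),
                 [/\ (size s <= m)%N, K x & r = `|partials s g x|]].

(* Distributions are functionals on all functions, of which only the values on
   smooth functions matter; hence eq_distr rather than =. *)
Definition functional n := ('rV[R]_n -> R) -> R.

(* E'(R^n), the continuous dual of C^oo(R^n). *)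
Definition compact_distribution n (u : functional n) : Prop :=
  (forall (a : R) (g h : 'rV[R]_n -> R), smooth g -> smooth h ->
     u (fun x => a * g x + h x) = a * u g + u h) /\
  (exists (K : set 'rV[R]_n) (m : nat) (C : R), compact K /\
     forall g : 'rV[R]_n -> R, smooth g -> `|u g| <= C * seminorm K m g).

Definition eq_distr n (u v : functional n) : Prop :=
  forall g : 'rV[R]_n -> R, smooth g -> u g = v g.

Definition vanishes_on n (V : set 'rV[R]_n) (u : functional n) : Prop :=
  forall g : 'rV[R]_n -> R, test_on V g -> u g = 0.

Definition dpartial n (i : 'I_n) (u : functional n) : functional n :=
  fun g => - u (partial i g).

Definition dscalar n (u : functional n) : 'I_n -> functional n :=
  fun i => dpartial i u.

Definition dcovector n (f : 'I_n -> functional n) (i j : 'I_n) : functional n :=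
  fun g => dpartial i (f j) g - dpartial j (f i) g.

Definition pairing n (f : 'I_n -> functional n) (Phi : 'I_n -> 'rV[R]_n -> R) : R :=
  \sum_(i < n) f i (Phi i).

(* <A f, g e_i> = <f, A^T (g e_i)>, and (A^T (g e_i))_j = A_ij g. *)
Definition mulmx_distr n (A : 'rV[R]_n -> 'M[R]_n) (f : 'I_n -> functional n) :
    'I_n -> functional n :=
  fun i g => pairing f (fun j x => A x i j * g x).

End Distributions.

Section Xray.
Context {R : realType}.

Definition dot n (x y : 'rV[R]_n) : R := \sum_(i < n) x 0 i * y 0 i.

(* Lebesgue integral on R^n, as n iterated one-dimensional integrals. It is
   applied only to bounded Borel functions vanishing off the unit ball. *)
Fixpoint integral_rV n : ('rV[R]_n -> R) -> R :=
  match n with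
  | 0 => fun g => g 0
  | m.+1 => fun g =>
      \int[lebesgue_measure]_t
        integral_rV (fun y : 'rV[R]_m => g (row_mx (t%:M : 'rV[R]_1) y))
  end.

(* Integral for the surface measure sigma of S^{n-1}, which is given by
   sigma(E) = n * Leb {r theta | 0 < r <= 1, theta in E}. *)
Definition integral_sphere n (g : 'rV[R]_n -> R) : R :=
  n%:R * integral_rV (fun x : 'rV[R]_n =>
    if 0 < dot x x <= 1 then g ((Num.sqrt (dot x x))^-1 *: x) else 0).

(* The manifold Gamma of oriented lines, embedded in R^{2n}: row_mx z theta
   represents the line t |-> z + t theta. *)
Definition Gamma n : set 'rV[R]_(n + n) :=
  [set p | dot (rsubmx p) (rsubmx p) = 1 /\ dot (lsubmx p) (rsubmx p) = 0].

Definition lines_meeting n (V : set 'rV[R]_n) : set 'rV[R]_(n + n) :=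
  @Gamma n `&` [set p | exists t : R, V (lsubmx p + t *: rsubmx p)].

Definition X1_adj n (psi : 'rV[R]_(n + n) -> R) (i : 'I_n) (x : 'rV[R]_n) : R :=
  integral_sphere (fun theta : 'rV[R]_n =>
    theta 0 i * psi (row_mx (x - dot x theta *: theta) theta)).

Definition X1 n (f : 'I_n -> functional n) (phi : 'rV[R]_(n + n) -> R) : R :=
  pairing f (X1_adj phi).

Definition XA n (A : 'rV[R]_n -> 'M[R]_n) (f : 'I_n -> functional n) :
    ('rV[R]_(n + n) -> R) -> R :=
  X1 (mulmx_distr A f).

Definition vanishes_on_lines_meeting n (V : set 'rV[R]_n)
    (T : ('rV[R]_(n + n) -> R) -> R) : Prop :=
  forall phi : 'rV[R]_(n + n) -> R,
    test_rel (@Gamma n) (lines_meeting V) phi -> T phi = 0.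

End Xray.

(* Main.v *)
From HB Require Import structures.
Require Import Defs.
From mathcomp Require Import all_boot all_order all_algebra.
From mathcomp Require Import all_classical all_reals all_analysis.
From mathcomp Require Import measurable_realfun.
From mathcomp Require Import ring lra zify.
Set Implicit Arguments.
Unset Strict Implicit.
Unset Printing Implicit Defensive.
Import Order.TTheory GRing.Theory Num.Theory.
Import numFieldNormedType.Exports.
Local Open Scope classical_set_scope.
Local Open Scope ring_scope.


(** Write [g = A f]. If [f = A^-1 (d psi)] then [g = d psi], and
    [<d psi, X1^* phi> = - <psi, div X1^* phi>] vanishes because [X1^* phi]
    superposes, over the directions [theta], the fields [theta phi(., theta)],
    each of which is constant along [theta] ([X1_adj_divergence]).

    The converse has three steps; the first two show that [dg = 0] on all of R^n.
    Fix a point [x0] of [V], two indices [j], [k], and consider the compactly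
    supported distribution [u h = g_j (d_k h) - g_k (d_j h)], which vanishes on
    functions supported near [x0]. For [h] supported near [x0] let
    [phi_(h,j) (z, theta) = theta_j \int h (z + t theta) dt], a test function on
    the lines that meet [V]. In polar coordinates, off the support of [h],
    [X1^* phi_(h,j)] is the convolution of [h] with the kernel
    [2 w_i w_j |w|^(-n-1)]; the curl of this kernel in [(j, k)] is, up to a
    constant, [delta_ij d_k - delta_ik d_j] applied to the Riesz kernel
    [|w|^(1-n)] ([X1_adj_curl_test]). So the difference of [X1^* phi_(d_k h,j)]
    and [X1^* phi_(d_j h,k)] equals, off a small box around [x0], a multiple of
    [e_j d_k K - e_k d_j K], where [K] is the Riesz potential of [h], with the
    kernel smoothed at the origin. Both fields are free of divergence, and a
    closed form annihilates a divergence-free field with support in a box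
    ([closed_kills_solenoidal]). As the X-ray transform of [g] vanishes near the
    lines through [x0], it follows that [u K = 0]; when [h] shrinks to a point,
    [u] annihilates all derivatives of the Riesz kernel centred at [x0]
    ([unmollify]).

    The second step is that such a [u] is zero ([riesz_kernel_rigidity]).
    Powers of the Laplacian, and then first derivatives, produce from
    [|x|^(1-n)] all the functions [|x|^(1-n) P (x / |x|^2)] with a polynomial
    [P]. Under the inversion [x -> x / |x|^2] the distribution [u] becomes a
    compactly supported distribution that annihilates all polynomials, and so it is
    zero, by approximation with Bernstein polynomials ([cd_polyfun_eq0]). Inversion moves
    the region far from [x0], where [u] is to be determined, to a neighbourhood of
    the origin.

    The third step is the Poincare lemma for compactly supported distributions
    ([closed_exact]), which holds because [n >= 2]. *)

(** * Calculus in coordinates and smooth functions *)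

Section Calculus.
Context {R : realType}.

Local Notation e_ i := (delta_mx 0 i).

Lemma coord_le_norm n (x : 'rV[R]_n) i : `|x 0 i| <= `|x|.
Proof.
rewrite [leRHS]/Num.norm /= mx_normrE; apply/bigmax_geP; right => /=.
by exists (0, i).
Qed.

Lemma norm_le_coord n (x : 'rV[R]_n) (M : R) :
  0 <= M -> (forall i, `|x 0 i| <= M) -> `|x| <= M.
Proof.
move=> M0 h; rewrite [leLHS]/Num.norm /= mx_normrE; apply/bigmax_leP; split => //.
by move=> [i j] _ /=; rewrite (ord1 i).
Qed.

Lemma norm_delta_le n (i : 'I_n) (t : R) : `|t *: (e_ i : 'rV[R]_n)| <= `|t|.
Proof.
apply: norm_le_coord => // j; rewrite !mxE eqxx /=.
by case: (j == i); rewrite ?mulr1 // mulr0 normr0.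
Qed.

Lemma is_derive_line n (g : 'rV[R]_n -> R) (x : 'rV[R]_n) i (s : R) :
  derivable g (x + s *: e_ i) (e_ i) ->
  is_derive s 1 (fun t => g (x + t *: e_ i)) (partial i g (x + s *: e_ i)).
Proof.
move=> dg; have E : (fun h : R => h^-1 *: (g (h *: e_ i + (x + s *: e_ i)) - g (x + s *: e_ i))) =
  (fun h : R => h^-1 *: (g (x + (h *: 1 + s) *: e_ i) - g (x + s *: e_ i))).
  apply/funext => h; congr (_ *: (g _ - _)).
  by rewrite scalerDl addrCA [h *: 1]mulr1.
split.
  by rewrite /derivable -E.
by rewrite /derive -E.
Qed.

Lemma partial_mvt n (g : 'rV[R]_n -> R) (x : 'rV[R]_n) i (t : R) :
  (forall s : R, `|s| <= `|t| -> derivable g (x + s *: e_ i) (e_ i)) ->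
  exists2 s : R, `|s| <= `|t| &
    g (x + t *: e_ i) - g x = t * partial i g (x + s *: e_ i).
Proof.
move=> dg.
pose f (s : R) : R := g (x + s *: e_ i).
have df (s : R) : `|s| <= `|t| -> is_derive s 1 f (partial i g (x + s *: e_ i)).
  by move=> st; apply: is_derive_line; exact: dg.
have cf (a b : R) : `|a| <= `|t| -> `|b| <= `|t| -> {within `[a, b], continuous f}.
  move=> la lb; apply: derivable_within_continuous => s.
  rewrite in_itv /= => /andP[as_ sb].
  have : `|s| <= `|t|.
    by rewrite ler_norml; move: la lb; rewrite !ler_norml => /andP[? ?] /andP[? ?];
      apply/andP; split; lra.
  by move=> /df [].
have E0 : f 0 = g x by rewrite /f scale0r addr0.
have [t0|t0] := leP 0 t.
  have [||s] := @MVT_segment R f (fun s : R => partial i g (x + s *: e_ i)) 0 t t0.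
  - move=> s; rewrite in_itv /= => /andP[s0 st]; apply: df.
    by rewrite !ger0_norm // ltW.
  - by apply: cf; rewrite ?normr0.
  - rewrite in_itv /= => /andP[s0 st] E; exists s; first by rewrite !ger0_norm.
    by rewrite -E0 -/(f t) E subr0 mulrC.
have [||s] := @MVT_segment R f (fun s : R => partial i g (x + s *: e_ i)) t 0 (ltW t0).
- move=> s; rewrite in_itv /= => /andP[ts s0]; apply: df.
  by rewrite !ltr0_norm // lerN2 ltW.
- by apply: cf; rewrite ?normr0.
- rewrite in_itv /= => /andP[ts s0] E; exists s; first by rewrite !ler0_norm ?lerN2 // ltW.
  by rewrite -E0 -/(f t) -opprB E sub0r mulrN opprK mulrC.
Qed.

(** The points of the polygonal path from [x] to [x + v] that changes one
    coordinate at a time. *)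
Definition partway n (x v : 'rV[R]_n) (k : nat) : 'rV[R]_n :=
  \row_i (x 0 i + (if (i < k)%N then v 0 i else 0)).

Lemma partway0 n (x v : 'rV[R]_n) : partway x v 0 = x.
Proof. by apply/rowP => i; rewrite mxE addr0. Qed.

Lemma partwayn n (x v : 'rV[R]_n) : partway x v n = x + v.
Proof. by apply/rowP => i; rewrite !mxE ltn_ord. Qed.

Lemma partwayS n (x v : 'rV[R]_n) (k : 'I_n) :
  partway x v k.+1 = partway x v k + v 0 k *: e_ k.
Proof.
apply/rowP => i; rewrite !mxE eqxx /= ltnS leq_eqVlt -[(i == k :> nat)]/(i == k).
case: (eqVneq i k) => [->|ik] /=; first by rewrite ltnn mulr1 addr0.
by rewrite mulr0 addr0.
Qed.

Lemma partway_norm n (x v : 'rV[R]_n) (k : 'I_n) (s : R) :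
  `|s| <= `|v 0 k| -> `|partway x v k + s *: e_ k - x| <= `|v|.
Proof.
move=> sv; apply: norm_le_coord => // i; rewrite !mxE eqxx /=.
have -> : x 0 i + (if (i < k)%N then v 0 i else 0) + s * (i == k)%:R - x 0 i =
   (if (i < k)%N then v 0 i else 0) + s * (i == k)%:R by lra.
case: (eqVneq i k) => [->|ik] /=.
  by rewrite ltnn add0r mulr1 (le_trans sv) // coord_le_norm.
by rewrite mulr0 addr0; case: ifP => _; rewrite ?normr0 // coord_le_norm.
Qed.

Lemma mvt_rV n (g : 'rV[R]_n -> R) (x v : 'rV[R]_n) :
  (forall y, `|y - x| <= `|v| -> forall i, derivable g y (e_ i)) ->
  exists2 xi : 'I_n -> 'rV[R]_n, (forall i, `|xi i - x| <= `|v|) &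
    g (x + v) - g x = \sum_i v 0 i * partial i g (xi i).
Proof.
move=> dg.
have H (k : 'I_n) : exists y : 'rV[R]_n, `|y - x| <= `|v| /\
    g (partway x v k.+1) - g (partway x v k) = v 0 k * partial k g y.
  have [s sv|s sv E] := @partial_mvt n g (partway x v k) k (v 0 k).
    by apply: dg; exact: partway_norm.
  exists (partway x v k + s *: e_ k); split; first exact: partway_norm.
  by rewrite partwayS.
have [xi hxi] := choice H.
exists xi; first by move=> i; have [] := hxi i.
transitivity (\sum_(0 <= k < n) (g (partway x v k.+1) - g (partway x v k))).
  by rewrite telescope_sumr // partway0 partwayn.
by rewrite big_mkord; apply: eq_bigr => k _; have [] := hxi k.
Qed.

Lemma nbhs_closed_ball (V : normedModType R) (x : V) (P : set V) :
  nbhs x P <-> exists2 d : R, 0 < d & forall y, `|y - x| <= d -> P y.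
Proof.
split=> [/nbhs_ballP [e /= e0 h]|[d d0 h]].
  exists (e / 2); first by rewrite divr_gt0.
  move=> y yx; apply: h; rewrite -ball_normE /= distrC (le_lt_trans yx) //; lra.
apply/nbhs_ballP; exists d => //= y; rewrite -ball_normE /= distrC => /ltW; exact: h.
Qed.

Lemma continuous_for_closed_ball (V W : normedModType R) (f : V -> W) (x : V) :
  {for x, continuous f} <->
  forall e : R, 0 < e -> exists2 d : R, 0 < d & forall y, `|y - x| <= d -> `|f y - f x| <= e.
Proof.
split=> [cf e e0|h].
  move: (cf [set z | `|z - f x| <= e]); rewrite /= => H.
  by apply/nbhs_closed_ball; apply: H; apply/nbhs_closed_ball; exists e.
move=> P /= /nbhs_closed_ball [e e0 eP]; rewrite /nbhs /=.
have [d d0 dh] := h e e0.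
by apply/nbhs_closed_ball; exists d => // y yd; apply: eP; exact: dh.
Qed.

Lemma continuous_for_mul (V : normedModType R) (f g : V -> R) x :
  {for x, continuous f} -> {for x, continuous g} -> {for x, continuous (fun y => f y * g y)}.
Proof. by move=> cf cg; exact: (@continuousM R V f g x cf cg). Qed.

Lemma continuous_for_add (V : normedModType R) (f g : V -> R) x :
  {for x, continuous f} -> {for x, continuous g} -> {for x, continuous (fun y => f y + g y)}.
Proof. by move=> cf cg; exact: (@continuousD R R V f g x cf cg). Qed.

Lemma continuous_for_sum (V : normedModType R) n (f : 'I_n -> V -> R) x :
  (forall i, {for x, continuous (f i)}) -> {for x, continuous (fun y => \sum_i f i y)}.
Proof.
move=> cf; elim: n f cf => [|n ih] f cf.
  rewrite (_ : (fun y => _) = fun=> 0); last by apply/funext => y; rewrite big_ord0.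
  exact: cst_continuous.
rewrite (_ : (fun y => _) = fun y => f ord0 y + \sum_i f (lift ord0 i) y); last first.
  by apply/funext => y; rewrite big_ord_recl.
by apply: continuous_for_add => //; exact: ih.
Qed.

Lemma continuous_for_coord n (j : 'I_n) (x : 'rV[R]_n) :
  {for x, continuous (fun y : 'rV[R]_n => y 0 j)}.
Proof.
apply/continuous_for_closed_ball => e e0; exists e => // y yx.
by apply: le_trans yx; rewrite (le_trans _ (coord_le_norm (y - x) j)) // !mxE.
Qed.

Lemma nbhs_forall_fin (T : topologicalType) (x : T) (I : finType) (P : I -> set T) :
  (forall i, nbhs x (P i)) -> nbhs x [set y | forall i, P i y].
Proof. by move=> h; apply: filter_forall. Qed.

(** The mean value theorem on each segment of the polygonal path that changes one
    coordinate at a time. *)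
Lemma C1_differentiable n (g : 'rV[R]_n -> R) (U : set 'rV[R]_n) x :
  open U -> U x -> (forall y, U y -> forall i, derivable g y (e_ i)) ->
  (forall i, {for x, continuous (partial i g)}) ->
  differentiable g x /\ forall v, 'd g x v = \sum_i v 0 i * partial i g x.
Proof.
move=> oU Ux dg cg.
pose L (v : 'rV[R]_n) : R := \sum_i v 0 i * partial i g x.
have Llin : linear L.
  move=> a v w; rewrite /L scaler_sumr -big_split /=; apply: eq_bigr => i _.
  by rewrite !mxE mulrDl scalerAl.
pose LL : {linear 'rV[R]_n -> R} := HB.pack L (GRing.isLinear.Build _ _ _ _ _ Llin).
have Lc : continuous LL.
  move=> v; rewrite (_ : LL = (fun v => \sum_i v 0 i * partial i g x) :> ('rV[R]_n -> R)) //.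
  apply: continuous_for_sum => i; apply: continuous_for_mul; first exact: continuous_for_coord.
  exact: cst_continuous.
have P : g \o shift x = cst (g x) + LL +o_ (0 : 'rV[R]_n) id.
  apply/eqaddoP => e e0 /=.
  have ne0 : 0 < e / n.+1%:R by rewrite divr_gt0.
  have [d d0 hd] : exists2 d : R, 0 < d & forall y, `|y - x| <= d -> U y /\
      forall i, `|partial i g y - partial i g x| <= e / n.+1%:R.
    apply/nbhs_closed_ball; apply: filterI; first exact: open_nbhs_nbhs.
    apply: nbhs_forall_fin => i; apply/nbhs_closed_ball.
    by move/continuous_for_closed_ball : (cg i); exact.
  apply/nbhs_closed_ball; exists d => // v; rewrite subr0 => vd.
  rewrite /= !fctE /= /cst.
  have [xi xiv E] : exists2 xi : 'I_n -> 'rV[R]_n, (forall i, `|xi i - x| <= `|v|) &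
    g (x + v) - g x = \sum_i v 0 i * partial i g (xi i).
    by apply: mvt_rV => y yv; apply: dg; have [] := hd y (le_trans yv vd).
  rewrite opprD addrA addrC [v + x]addrC E /L -sumrN -big_split /=.
  apply: le_trans (ler_norm_sum _ _ _) _.
  apply: (@le_trans _ _ (\sum_(i < n) `|v| * (e / n.+1%:R))).
    apply: ler_sum => i _; rewrite addrC -mulrBr normrM.
    apply: ler_pM => //; first exact: coord_le_norm.
    by have [_] := hd _ (le_trans (xiv i) vd); exact.
  rewrite sumr_const card_ord -[leLHS]mulr_natr.
  have -> : `|v| * (e / n.+1%:R) * n%:R = (e * `|v|) * (n%:R / n.+1%:R).
    by rewrite mulrA [`|v| * e]mulrC -!mulrA [_^-1 * _]mulrC.
  rewrite ler_piMr ?mulr_ge0 ?(ltW e0) //.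
  by rewrite ler_pdivrMr // mul1r ler_nat.
have E := diff_unique Lc P.
split; last by move=> v; rewrite E.
by apply/diff_locallyP; rewrite E.
Qed.

Lemma partials_rcons n (s : seq 'I_n) i (g : 'rV[R]_n -> R) :
  partials (rcons s i) g = partials s (partial i g).
Proof. by rewrite /partials foldr_rcons. Qed.

Lemma partials_cat n (s t : seq 'I_n) (g : 'rV[R]_n -> R) :
  partials (s ++ t) g = partials s (partials t g).
Proof. by rewrite /partials foldr_cat. Qed.

Section Locality.
Variables (n : nat) (U : set 'rV[R]_n) (f g : 'rV[R]_n -> R).
Hypotheses (oU : open U) (fg : forall x, U x -> f x = g x).

Let near_fg x : U x -> {near x, f =1 g}.
Proof. by move=> Ux; apply: filterS fg _; exact: open_nbhs_nbhs. Qed.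

Lemma derivable_eq_on x i : U x -> derivable f x (e_ i) -> derivable g x (e_ i).
Proof. by move=> Ux; apply: near_eq_derivable; exact: near_fg. Qed.

Lemma partial_eq_on i x : U x -> partial i f x = partial i g x.
Proof. by move=> Ux; apply: near_eq_derive; exact: near_fg. Qed.

Lemma continuous_eq_on x : U x -> {for x, continuous f} -> {for x, continuous g}.
Proof.
move=> Ux /continuous_for_closed_ball cf; apply/continuous_for_closed_ball => e e0.
have [d d0 h] := cf e e0.
have /nbhs_closed_ball [d' d'0 h'] : nbhs x U by exact: open_nbhs_nbhs.
exists (Num.min d d'); first by rewrite lt_min d0.
by move=> y; rewrite le_min => /andP[yd yd']; rewrite -!fg //; [exact: h|exact: h'].
Qed.
End Locality.

(** Partial derivatives are local; this transports computations between functions that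
    agree on an open set only. *)
Lemma partials_eq_on n (U : set 'rV[R]_n) (f g : 'rV[R]_n -> R) s x :
  open U -> (forall x, U x -> f x = g x) -> U x -> partials s f x = partials s g x.
Proof.
move=> oU fg; elim: s x => [|i s ih] x Ux /=; first exact: fg.
exact: partial_eq_on Ux.
Qed.

Section SmoothBasics.
Variables (n : nat).
Implicit Types (U W : set 'rV[R]_n) (f g : 'rV[R]_n -> R).

Lemma smooth_on_continuous U g x : smooth_on U g -> U x -> {for x, continuous g}.
Proof. by move=> sg Ux; have [] := sg [::] x Ux. Qed.

Lemma smooth_on_derivable U g x : smooth_on U g -> U x -> forall i, derivable g x (e_ i).
Proof. by move=> sg Ux; have [_] := sg [::] x Ux; exact. Qed.
Arguments smooth_on_derivable [U g x] _ _ i.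

Lemma smooth_on_partials U g s : smooth_on U g -> smooth_on U (partials s g).
Proof. by move=> sg t x Ux; rewrite -partials_cat; exact: sg. Qed.

Lemma smooth_on_partial U g i : smooth_on U g -> smooth_on U (partial i g).
Proof. by move=> sg; exact: (smooth_on_partials [:: i] sg). Qed.

Lemma smooth_on_subset U W g : U `<=` W -> smooth_on W g -> smooth_on U g.
Proof. by move=> UW sg s x /UW; exact: sg. Qed.

Lemma smooth_smooth_on U g : smooth g -> smooth_on U g.
Proof. by move=> sg; apply: smooth_on_subset sg. Qed.

Lemma smooth_on_eq U f g : open U -> (forall x, U x -> f x = g x) ->
  smooth_on U f -> smooth_on U g.
Proof.
move=> oU fg sf s x Ux; have [c d] := sf s x Ux.
have E y : U y -> partials s f y = partials s g y by exact: partials_eq_on.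
split; first exact: (continuous_eq_on oU E Ux c).
by move=> i; exact: (derivable_eq_on oU E Ux (d i)).
Qed.

Lemma smooth_on_local U g :
  (forall x, U x -> exists2 W, (open W /\ W x) & smooth_on W g) -> smooth_on U g.
Proof. by move=> h s x /h [W [_ Wx] sg]; exact: sg. Qed.

(** Smoothness is a statement on all iterated derivatives; [C] is an invariant that
    contains them, up to equality on [U], so that no formula for them is needed. *)
Lemma smooth_on_coind U (C : ('rV[R]_n -> R) -> Prop) :
  open U ->
  (forall g, C g -> forall x, U x -> {for x, continuous g}) ->
  (forall g, C g -> forall i, exists2 g', C g' & forall x, U x ->
      derivable g x (e_ i) /\ partial i g x = g' x) ->
  forall g, C g -> smooth_on U g.
Proof.
move=> oU Cc Cd g Cg s.
have [g' Cg' E] : exists2 g', C g' & forall x, U x -> partials s g x = g' x.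
  elim: s => [|i s [h Ch hE]]; first by exists g.
  have [h' Ch' h'E] := Cd _ Ch i.
  by exists h' => // x Ux /=; rewrite (partial_eq_on oU hE) //; have [] := h'E x Ux.
move=> x Ux; have E' y : U y -> g' y = partials s g y by move=> /E.
split; first exact: (continuous_eq_on oU E' Ux (Cc _ Cg' _ Ux)).
move=> i; have [h _ /(_ x Ux) [d _]] := Cd _ Cg' i.
exact: (derivable_eq_on oU E' Ux d).
Qed.

Lemma smooth_on_differentiable U g x : open U -> smooth_on U g -> U x ->
  differentiable g x /\ forall v, 'd g x v = \sum_i v 0 i * partial i g x.
Proof.
move=> oU sg Ux; apply: (C1_differentiable oU Ux) => [y Uy i|i].
  exact: (smooth_on_derivable sg Uy i).
exact: (smooth_on_continuous (smooth_on_partial i sg) Ux).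
Qed.

Lemma smooth_on_cst U c : open U -> smooth_on U (fun=> c).
Proof.
move=> oU; pose C g := exists c : R, g = (fun _ : 'rV[R]_n => c).
apply: (@smooth_on_coind U C) => //; last by exists c.
  by move=> g [d ->] x _; exact: cst_continuous.
move=> g [d ->] i; exists (fun=> 0); first by exists 0.
move=> x _; split; first exact: derivable_cst.
by rewrite /partial derive_cst.
Qed.

Lemma smooth_on_add U f g : open U -> smooth_on U f -> smooth_on U g ->
  smooth_on U (fun x => f x + g x).
Proof.
move=> oU sf sg.
pose C h := exists f' g', [/\ smooth_on U f', smooth_on U g' & h = fun x => f' x + g' x].
apply: (@smooth_on_coind U C) => //; last by exists f, g.
  move=> h [f' [g' [sf' sg' ->]]] x Ux; apply: continuousD;
    [exact: (smooth_on_continuous sf' Ux)|exact: (smooth_on_continuous sg' Ux)].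
move=> h [f' [g' [sf' sg' ->]]] i; exists (fun x => partial i f' x + partial i g' x).
  exists (partial i f'), (partial i g').
  by split; [exact: (smooth_on_partial i sf')|exact: (smooth_on_partial i sg')|].
move=> x Ux; have df := smooth_on_derivable sf' Ux i.
have dg := smooth_on_derivable sg' Ux i.
by split; [exact: derivableD|rewrite /partial deriveD].
Qed.

(** The Leibniz rule leads out of the products, but not out of their sums. *)
Inductive sum_of_products U : ('rV[R]_n -> R) -> Prop :=
| SumProd1 f g : smooth_on U f -> smooth_on U g -> sum_of_products U (fun x => f x * g x)
| SumProdD f g : sum_of_products U f -> sum_of_products U g ->
    sum_of_products U (fun x => f x + g x).

Lemma smooth_on_mul U f g : open U -> smooth_on U f -> smooth_on U g ->
  smooth_on U (fun x => f x * g x).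
Proof.
move=> oU sf sg.
apply: (@smooth_on_coind U (sum_of_products U)) => //; last exact: SumProd1.
  move=> h; elim=> [f' g' sf' sg' x Ux|f' g' _ cf _ cg x Ux].
    by apply: continuousM; [exact: (smooth_on_continuous sf' Ux)|exact: (smooth_on_continuous sg' Ux)].
  by apply: continuousD; [exact: cf|exact: cg].
move=> h; elim=> [f' g' sf' sg' i|f' g' _ cf _ cg i].
  exists (fun x => f' x * partial i g' x + partial i f' x * g' x).
    exact: (SumProdD (SumProd1 sf' (smooth_on_partial i sg')) (SumProd1 (smooth_on_partial i sf') sg')).
  move=> x Ux; have df := smooth_on_derivable sf' Ux i.
  have dg := smooth_on_derivable sg' Ux i.
  split; first exact: (derivableM df dg).
  by apply: (etrans (deriveM df dg)); rewrite [in RHS](mulrC (partial i f' x)).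
have [f1 Cf1 hf1] := cf i; have [g1 Cg1 hg1] := cg i.
exists (fun x => f1 x + g1 x); first exact: SumProdD.
move=> x Ux; have [df Ef] := hf1 x Ux; have [dg Eg] := hg1 x Ux.
by split; [exact: derivableD|rewrite /partial deriveD // -Ef -Eg].
Qed.

Lemma smooth_on_scale U c f : open U -> smooth_on U f -> smooth_on U (fun x => c * f x).
Proof. by move=> oU sf; exact: (smooth_on_mul oU (smooth_on_cst c oU) sf). Qed.

Lemma smooth_on_opp U f : open U -> smooth_on U f -> smooth_on U (fun x => - f x).
Proof.
move=> oU sf; apply: smooth_on_eq (smooth_on_scale (-1) oU sf) => // x _.
by rewrite mulN1r.
Qed.

Lemma smooth_on_sub U f g : open U -> smooth_on U f -> smooth_on U g ->
  smooth_on U (fun x => f x - g x).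
Proof. by move=> oU sf sg; exact: (smooth_on_add oU sf (smooth_on_opp oU sg)). Qed.

Lemma smooth_on_sum U (I : Type) (r : seq I) (P : pred I) (F : I -> 'rV[R]_n -> R) :
  open U -> (forall i, P i -> smooth_on U (F i)) ->
  smooth_on U (fun x => \sum_(i <- r | P i) F i x).
Proof.
move=> oU sF; elim: r => [|i r ih].
  by apply: smooth_on_eq (smooth_on_cst 0 oU) => // x _; rewrite big_nil.
case Pi : (P i).
  apply: smooth_on_eq (smooth_on_add oU (sF i Pi) ih) => // x _.
  by rewrite big_cons Pi.
by apply: smooth_on_eq ih => // x _; rewrite big_cons Pi.
Qed.

Lemma smooth_on_prod U (I : Type) (r : seq I) (P : pred I) (F : I -> 'rV[R]_n -> R) :
  open U -> (forall i, P i -> smooth_on U (F i)) ->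
  smooth_on U (fun x => \prod_(i <- r | P i) F i x).
Proof.
move=> oU sF; elim: r => [|i r ih].
  by apply: smooth_on_eq (smooth_on_cst 1 oU) => // x _; rewrite big_nil.
case Pi : (P i).
  apply: smooth_on_eq (smooth_on_mul oU (sF i Pi) ih) => // x _.
  by rewrite big_cons Pi.
by apply: smooth_on_eq ih => // x _; rewrite big_cons Pi.
Qed.

Lemma is_derive_coord (j i : 'I_n) (x : 'rV[R]_n) :
  is_derive x (e_ i) (fun y : 'rV[R]_n => y 0 j) ((j == i)%:R : R).
Proof.
have dd := @differentiable_coord R 1 n x 0 j.
pose c : 'rV[R]_n -> R := fun y => y 0 j.
have clin : linear c by move=> a u v; rewrite /c !mxE.
pose cc : {linear 'rV[R]_n -> R} := HB.pack c (GRing.isLinear.Build _ _ _ _ _ clin).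
have cd : continuous cc by exact: coord_continuous.
apply: DeriveDef; first exact: diff_derivable.
by rewrite deriveE // (@diff_lin _ _ _ cc x cd) /= /c mxE eqxx.
Qed.

Lemma smooth_on_coord U j : open U -> smooth_on U (fun x => x 0 j).
Proof.
move=> oU.
pose C g := exists a b : R, g = (fun x : 'rV[R]_n => a * x 0 j + b).
apply: (@smooth_on_coind U C) => //;
  last by exists 1, 0; apply/funext => x; rewrite mul1r addr0.
  move=> g [a [b ->]] x _; apply: continuousD; last exact: cst_continuous.
  apply: continuousM; first exact: cst_continuous.
  exact: continuous_for_coord.
move=> g [a [b ->]] i; exists (fun=> a * (j == i)%:R).
  by exists 0, (a * (j == i)%:R); apply/funext => x; rewrite mul0r add0r.
move=> x _; have [dx Dx] := is_derive_coord j i x.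
have da := @derivable_cst R _ _ a x (e_ i); have db := @derivable_cst R _ _ b x (e_ i).
have dax := @derivableM _ _ _ _ _ _ da dx.
split; first exact: (derivableD dax db).
apply: (etrans (deriveD dax db)); rewrite derive_cst addr0.
by apply: (etrans (deriveM da dx)); rewrite derive_cst scaler0 addr0 Dx.
Qed.

End SmoothBasics.
End Calculus.
Arguments smooth_on_derivable {R n U g x} _ _ i.

(** * The chain rule and the rules for partial derivatives *)

Section Chain.
Context {R : realType}.
Local Notation e_ i := (delta_mx 0 i).

Lemma is_derive_lineE (V W : normedModType R) (f : V -> W) x v df :
  is_derive (0 : R) 1 (fun h : R => f (h *: v + x)) df <-> is_derive x v f df.
Proof.
have E : (fun h : R => h^-1 *: (f ((h *: (1 : R) + 0) *: v + x) - f ((0 : R) *: v + x))) =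
  (fun h : R => h^-1 *: (f (h *: v + x) - f x)).
  by apply/funext => h; rewrite scale0r add0r addr0 [h *: 1]mulr1.
split=> -[D E'].
  split; first by rewrite /derivable -E.
  by rewrite /derive -E.
split; first by rewrite /derivable E.
by rewrite /derive E.
Qed.

(** Along a line the composition is a function of one variable; only the
    coordinates of [io] have to be differentiable there. *)
Lemma is_derive_comp_rV (V : normedModType R) m (io : V -> 'rV[R]_m) (h : 'rV[R]_m -> R)
    (x v : V) (dio : 'I_m -> R) :
  (forall j, is_derive x v (fun y => io y 0 j) (dio j)) ->
  differentiable h (io x) ->
  is_derive x v (fun y => h (io y)) (\sum_j dio j * 'd h (io x) (e_ j)).
Proof.
move=> dj dfh; apply/is_derive_lineE.
pose g (t : R) := io (t *: v + x).
have g0 : g 0 = io x by rewrite /g scale0r add0r.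
have dgj j : is_derive (0 : R) 1 (fun t => g t 0 j) (dio j).
  exact: (is_derive_lineE (fun y => io y 0 j) x v (dio j)).2.
have dg : derivable g 0 1.
  by apply/derivable_mxP => i j; rewrite (ord1 i); have [] := dgj j.
have Dg := derive_mx dg.
have dfg : differentiable g 0 by apply/derivable1_diffP.
have dfh0 : differentiable h (g 0) by rewrite g0.
have dc : differentiable (h \o g) 0 by exact: differentiable_comp.
have Dc : 'D_1 (h \o g) 0 = \sum_j dio j * 'd h (io x) (e_ j).
  have Eg : 'd g 0 1 = 'D_1 g 0 by rewrite (deriveE _ dfg).
  rewrite (deriveE _ dc) (diff_comp dfg dfh0) /= Eg Dg g0.
  have -> : \matrix_(i < 1, j < m) 'D_1 (fun t : R => g t i j) 0 =
     \sum_j dio j *: (e_ j : 'rV[R]_m).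
    apply/rowP => j; rewrite !mxE summxE (bigD1 j) //= big1 => [|k kj].
      by rewrite !mxE !eqxx mulr1 addr0; have [] := dgj j.
    by rewrite !mxE eqxx eq_sym (negbTE kj) mulr0.
  by rewrite linear_sum; apply: eq_bigr => j _; rewrite linearZ.
by split; [exact: diff_derivable|exact: Dc].
Qed.

Lemma is_derive_mul (V : normedModType R) (f g : V -> R) x v (df dg : R) :
  is_derive x v f df -> is_derive x v g dg ->
  is_derive x v (fun y => f y * g y) (df * g x + f x * dg).
Proof.
move=> [f' <-] [g' <-]; split; first exact: (derivableM f' g').
by rewrite [LHS](deriveM f' g') /GRing.scale /= [g x * _]mulrC [LHS]addrC.
Qed.

Lemma is_derive_add (V : normedModType R) (f g : V -> R) x v (df dg : R) :
  is_derive x v f df -> is_derive x v g dg ->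
  is_derive x v (fun y => f y + g y) (df + dg).
Proof.
move=> [f' <-] [g' <-]; split; first exact: (derivableD f' g').
by rewrite [LHS](deriveD f' g').
Qed.

Lemma is_derive_scale (V : normedModType R) (c : R) (g : V -> R) x v (dg : R) :
  is_derive x v g dg -> is_derive x v (fun y => c * g y) (c * dg).
Proof.
move=> Dg; have D := is_derive_mul (is_derive_cst c x v) Dg.
by rewrite mul0r add0r in D.
Qed.

Section SmoothComp.
Variables (n m : nat) (U : set 'rV[R]_n) (W : set 'rV[R]_m) (io : 'rV[R]_n -> 'rV[R]_m).
Hypotheses (oU : open U) (oW : open W).
Hypothesis sio : forall j, smooth_on U (fun x => io x 0 j).
Hypothesis UW : forall x, U x -> W (io x).

Lemma is_derive_comp_smooth h x (i : 'I_n) : smooth_on W h -> U x ->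
  is_derive x (e_ i) (fun y => h (io y))
    (\sum_j partial i (fun y => io y 0 j) x * partial j h (io x)).
Proof.
move=> sh Ux; have [dh Dh] := smooth_on_differentiable oW sh (UW Ux).
apply: is_derive_eq.
  apply: (@is_derive_comp_rV _ _ io h x (e_ i) (fun j => partial i (fun y => io y 0 j) x)) => //.
    by move=> j; apply: DeriveDef => //; exact: (smooth_on_derivable (sio j) Ux).
apply: eq_bigr => j _; congr (_ * _); rewrite Dh (bigD1 j) //= big1 => [|k kj].
  by rewrite mxE !eqxx mul1r addr0.
by rewrite mxE eqxx (negbTE kj) mul0r.
Qed.

Lemma continuous_comp_smooth (h : 'rV[R]_m -> R) x : {for io x, continuous h} -> U x ->
  {for x, continuous (fun y => h (io y))}.
Proof.
move=> /continuous_for_closed_ball ch Ux; apply/continuous_for_closed_ball => e e0.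
have [d d0 hd] := ch e e0.
have : nbhs x [set y | forall j, `|io y 0 j - io x 0 j| <= d].
  apply: nbhs_forall_fin => j; apply/nbhs_closed_ball.
  exact: ((continuous_for_closed_ball _ _).1 (smooth_on_continuous (sio j) Ux) d d0).
move=> /nbhs_closed_ball [d' d'0 h']; exists d' => // y /h' /= H; apply: hd.
by apply: norm_le_coord => [|j]; [exact: ltW|rewrite !mxE].
Qed.

(** The smallest class that contains [h o io] and is stable under the chain rule. *)
Inductive pullback_class : ('rV[R]_n -> R) -> Prop :=
| Pullback1 a h : smooth_on U a -> smooth_on W h -> pullback_class (fun x => a x * h (io x))
| PullbackD f g : pullback_class f -> pullback_class g -> pullback_class (fun x => f x + g x).

Lemma pullback_class_sum k (F : 'I_k -> 'rV[R]_n -> R) :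
  (forall j, pullback_class (F j)) -> pullback_class (fun x => \sum_j F j x).
Proof.
elim: k F => [|k ih] F hF.
  rewrite (_ : (fun x => _) = (fun x => (fun=> 0) x * (fun=> 0) (io x))).
    by apply: (@Pullback1 (fun=> 0) (fun=> 0)); exact: smooth_on_cst.
  by apply/funext => x; rewrite big_ord0 mul0r.
rewrite (_ : (fun x => _) = (fun x => F ord0 x + \sum_j F (lift ord0 j) x)).
  by apply: PullbackD => //; apply: ih => j.
by apply/funext => x; rewrite big_ord_recl.
Qed.

Lemma smooth_on_comp h : smooth_on W h -> smooth_on U (fun x => h (io x)).
Proof.
move=> sh; apply: (@smooth_on_eq _ _ _ (fun x => 1 * h (io x))) => //.
  by move=> x _; rewrite mul1r.
apply: (@smooth_on_coind _ _ U pullback_class) => //; last first.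
- exact: (Pullback1 (smooth_on_cst 1 oU) sh).
- move=> g; elim=> [a k sa sk i|f k _ If _ Ik i].
    exists (fun x => partial i a x * k (io x) +
        \sum_j (a x * partial i (fun y => io y 0 j) x) * partial j k (io x)).
      apply: PullbackD; first exact: (Pullback1 (smooth_on_partial i sa) sk).
      apply: pullback_class_sum => j.
      exact: (Pullback1 (smooth_on_mul oU sa (smooth_on_partial i (sio j)))
        (smooth_on_partial j sk)).
    move=> x Ux; have da := DeriveDef (smooth_on_derivable sa Ux i) erefl.
    have [? EE] := is_derive_mul da (is_derive_comp_smooth i sk Ux).
    split=> //; rewrite [LHS]EE; congr (_ + _); rewrite mulr_sumr; apply: eq_bigr => j _.
    by rewrite mulrA.
  have [f1 Cf1 hf1] := If i; have [g1 Cg1 hg1] := Ik i.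
  exists (fun x => f1 x + g1 x); first exact: PullbackD.
  move=> x Ux; have [df Ef] := hf1 x Ux; have [dg Eg] := hg1 x Ux.
  by have [? EE] := is_derive_add (DeriveDef df Ef) (DeriveDef dg Eg).
- move=> g; elim=> [a k sa sk x Ux|f k _ If _ Ik x Ux].
    apply: continuous_for_mul; first exact: (smooth_on_continuous sa Ux).
    apply: continuous_comp_smooth => //.
    exact: (smooth_on_continuous sk (UW Ux)).
  by apply: continuous_for_add; [exact: If|exact: Ik].
Qed.

End SmoothComp.

(** Derivatives of [e o g] are sums of products of derivatives of [g] with [e' o g],
    where [e'] is again in the family [E]: smoothness of the outer functions enters
    only through the stability of [E] under differentiation. *)
Section SmoothComp1.
Variables (n : nat) (U : set 'rV[R]_n) (W : set R) (E : (R -> R) -> Prop) (g : 'rV[R]_n -> R).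
Hypotheses (oU : open U) (sg : smooth_on U g) (UW : forall x, U x -> W (g x)).
Hypothesis Eder : forall e, E e -> exists2 e', E e' & forall t, W t -> is_derive t 1 e (e' t).

Lemma is_derive_comp1 (V : normedModType R) (e : R -> R) (k : V -> R) x v e' k' :
  is_derive (k x) 1 e e' -> is_derive x v k k' -> is_derive x v (fun y => e (k y)) (k' * e').
Proof.
move=> [de De] dk; apply/is_derive_lineE.
pose kk (h : R) : R := k (h *: v + x).
have kk0 : kk 0 = k x by rewrite /kk scale0r add0r.
have [dk' Dk'] : is_derive (0 : R) 1 kk k' by apply/is_derive_lineE.
have df1 : differentiable kk 0 by apply/derivable1_diffP.
rewrite -kk0 in de De.
have df2 : differentiable e (kk 0) by apply/derivable1_diffP.
have dc : differentiable (e \o kk) 0 by exact: differentiable_comp.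
have Dc : 'D_1 (e \o kk) 0 = k' * e'.
  have E1 : 'd kk 0 1 = k' by rewrite -(deriveE _ df1) Dk'.
  have E3 (t : R) : 'd e (kk 0) t = t * e'.
    by rewrite (deriv1E de) derive1E De.
  rewrite (deriveE _ dc) (diff_comp df1 df2).
  change ('d e (kk 0) ('d kk 0 1) = k' * e').
  by rewrite E3 E1.
by split; [exact: diff_derivable|exact: Dc].
Qed.

Inductive pullback1_class : ('rV[R]_n -> R) -> Prop :=
| Pullback11 a e : smooth_on U a -> E e -> pullback1_class (fun x => a x * e (g x))
| Pullback1D f k : pullback1_class f -> pullback1_class k -> pullback1_class (fun x => f x + k x).

Lemma smooth_on_comp1 e : E e -> smooth_on U (fun x => e (g x)).
Proof.
move=> Ee; apply: (@smooth_on_eq _ _ _ (fun x => 1 * e (g x)) _ oU).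
  by move=> x _; rewrite mul1r.
apply: (@smooth_on_coind _ _ U pullback1_class) => //; last first.
- exact: (Pullback11 (smooth_on_cst 1 oU) Ee).
- move=> f; elim=> [a k sa Ek i|f1 k _ If _ Ik i].
    have [k' Ek' Dk'] := Eder Ek.
    exists (fun x => partial i a x * k (g x) + (a x * partial i g x) * k' (g x)).
      apply: Pullback1D; first exact: (Pullback11 (smooth_on_partial i sa) Ek).
      exact: (Pullback11 (smooth_on_mul oU sa (smooth_on_partial i sg)) Ek').
    move=> x Ux; have da := DeriveDef (smooth_on_derivable sa Ux i) erefl.
    have dg := DeriveDef (smooth_on_derivable sg Ux i) erefl.
    have [? EE] := is_derive_mul da (is_derive_comp1 (Dk' _ (UW Ux)) dg).
    by split=> //; rewrite [LHS]EE mulrA.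
  have [f2 Cf2 hf2] := If i; have [g2 Cg2 hg2] := Ik i.
  exists (fun x => f2 x + g2 x); first exact: Pullback1D.
  move=> x Ux; have [df Ef] := hf2 x Ux; have [dg Eg] := hg2 x Ux.
  by have [? EE] := is_derive_add (DeriveDef df Ef) (DeriveDef dg Eg).
- move=> f; elim=> [a k sa Ek x Ux|f1 k _ If _ Ik x Ux].
    apply: continuous_for_mul; first exact: (smooth_on_continuous sa Ux).
    have [k' _ /(_ _ (UW Ux)) [dk _]] := Eder Ek.
    have ck : {for g x, continuous k}.
      by apply: differentiable_continuous; apply/derivable1_diffP.
    exact: (continuous_comp (smooth_on_continuous sg Ux) ck).
  by apply: continuous_for_add; [exact: If|exact: Ik].
Qed.
End SmoothComp1.

Section PartialRules.
Variables (n : nat) (U : set 'rV[R]_n).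
Implicit Types (f g : 'rV[R]_n -> R).

Lemma is_derive_partial f i x : smooth_on U f -> U x -> is_derive x (e_ i) f (partial i f x).
Proof. by move=> sf Ux; exact: (DeriveDef (smooth_on_derivable sf Ux i) erefl). Qed.

Lemma partialD f g i x : smooth_on U f -> smooth_on U g -> U x ->
  partial i (fun y => f y + g y) x = partial i f x + partial i g x.
Proof.
move=> sf sg Ux.
by have [_] := is_derive_add (is_derive_partial i sf Ux) (is_derive_partial i sg Ux).
Qed.

Lemma partialM f g i x : smooth_on U f -> smooth_on U g -> U x ->
  partial i (fun y => f y * g y) x = partial i f x * g x + f x * partial i g x.
Proof.
move=> sf sg Ux.
by have [_] := is_derive_mul (is_derive_partial i sf Ux) (is_derive_partial i sg Ux).
Qed.

Lemma partial_cst c i x : partial i (fun _ : 'rV[R]_n => c) x = 0.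
Proof. by rewrite /partial derive_cst. Qed.

Lemma partial_coord i j (x : 'rV[R]_n) : partial i (fun y : 'rV[R]_n => y 0 j) x = (j == i)%:R.
Proof. by have [] := is_derive_coord j i x. Qed.

Lemma partialZ c f i x : smooth_on U f -> U x ->
  partial i (fun y => c * f y) x = c * partial i f x.
Proof.
by move=> sf Ux; have [_] := is_derive_scale c (is_derive_partial i sf Ux).
Qed.

Lemma partialB f g i x : smooth_on U f -> smooth_on U g -> U x ->
  partial i (fun y => f y - g y) x = partial i f x - partial i g x.
Proof.
move=> sf sg Ux.
have [_ E] := is_derive_add (is_derive_partial i sf Ux)
  (is_derive_scale (-1) (is_derive_partial i sg Ux)).
rewrite -[X in _ - X]mul1r -mulNr -[RHS]E; congr (partial i _ x).
by apply/funext => y; rewrite mulN1r.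
Qed.

Lemma partial_sum m (F : 'I_m -> 'rV[R]_n -> R) i x : (forall k, smooth_on U (F k)) -> U x ->
  partial i (fun y => \sum_k F k y) x = \sum_k partial i (F k) x.
Proof.
move=> sF Ux; rewrite /partial.
rewrite (_ : (fun y => \sum_k F k y) = \sum_k F k); last first.
  by apply/funext => y; rewrite fct_sumE.
by rewrite derive_sum // => k; exact: (smooth_on_derivable (sF k) Ux i).
Qed.
End PartialRules.

Lemma smooth_cst n (c : R) : smooth (fun _ : 'rV[R]_n => c).
Proof. exact: smooth_on_cst openT. Qed.
Lemma smooth_coord n j : smooth (fun x : 'rV[R]_n => x 0 j).
Proof. exact: smooth_on_coord openT. Qed.
Lemma smooth_add n (f g : 'rV[R]_n -> R) : smooth f -> smooth g -> smooth (fun x => f x + g x).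
Proof. exact: smooth_on_add openT. Qed.
Lemma smooth_sub n (f g : 'rV[R]_n -> R) : smooth f -> smooth g -> smooth (fun x => f x - g x).
Proof. exact: smooth_on_sub openT. Qed.
Lemma smooth_opp n (f : 'rV[R]_n -> R) : smooth f -> smooth (fun x => - f x).
Proof. exact: smooth_on_opp openT. Qed.
Lemma smooth_mul n (f g : 'rV[R]_n -> R) : smooth f -> smooth g -> smooth (fun x => f x * g x).
Proof. exact: smooth_on_mul openT. Qed.
Lemma smooth_scale n (c : R) (g : 'rV[R]_n -> R) : smooth g -> smooth (fun x => c * g x).
Proof. exact: smooth_on_scale openT. Qed.
Lemma smooth_sum n (I : Type) (r : seq I) (P : pred I) (F : I -> 'rV[R]_n -> R) :
  (forall i, P i -> smooth (F i)) -> smooth (fun x => \sum_(i <- r | P i) F i x).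
Proof. exact: smooth_on_sum openT. Qed.
Lemma smooth_prod n (I : Type) (r : seq I) (P : pred I) (F : I -> 'rV[R]_n -> R) :
  (forall i, P i -> smooth (F i)) -> smooth (fun x => \prod_(i <- r | P i) F i x).
Proof. exact: smooth_on_prod openT. Qed.
Lemma smooth_partial n i (f : 'rV[R]_n -> R) : smooth f -> smooth (partial i f).
Proof. exact: smooth_on_partial. Qed.
Lemma smooth_partials n s (f : 'rV[R]_n -> R) : smooth f -> smooth (partials s f).
Proof. exact: smooth_on_partials. Qed.
Lemma smooth_comp n m (io : 'rV[R]_n -> 'rV[R]_m) (h : 'rV[R]_m -> R) :
  (forall j, smooth (fun x => io x 0 j)) -> smooth h -> smooth (fun x => h (io x)).
Proof. by move=> sio; apply: smooth_on_comp => //; exact: openT. Qed.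
Lemma smooth_continuous n (f : 'rV[R]_n -> R) x : smooth f -> {for x, continuous f}.
Proof. by move=> sf; exact: (smooth_on_continuous sf). Qed.
Lemma smooth_derivable n (f : 'rV[R]_n -> R) x i : smooth f -> derivable f x (e_ i).
Proof. by move=> sf; exact: (smooth_on_derivable sf). Qed.

End Chain.

(** * Lebesgue measure on tuples *)

Section LebesgueTuple.
Context {R : realType}.
Local Notation mR := (measurableTypeR R).
Local Notation tupR n := (n.-tuple mR).
Local Open Scope ereal_scope.

(** Measures on tuples are built one coordinate at a time, in the order in which
    [integral_rV] integrates. *)
Definition tcons n (p : (mR * tupR n)%type) : tupR n.+1 := [the n.+1.-tuple mR of p.1 :: p.2].

Lemma measurable_tcons n : measurable_fun [set: (mR * tupR n)%type] (@tcons n).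
Proof. by apply: measurable_cons. Qed.

Section Step.
Variables (n : nat) (m : {sigma_finite_measure set (tupR n) -> \bar R}).

Definition leb_step : set (tupR n.+1) -> \bar R :=
  pushforward (lebesgue_measure \x m) (@tcons n).

HB.instance Definition _ := Measure.copy leb_step
  (measure_function_pushforward__canonical__measure_function_Measure
     (lebesgue_measure \x m) (@measurable_tcons n)).

Lemma leb_step_sigma_finite : sigma_finite setT leb_step.
Proof.
have [F UF mF] := sigma_finiteT m.
have [G UG mG] := sigma_finiteT (@lebesgue_measure R).
have [f ff] : exists f : nat -> nat * nat, forall p, exists k, f k = p.
  exists (fun k => odflt (0%N, 0%N) (unpickle k)) => p.
  by exists (pickle p); rewrite pickleK.
pose H (p : nat * nat) : set (tupR n.+1) :=
  [set t | G p.1 (thead t) /\ F p.2 [tuple of behead t]].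
have HE p : (@tcons n) @^-1` (H p) = G p.1 `*` F p.2.
  apply/seteqP; split=> -[a b] /=; rewrite /H /tcons /= theadE => -[Ga Fb]; split => //=.
    by move: Fb; congr (F _ _); apply/val_inj.
  by move: Fb; congr (F _ _); apply/val_inj.
exists (H \o f).
  apply/seteqP; split=> // t _.
  have [i _ Gi] : (\bigcup_i G i) (thead t) by rewrite -UG.
  have [j _ Fj] : (\bigcup_i F i) [tuple of behead t] by rewrite -UF.
  by have [k fk] := ff (i, j); exists k => //=; rewrite fk.
move=> k /=; split.
  apply: measurableI.
    rewrite -[X in measurable X]setTI; apply: (@measurable_tnth _ mR n.+1 ord0) => //.
    exact: (mG _).1.
  by rewrite -[X in measurable X]setTI; apply: measurable_behead => //; exact: (mF _).1.
rewrite /leb_step /pushforward HE product_measure1E; [|exact: (mG _).1|exact: (mF _).1].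
by apply: lte_mul_pinfty => //; [rewrite ge0_fin_numE //; exact: (mG _).2|exact: (mF _).2].
Qed.

HB.instance Definition _ := @Measure_isSigmaFinite.Build _ _ _ leb_step leb_step_sigma_finite.

Definition leb_step_sf : {sigma_finite_measure set (tupR n.+1) -> \bar R} := leb_step.
End Step.

Fixpoint leb n : {sigma_finite_measure set (tupR n) -> \bar R} :=
  match n with
  | 0 => \d_([tuple] : tupR 0)
  | k.+1 => leb_step_sf (leb k)
  end.

Local Open Scope ring_scope.

Definition row_of n (t : tupR n) : 'rV[R]_n := \row_i tnth t i.
Definition tup_of n (x : 'rV[R]_n) : tupR n := [tuple x 0 i | i < n].

Lemma tup_ofK n : cancel (@tup_of n) (@row_of n).
Proof. by move=> x; apply/rowP => i; rewrite mxE tnth_mktuple. Qed.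

Lemma row_of_tcons n t (y : tupR n) :
  row_of (tcons (t, y)) = row_mx (t%:M : 'rV[R]_1) (row_of y) :> 'rV[R]_(1 + n).
Proof.
apply/rowP => i; rewrite mxE; case: (splitP i) => j Hj.
  have -> : i = lshift n j by apply/val_inj; rewrite /= Hj.
  rewrite row_mxEl !mxE (ord1 j) /= (_ : lshift n 0 = ord0); last exact/val_inj.
  by rewrite tnth0.
have -> : i = rshift 1 j by apply/val_inj; rewrite /= Hj.
rewrite row_mxEr mxE /= (_ : rshift 1 j = lift ord0 j); last exact/val_inj.
by rewrite tnthS.
Qed.

Definition mrV n (F : 'rV[R]_n -> R) := measurable_fun setT (fun t : tupR n => F (row_of t)).
Definition mset n (A : set 'rV[R]_n) := measurable [set t : tupR n | A (row_of t)].

Lemma measurable_comp_rV d (T : measurableType d) n (g : T -> 'rV[R]_n) d'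
    (T' : measurableType d') (F : 'rV[R]_n -> T') :
  (forall i, measurable_fun setT (fun w => g w 0 i)) ->
  measurable_fun setT (fun t : tupR n => F (row_of t)) ->
  measurable_fun setT (fun w => F (g w)).
Proof.
move=> mg mF; have mt : measurable_fun setT (fun w => tup_of (g w) : tupR n).
  apply/measurable_fun_tnthP => i.
  by apply: eq_measurable_fun (mg i) => w _; rewrite /= tnth_mktuple.
rewrite (_ : (fun w => F (g w)) = (fun t => F (row_of t)) \o (fun w => tup_of (g w))).
  exact: measurableT_comp mF mt.
by apply/funext => w; rewrite /= tup_ofK.
Qed.

Lemma mrV_coord n i : mrV (fun x : 'rV[R]_n => x 0 i).
Proof.
rewrite /mrV (_ : (fun t => _) = fun t => tnth t i); first exact: measurable_tnth.
by apply/funext => t; rewrite mxE.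
Qed.

Lemma mset_box n (I : 'I_n -> interval R) : mset [set x : 'rV[R]_n | forall i, x 0 i \in I i].
Proof.
rewrite /mset (_ : [set t | _] = \bigcap_(i in [set: 'I_n]) ((fun t : tupR n => tnth t i) @^-1` [set` I i])).
  apply: fin_bigcap_measurable => // i _.
  by rewrite -[X in measurable X]setTI; apply: measurable_tnth => //; exact: measurable_itv.
apply/seteqP; split=> t /= h i; first by move=> _; have := h i; rewrite mxE.
by rewrite mxE; exact: h.
Qed.

(** An open set is a countable union of boxes with rational vertices. *)
Lemma mset_open n (O : set 'rV[R]_n) : open O -> mset O.
Proof.
move=> oO.
pose box (p : 'rV[rat]_n * nat) : set 'rV[R]_n :=
  [set x | forall i, x 0 i \in `[ratr (p.1 0 i) - p.2.+1%:R^-1, ratr (p.1 0 i) + p.2.+1%:R^-1]].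
pose B k : set 'rV[R]_n := if unpickle k is Some p then
  (if `[< box p `<=` O >] then box p else set0) else set0.
have -> : O = \bigcup_k B k.
  apply/seteqP; split=> [x Ox|x [k _]]; last first.
    by rewrite /B; case: unpickle => // p; case: asboolP => // h /h.
  have /nbhs_closed_ball [d d0 dO] : nbhs x O by exact: open_nbhs_nbhs.
  pose k := Num.truncn ((2 / d)).
  have kd : 2 * k.+1%:R^-1 < d.
    rewrite ltr_pdivrMr // mulrC -ltr_pdivrMr // .
    exact: truncnS_gt.
  have [q hq] : exists q : 'rV[rat]_n, forall i, x 0 i - k.+1%:R^-1 < ratr (q 0 i) < x 0 i + k.+1%:R^-1.
    have H i : exists q : rat, x 0 i - k.+1%:R^-1 < ratr q < x 0 i + k.+1%:R^-1.
      have [|q] := @rat_in_itvoo R (x 0 i - k.+1%:R^-1) (x 0 i + k.+1%:R^-1).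
        by rewrite ltrD2l gtrN // invr_gt0.
      by rewrite in_itv /= => ?; exists q.
    have [f hf] := choice H.
    by exists (\row_i f i) => i; rewrite mxE.
  exists (pickle (q, k)) => //; rewrite /B pickleK; case: asboolP => [_|h].
    move=> i /=; rewrite in_itv /=; have := hq i.
    by move: (ratr (q 0 i)) (k.+1%:R^-1) => r w /andP[h1 h2]; apply/andP; split; lra.
  exfalso; apply: h => y hy; apply: dO; apply: norm_le_coord => [|i]; first exact: ltW.
  rewrite !mxE; have := hy i; rewrite /= in_itv /=; have := hq i.
  move: (ratr (q 0 i)) (k.+1%:R^-1 : R) kd => r w kd /andP[h3 h4] /andP[h1 h2].
  by rewrite ler_norml; apply/andP; split; lra.
rewrite /mset (_ : [set t | _] = \bigcup_k [set t | B k (row_of t)]) //.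
apply: bigcup_measurable => k _; rewrite /B.
case: unpickle => [p|]; last exact: measurable0.
by case: asboolP => _; [exact: mset_box|exact: measurable0].
Qed.

(** The part in [D] of the set where [g > a] is the trace on [D] of an open set, and
    outside [D] the function is zero. *)
Lemma mrV_within n (D : set 'rV[R]_n) (f g : 'rV[R]_n -> R) : mset D ->
  (forall y, D y -> forall e : R, 0 < e -> exists2 d : R, 0 < d &
     forall y', D y' -> `|y' - y| <= d -> `|f y' - f y| <= e) ->
  (forall y, D y -> g y = f y) -> (forall y, ~ D y -> g y = 0) -> mrV g.
Proof.
move=> mD cf gf g0.
apply: (measurability _ (RGenOInfty.measurableE R)) => // _ [_ [a ->] <-].
rewrite setTI.
pose O : set 'rV[R]_n := [set z | exists y, exists d : R,
  [/\ `|z - y| < d & forall y', D y' -> `|y' - y| < d -> a < f y']].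
have oO : open O.
  rewrite openE => z [y [d [zy h]]]; apply/nbhs_closed_ball.
  exists ((d - `|z - y|) / 2); first by rewrite divr_gt0 // subr_gt0.
  move=> z' zz'; exists y, d; split => //.
  rewrite -(subrK z z') -addrA (le_lt_trans (ler_normD _ _)) //; lra.
have DO y : D y -> a < f y <-> O y.
  move=> Dy; split=> [af|[y0 [d [yy0 h]]]]; last exact: h.
  have e0 : 0 < (f y - a) / 2 by rewrite divr_gt0 // subr_gt0.
  have [d d0 hd] := cf y Dy _ e0.
  exists y, d; split; first by rewrite subrr normr0.
  move=> y' Dy' /ltW yd; have := hd y' Dy' yd; rewrite ler_norml => /andP[h _]; lra.
have mO := mset_open oO.
rewrite (_ : _ @^-1` _ = ([set t | D (row_of t)] `&` [set t | O (row_of t)]) `|`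
   (if a < 0 then ~` [set t : tupR n | D (row_of t)] else set0)).
  apply: measurableU; first exact: measurableI.
  by case: ifP => _; [exact: measurableC|exact: measurable0].
apply/seteqP; split=> t /=; rewrite in_itv /= andbT.
  move=> ag; have [Dt|Dt] := pselect (D (row_of t)).
    by left; split => //; apply/DO => //; rewrite -gf.
  by right; move: ag; rewrite g0 // => ->.
case=> [[Dt Ot]|]; first by rewrite gf //; exact/DO.
by case: ifP => // a0 Dt; rewrite g0.
Qed.

Lemma mrV_continuous n (f : 'rV[R]_n -> R) : (forall x, {for x, continuous f}) -> mrV f.
Proof.
move=> cf; apply: (@mrV_within n setT f f) => //.
- exact: measurableT.
- move=> y _ e e0; have [d d0 h] := (continuous_for_closed_ball f y).1 (cf y) e e0.
  by exists d => // y' _; exact: h.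
- by move=> y /(_ I).
Qed.

Lemma mrV_smooth n (f : 'rV[R]_n -> R) : smooth f -> mrV f.
Proof. by move=> sf; apply: mrV_continuous => x; exact: smooth_continuous. Qed.

(** The image of Lebesgue measure under an affine map is determined by its values on
    intervals. *)
Lemma lebesgue_affine1 (a s : R) (F : R -> \bar R) : s != 0 ->
  measurable_fun setT F -> (forall t, (0 <= F t)%E) ->
  (\int[lebesgue_measure]_t F (a + s * t)%R = `|s|^-1%:E * \int[lebesgue_measure]_t F t)%E.
Proof.
move=> s0 mF F0.
pose phi (t : mR) : mR := a + s * t.
have mphi : measurable_fun setT phi by apply: measurable_funD => //; apply: measurable_funM.
have ns : 0 < `|s| by rewrite normr_gt0.
pose nu : {measure set mR -> \bar R} := mscale (NngNum (normr_ge0 s)) 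
   (measure_function_pushforward__canonical__measure_function_Measure lebesgue_measure mphi).
have E : forall A, measurable A -> lebesgue_measure A = nu A.
  apply: lebesgue_measure_unique => _ [[x y] _ <-] /=.
  rewrite /nu /mscale /= /pushforward.
  have [s1|s1] := ltP 0 s.
    rewrite (_ : phi @^-1` _ = `](x - a) / s, (y - a) / s]%classic); last first.
      apply/seteqP; split=> t /=; rewrite /phi !in_itv /= ltr_pdivrMr // ler_pdivlMr //.
        by move=> /andP[h1 h2]; apply/andP; split; lra.
      by move=> /andP[h1 h2]; apply/andP; split; lra.
    rewrite !lebesgue_measure_itv /= !lte_fin ltr_pM2r ?invr_gt0 // ltrD2r.
    case: ifP => _; last by rewrite mule0.
    rewrite -!EFinB -EFinM gtr0_norm //; congr _%:E; field; exact: lt0r_neq0.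
  have s2 : s < 0 by rewrite lt_neqAle s0.
  rewrite (_ : phi @^-1` _ = `[(y - a) / s, (x - a) / s[%classic); last first.
    apply/seteqP; split=> t /=; rewrite /phi !in_itv /= ltr_ndivlMr // ler_ndivrMr //.
      by move=> /andP[h1 h2]; apply/andP; split; lra.
    by move=> /andP[h1 h2]; apply/andP; split; lra.
  rewrite !lebesgue_measure_itv /= !lte_fin ltr_nM2r ?invr_lt0 // ltrD2r.
  case: ifP => _; last by rewrite mule0.
  by rewrite -!EFinB -EFinM ltr0_norm //; congr _%:E; field.
have -> : (\int[lebesgue_measure]_t F t = \int[nu]_t F t)%E.
  by apply: eq_measure_integral => A mA _; exact: E.
rewrite ge0_integral_mscale //= muleA -EFinM mulVf ?mul1e ?gt_eqF //.
by rewrite (ge0_integral_pushforward mphi) //= preimage_setT.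
Qed.

End LebesgueTuple.

(** * Tonelli, affine substitutions and iterated integrals *)

Section LebesgueTuple2.
Context {R : realType}.
Local Notation mR := (measurableTypeR R).
Local Notation tupR n := (n.-tuple mR).

Lemma leb0E : @leb R 0 = \d_([tuple] : tupR 0) :> (set _ -> \bar R).
Proof. by []. Qed.

Lemma lebSE n : @leb R n.+1 = pushforward (lebesgue_measure \x leb n)%E (@tcons R n) :> (set _ -> \bar R).
Proof. by []. Qed.

Lemma leb_tcons_ge0 n (G : tupR n.+1 -> \bar R) :
  measurable_fun setT G -> (forall t, (0 <= G t)%E) ->
  (\int[leb n.+1]_t G t = \int[(lebesgue_measure \x leb n)]_p G (tcons p))%E.
Proof.
move=> mG G0; rewrite -(preimage_setT (@tcons R n)).
by rewrite -(ge0_integral_pushforward (@measurable_tcons R n)).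
Qed.

Lemma leb_tcons_integrable n (G : tupR n.+1 -> \bar R) :
  (leb n.+1).-integrable setT G ->
  (lebesgue_measure \x leb n)%E.-integrable setT (fun p => G (tcons p)).
Proof.
move=> /integrableP[mG Goo]; apply/integrableP; split.
  by apply: measurableT_comp => //; exact: measurable_tcons.
by rewrite -(@leb_tcons_ge0 _ (fun t => `|G t|)%E) //; exact: measurableT_comp.
Qed.

Lemma leb_tcons n (G : tupR n.+1 -> \bar R) : (leb n.+1).-integrable setT G ->
  (\int[leb n.+1]_t G t = \int[(lebesgue_measure \x leb n)]_p G (tcons p))%E.
Proof.
move=> iG; have /integrableP[mG _] := iG; rewrite -(preimage_setT (@tcons R n)).
rewrite -(integral_pushforward (@measurable_tcons R n)) //.
by rewrite preimage_setT; exact: leb_tcons_integrable.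
Qed.

Lemma leb_tonelli n (G : tupR n.+1 -> \bar R) :
  measurable_fun setT G -> (forall t, (0 <= G t)%E) ->
  (\int[leb n.+1]_t G t = \int[lebesgue_measure]_t \int[leb n]_y G (tcons (t, y)))%E.
Proof.
move=> mG G0; rewrite leb_tcons_ge0 //.
have mGc : measurable_fun setT (G \o @tcons R n) by apply: measurableT_comp => //; exact: measurable_tcons.
by rewrite (fubini_tonelli1 _ mGc (fun p => G0 _)).
Qed.

Lemma measurable_affine_rV n (x : 'rV[R]_n) (s : R) (F : 'rV[R]_n -> \bar R) :
  measurable_fun setT (fun t : tupR n => F (row_of t)) ->
  measurable_fun setT (fun t : tupR n => F (x + s *: row_of t)).
Proof.
apply: measurable_comp_rV => i.
rewrite (_ : (fun w => _) = fun t => x 0 i + s * tnth t i); last first.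
  by apply/funext => t; rewrite !mxE.
by apply: measurable_funD => //; apply: measurable_funM => //; exact: measurable_tnth.
Qed.

(** Tonelli reduces this to one variable at a time. *)
Lemma leb_affine n (x : 'rV[R]_n) (s : R) (F : 'rV[R]_n -> \bar R) : s != 0 ->
  measurable_fun setT (fun t : tupR n => F (row_of t)) -> (forall y, (0 <= F y)%E) ->
  (\int[leb n]_t F (x + s *: row_of t)%R = (`|s| ^- n)%:E * \int[leb n]_t F (row_of t))%E.
Proof.
move=> s0; elim: n x F => [|n ih] x F mF F0.
  rewrite expr0 invr1 mul1e; apply: eq_integral => t _; congr (F _).
  by apply/rowP => -[].
pose Fr (t : mR) (y : 'rV[R]_n) := F (row_mx (t%:M : 'rV[R]_1) y).
have mFr t : measurable_fun setT (fun y : tupR n => Fr t (row_of y)).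
  rewrite (_ : (fun y => _) = (fun t => F (row_of t)) \o (fun y => tcons (t, y))).
    apply: measurableT_comp => //; apply: measurableT_comp; first exact: measurable_tcons.
    exact: measurable_pair1.
  by apply/funext => y /=; rewrite /Fr -row_of_tcons.
rewrite (leb_tonelli (measurable_affine_rV x s mF) (fun t => F0 _)).
rewrite [in RHS](leb_tonelli mF (fun t => F0 _)).
pose H (t : mR) := (\int[leb n]_y Fr t (row_of y))%E.
have mH : measurable_fun setT H.
  have := @measurable_fun_fubini_tonelli_F _ _ mR (tupR n) R (leb n) (fun p => F (row_of (tcons p))).
  rewrite /fubini_F => h; rewrite (_ : H = fun x => \int[leb n]_y F (row_of (tcons (x, y))))%E.
    by apply: h => //; apply: measurableT_comp mF _; exact: measurable_tcons.
  by apply/funext => t; apply: eq_integral => y _; rewrite row_of_tcons.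
have H0 t : (0 <= H t)%E by apply: integral_ge0 => y _; exact: F0.
transitivity (\int[lebesgue_measure]_t ((`|s| ^- n)%:E * H (x 0 ord0 + s * t)%R))%E.
  apply: eq_integral => t _.
  rewrite /H -(ih (\row_i x 0 (lift ord0 i)) (Fr _) (mFr _) (fun y => F0 _)).
  apply: eq_integral => y _; rewrite /Fr.
  congr F; rewrite row_of_tcons; apply/rowP => i; case: (@splitP 1 n i) => j Hj.
    have -> : i = lshift n j by apply/val_inj; rewrite /= Hj.
    rewrite (@row_mxEl R 1 1 n) [LHS]mxE [RHS]mxE (ord1 j) mulr1n; congr (_ + _).
      by congr (x _ _); exact/val_inj.
    by rewrite mxE (@row_mxEl R 1 1 n) mxE mulr1n.
  have -> : i = rshift 1 j by apply/val_inj; rewrite /= Hj.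
  rewrite (@row_mxEr R 1 1 n) [LHS]mxE [RHS]mxE [in RHS]mxE; congr (_ + _).
    by congr (x _ _); exact/val_inj.
  by rewrite [LHS]mxE (@row_mxEr R 1 1 n) [RHS]mxE.
have mHs : measurable_fun setT (fun t : mR => H (x 0 ord0 + s * t)).
  have mphi : measurable_fun setT (fun t : mR => x 0 ord0 + s * t : mR).
    by apply: measurable_funD => //; exact: measurable_funM.
  exact: (measurableT_comp mH mphi).
have c0 : (0 <= (`|s| ^- n)%:E)%E by rewrite lee_fin invr_ge0 exprn_ge0.
rewrite (ge0_integralZl _ _ mHs _ c0) //.
rewrite lebesgue_affine1 // muleA -EFinM exprSr invfM; congr (_ * _)%E.
by apply: eq_integral => t _; apply: eq_integral => y _; rewrite row_of_tcons.
Qed.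

Definition cubeT n (K : R) : set (tupR n) := [set t | forall i, `|tnth t i| <= K].

Lemma measurable_cubeT n K : measurable (@cubeT n K).
Proof.
have := @mset_box R n (fun=> `[- K, K]); rewrite /mset.
rewrite (_ : [set t | _] = @cubeT n K) //; apply/seteqP; split=> t /= h i.
  by have := h i; rewrite mxE in_itv /= ler_norml.
by rewrite mxE in_itv /= -ler_norml.
Qed.

Lemma leb_cubeT n K : 0 <= K -> leb n (@cubeT n K) = ((2 * K) ^+ n)%:E.
Proof.
move=> K0; elim: n => [|n ih].
  by rewrite leb0E diracE mem_set // => -[].
rewrite lebSE /pushforward.
rewrite (_ : _ @^-1` _ = `[- K, K]%classic `*` @cubeT n K); last first.
  apply/seteqP; split=> -[t y] /=.
    move=> h; split; first by have := h ord0; rewrite tnth0 in_itv /= ler_norml.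
    by move=> i; have := h (lift ord0 i); rewrite tnthS.
  rewrite in_itv /= -ler_norml => -[h1 h2] i.
  by case: (unliftP ord0 i) => [j ->|->]; rewrite ?tnthS ?tnth0.
rewrite product_measure1E //; last exact: measurable_cubeT.
rewrite ih /= lebesgue_measure_itv /= lte_fin.
case: ifP => h; first by rewrite -EFinB -EFinM exprS; congr (_%:E); ring.
have -> : K = 0 by apply/eqP; rewrite eq_le K0 andbT; move: h => /negbT; rewrite -leNgt; lra.
by rewrite mul0e mulr0 exprS mul0r.
Qed.

(** These functions are closed under restriction to coordinate slices, and on them all
    the one-dimensional integrals in [integral_rV] are absolutely convergent. *)
Definition nice n (M K : R) (g : 'rV[R]_n -> R) := [/\ mrV g, (forall x, `|g x| <= M) &
  forall x : 'rV[R]_n, (exists i, K < `|x 0 i|) -> g x = 0].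

Lemma nice_integrable n M K (g : 'rV[R]_n -> R) : nice M K g ->
  (leb n).-integrable setT (EFin \o (fun t => g (row_of t))).
Proof.
move=> [mg gM gK].
have M0 : 0 <= M by apply: le_trans (gM 0).
pose K' := `|K|.
apply: (@le_integrable _ _ _ (leb n) setT measurableT _ (fun t => (M * \1_(@cubeT n K') t)%:E)).
- exact/measurable_EFinP.
- move=> t _; rewrite /= lee_fin indicE.
  have [h|h] := boolP (t \in @cubeT n K').
    by rewrite mulr1 (ger0_norm M0); exact: gM.
  rewrite gK ?normr0 //; move: h; rewrite notin_setE => h.
  apply: contrapT => h'; apply: h => i; rewrite leNgt; apply/negP => h2; apply: h'.
  exists i; rewrite mxE; apply: le_lt_trans h2; exact: ler_norm.
apply/integrableP; split.
  by apply/measurable_EFinP; apply: measurable_funM => //; apply: measurable_indic; exact: measurable_cubeT.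
under eq_integral do rewrite /= ger0_norm ?mulr_ge0 // EFinM.
rewrite ge0_integralZl //; last by apply/measurable_EFinP; apply: measurable_indic; exact: measurable_cubeT.
rewrite integral_indic //; last exact: measurable_cubeT.
by rewrite setIT [X in (_ * X)%E](leb_cubeT n (normr_ge0 K : 0 <= K')) -EFinM ltry.
Qed.

Lemma nice_section n M K (g : 'rV[R]_(1 + n) -> R) (t : R) : nice M K g ->
  nice M K (fun y : 'rV[R]_n => g (row_mx (t%:M : 'rV[R]_1) y)).
Proof.
move=> [mg gM gK]; split => //.
- rewrite /mrV (_ : (fun y => _) = (fun t => g (row_of t)) \o (fun y => tcons (t, y))).
    apply: measurableT_comp => //; apply: measurableT_comp; first exact: measurable_tcons.
    exact: measurable_pair1.
  by apply/funext => y /=; rewrite -row_of_tcons.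
- by move=> y [i Ki]; apply: gK; exists (rshift 1 i); rewrite row_mxEr.
Qed.

Lemma integral_rVE n M K (g : 'rV[R]_n -> R) : nice M K g ->
  integral_rV g = \int[leb n]_t g (row_of t).
Proof.
elim: n M K g => [|n ih] M K g ng.
  have [/measurable_EFinP mg _ _] := ng.
  rewrite /= /Rintegral leb0E integral_dirac // /dirac /= indicE in_setT /= mul1r.
  by congr g; apply/rowP => -[].
have ig := nice_integrable ng.
have [mg gM gK] := ng.
rewrite [RHS]/Rintegral (leb_tcons ig).
rewrite -(integral12_prod_meas1 (leb_tcons_integrable ig)).
rewrite /= /Rintegral; congr fine; apply: eq_integral => t _.
have ns := nice_section t ng.
rewrite (ih _ _ _ ns) /Rintegral fineK.
  by apply: eq_integral => y _; rewrite /= row_of_tcons.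
exact: (integrable_fin_num _ (nice_integrable ns)).
Qed.

End LebesgueTuple2.

(** * Differentiation under the integral sign *)

Section ParameterIntegrals.
Context {R : realType} d (T : measurableType d) (mu : {measure set T -> \bar R}).
Local Notation e_ i := (delta_mx 0 i).

Definition itg (f : T -> R) := mu.-integrable setT (EFin \o f).

Lemma itg_add f g : itg f -> itg g -> itg (fun t => f t + g t).
Proof. by move=> If Ig; have := integrableD measurableT If Ig. Qed.

Lemma itg_scale c f : itg f -> itg (fun t => c * f t).
Proof. by move=> If; have := integrableZl measurableT c If. Qed.

Lemma itg_sub f g : itg f -> itg g -> itg (fun t => f t - g t).
Proof. by move=> If Ig; have := integrableB measurableT If Ig. Qed.

Lemma itg_sum (I : Type) (r : seq I) (f : I -> T -> R) :
  (forall i, itg (f i)) -> itg (fun t => \sum_(i <- r) f i t).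
Proof.
move=> If; elim: r => [|i r ih].
  rewrite (_ : (fun t => _) = (fun=> 0)); first exact: (integrable0 mu setT).
  by apply/funext => t; rewrite big_nil.
rewrite (_ : (fun t => _) = (fun t => f i t + \sum_(j <- r) f j t)).
  exact: itg_add.
by apply/funext => t; rewrite big_cons.
Qed.

Lemma itg_bounded (f g : T -> R) : measurable_fun setT f -> (forall t, `|f t| <= g t) -> itg g -> itg f.
Proof.
move=> mf fg ig; apply: (@le_integrable _ _ _ mu setT measurableT _ (EFin \o g)) => //.
  exact/measurable_EFinP.
by move=> t _ /=; rewrite lee_fin (le_trans (fg t)) // ler_norm.
Qed.

Lemma int_add f g : itg f -> itg g -> \int[mu]_t (f t + g t) = \int[mu]_t f t + \int[mu]_t g t.
Proof. by move=> If Ig; rewrite RintegralD. Qed.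

Lemma int_sub f g : itg f -> itg g -> \int[mu]_t (f t - g t) = \int[mu]_t f t - \int[mu]_t g t.
Proof. by move=> If Ig; rewrite RintegralB. Qed.

Lemma int_scale c f : itg f -> \int[mu]_t (c * f t) = c * \int[mu]_t f t.
Proof. by move=> If; rewrite RintegralZl. Qed.

Lemma int_sum n (f : 'I_n -> T -> R) : (forall i, itg (f i)) ->
  \int[mu]_t (\sum_i f i t) = \sum_i \int[mu]_t f i t.
Proof.
elim: n f => [|n ih] f If.
  rewrite big_ord0; under eq_Rintegral do rewrite big_ord0.
  by rewrite /Rintegral integral0.
under eq_Rintegral do rewrite big_ord_recl.
rewrite int_add //; last by apply: itg_sum => i; exact: If.
by rewrite big_ord_recl ih.
Qed.

Lemma int_norm_le (f g : T -> R) : itg f -> itg g -> (forall t, `|f t| <= g t) ->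
  `|\int[mu]_t f t| <= \int[mu]_t g t.
Proof.
move=> If Ig fg; apply: le_trans (le_normr_Rintegral measurableT If) _.
by apply: le_Rintegral => //; exact: integrable_norm.
Qed.

(** Bounds are required for all iterated derivatives, so that the class of these
    integrands is stable under differentiation in [x]; the bounds on second derivatives
    replace a convergence theorem. *)
Record dominated_smooth n (F : 'rV[R]_n -> T -> R) : Prop := DominatedSmooth {
  ds_smooth : forall t, smooth (F ^~ t) ;
  ds_meas : forall s x, measurable_fun setT (fun t => partials s (F ^~ t) x) ;
  ds_bound : forall s x0, exists (e : R) (G : T -> R),
    [/\ 0 < e, itg G & forall x, `|x - x0| <= e -> forall t, `|partials s (F ^~ t) x| <= G t] }.

Section DiffUnder.
Variables (n : nat).
Implicit Types (F : 'rV[R]_n -> T -> R).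

Lemma ds_partials F s : dominated_smooth F ->
  dominated_smooth (fun x t => partials s (F ^~ t) x).
Proof.
move=> [sF mF bF]; split.
- by move=> t; exact: smooth_partials.
- move=> s' x; have := mF (s' ++ s) x.
  by under eq_fun do rewrite partials_cat.
- move=> s' x0; have [e [G [e0 iG h]]] := bF (s' ++ s) x0.
  by exists e, G; split => // x xe t; rewrite -partials_cat; exact: h.
Qed.

Lemma ds_itg F x : dominated_smooth F -> itg (F x).
Proof.
move=> [sF mF bF]; have [e [G [e0 iG h]]] := bF [::] x.
apply: (itg_bounded (mF [::] x) _ iG) => t; apply: h.
by rewrite subrr normr0 ltW.
Qed.

Lemma ds_continuous F x : dominated_smooth F -> {for x, continuous (fun x => \int[mu]_t F x t)}.
Proof.
move=> dF; apply/continuous_for_closed_ball => e e0.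
have H i : exists p : R * (T -> R), [/\ 0 < p.1, itg p.2 &
    forall y, `|y - x| <= p.1 -> forall t, `|partial i (F ^~ t) y| <= p.2 t].
  by have [r [G [r0 iG h]]] := ds_bound dF [:: i] x; exists (r, G).
have [p hp] := choice H.
pose M := \sum_i \int[mu]_t (p i).2 t.
have p0 i t : 0 <= (p i).2 t.
  have [r0 _ h] := hp i; apply: le_trans (h x _ t) => //.
  by rewrite subrr normr0 ltW.
have M0 : 0 <= M by apply: sumr_ge0 => i _; apply: Rintegral_ge0 => t _.
pose r := \big[Num.min/1]_i (p i).1.
have r0 : 0 < r.
  by rewrite /r; elim/big_ind : _ => // [a b a0 b0|i _]; [rewrite lt_min a0|have [] := hp i].
have rp i : r <= (p i).1 by rewrite /r; exact: bigmin_le.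
exists (Num.min r (e / (M + 1))).
  by rewrite lt_min r0 divr_gt0 // ltr_wpDl.
move=> y; rewrite le_min => /andP[yr ye].
rewrite -int_sub; [|exact: ds_itg|exact: ds_itg].
apply: (@le_trans _ _ (\int[mu]_t (`|y - x| * \sum_i (p i).2 t))).
  apply: int_norm_le.
  - by apply: itg_sub; exact: ds_itg.
  - by apply: itg_scale; apply: itg_sum => i; have [] := hp i.
  move=> t; have [|xi hxi E] := @mvt_rV R n (F ^~ t) x (y - x).
    by move=> z _ i; apply: smooth_derivable; exact: ds_smooth dF t.
  rewrite subrKC in E; rewrite E (le_trans (ler_norm_sum _ _ _)) // mulr_sumr.
  apply: ler_sum => i _; rewrite normrM ler_pM //; first exact: coord_le_norm.
  have [_ _ h] := hp i; apply: h; apply: le_trans (hxi i) _.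
  exact: le_trans yr (rp i).
rewrite int_scale; last by apply: itg_sum => i; have [] := hp i.
rewrite int_sum; last by move=> i; have [] := hp i.
rewrite -/M; apply: (@le_trans _ _ (e / (M + 1) * (M + 1))).
  by apply: ler_pM => //; lra.
by rewrite divfK // gt_eqF // ltr_wpDl.
Qed.

(** The difference quotient differs from the derivative by at most [|k|] times an
    integrable bound of the second derivative. *)
Lemma ds_derive F x i : dominated_smooth F ->
  is_derive x (e_ i) (fun x => \int[mu]_t F x t) (\int[mu]_t partial i (F ^~ t) x).
Proof.
move=> dF; have [r [G [r0 iG h]]] := ds_bound dF [:: i; i] x.
set D := \int[mu]_t partial i (F ^~ t) x.
have G0 t : 0 <= G t.
  by apply: le_trans (h x _ t) => //; rewrite subrr normr0 ltW.
pose M := \int[mu]_t G t.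
have M0 : 0 <= M by apply: Rintegral_ge0 => t _.
have dF1 := ds_partials [:: i] dF.
suff C : h0^-1 *: ((\int[mu]_t F (h0 *: e_ i + x) t) - \int[mu]_t F x t) @[h0 --> 0^'] --> D.
  split; first by apply/cvg_ex; exists D.
  exact: cvg_lim C.
apply/cvgrPdist_le => e e0; near=> k.
have k0 : k != 0 by near: k; exact: nbhs_dnbhs_neq.
have kr : `|k| <= Num.min r (e / (M + 1)).
  near: k; apply: dnbhs0_le; rewrite lt_min r0 divr_gt0 // ltr_wpDl //.
move: kr; rewrite le_min => /andP[kr ke].
rewrite distrC.
have -> : k^-1 *: ((\int[mu]_t F (k *: e_ i + x) t) - \int[mu]_t F x t) - D =
  k^-1 * (\int[mu]_t (F (k *: e_ i + x) t - F x t - k * partial i (F ^~ t) x)).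
  rewrite int_sub; [|by apply: itg_sub; exact: ds_itg|by apply: itg_scale; exact: (ds_itg x dF1)].
  rewrite int_sub; [|exact: ds_itg|exact: ds_itg].
  rewrite int_scale; last exact: (ds_itg x dF1).
  by rewrite [in RHS]mulrBr mulKf.
rewrite normrM.
have -> : e = `|k^-1| * (`|k| * e) by rewrite mulrA -normrM mulVf // normr1 mul1r.
rewrite ler_wpM2l //.
apply: (@le_trans _ _ (\int[mu]_t ((`|k| * `|k|) * G t))).
  apply: int_norm_le.
  - apply: itg_sub; first by apply: itg_sub; exact: ds_itg.
    by apply: itg_scale; exact: (ds_itg x dF1).
  - exact: itg_scale.
  move=> t; have sF := ds_smooth dF t.
  have [|s sk E] := @partial_mvt R n (F ^~ t) x i k; first by move=> *; exact: smooth_derivable.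
  have [|s' s's E'] := @partial_mvt R n (partial i (F ^~ t)) x i s.
    by move=> *; apply: smooth_derivable; exact: smooth_partial.
  rewrite [k *: _ + x]addrC E -mulrBr E' 2!normrM mulrA.
  apply: ler_pM => //; first by rewrite ler_pM.
  apply: h; rewrite addrC addKr (le_trans (norm_delta_le _ _)) //.
  exact: le_trans s's (le_trans sk kr).
rewrite int_scale // -mulrA ler_wpM2l // -/M.
apply: (@le_trans _ _ (e / (M + 1) * (M + 1))).
  by apply: ler_pM => //; lra.
by rewrite divfK // gt_eqF // ltr_wpDl.
Unshelve. all: by end_near. Qed.

Lemma smooth_integral F : dominated_smooth F -> smooth (fun x => \int[mu]_t F x t).
Proof.
move=> dF.
pose C (g : 'rV[R]_n -> R) := exists2 F, dominated_smooth F & g = fun x => \int[mu]_t F x t.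
rewrite /smooth; apply: (@smooth_on_coind _ _ setT C openT) => //; last by exists F.
- by move=> g [F' dF' ->] x _; exact: ds_continuous.
- move=> g [F' dF' ->] i; exists (fun x => \int[mu]_t partial i (F' ^~ t) x).
    by exists (fun x t => partial i (F' ^~ t) x) => //; exact: (ds_partials [:: i]).
  by move=> x _; have [] := ds_derive x i dF'.
Qed.

Lemma partial_integral F i x : dominated_smooth F ->
  partial i (fun x => \int[mu]_t F x t) x = \int[mu]_t partial i (F ^~ t) x.
Proof. by move=> dF; have [] := ds_derive x i dF. Qed.

End DiffUnder.
End ParameterIntegrals.

(** * Integrals over compact sets of parameters *)

Section CompactParameters.
Context {R : realType}.
Local Notation e_ i := (delta_mx 0 i).

Lemma compact_locally_bounded (V : normedModType R) (A : set V) (f : V -> R) :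
  compact A ->
  (forall p, A p -> exists2 r : R, 0 < r & exists M : R,
      forall q, A q -> `|q - p| <= r -> `|f q| <= M) ->
  exists2 M : R, 0 <= M & forall q, A q -> `|f q| <= M.
Proof.
move=> cA fA.
have H : \forall M \near +oo, A `<=` (fun q => A q -> `|f q| <= M).
  apply: ((compact_near_coveringP A).1 cA) => p Ap.
  have [r r0 [M h]] := fA p Ap.
  exists ([set q | `|q - p| <= r], [set N | M <= N]) => /=.
    split; first by apply/nbhs_closed_ball; exists r.
    by apply: nbhs_pinfty_ge; exact: num_real.
  by move=> [q N] /= [qp MN] Aq; apply: le_trans (h q Aq qp) MN.
have [M [Mr h]] := H.
exists (Num.max 0 (M + 1)); first by rewrite le_max lexx.
move=> q Aq; have := h (M + 1); rewrite ltrDl => /(_ ltr01 q Aq Aq) hq.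
by rewrite le_max hq orbT.
Qed.

Definition continuous_in (V : normedModType R) (A : set V) (f : V -> R) :=
  forall p, A p -> forall e : R, 0 < e -> exists2 r : R, 0 < r &
     forall q, A q -> `|q - p| <= r -> `|f q - f p| <= e.

Lemma compact_bounded_in (V : normedModType R) (A : set V) (f : V -> R) :
  compact A -> continuous_in A f -> exists2 M : R, 0 <= M & forall q, A q -> `|f q| <= M.
Proof.
move=> cA cf; apply: compact_locally_bounded cA _ => p Ap.
have [r r0 h] := cf p Ap 1 ltr01; exists r => //; exists (`|f p| + 1) => q Aq qp.
rewrite -[f q](subrK (f p)) addrC (le_trans (ler_normD _ _)) // lerD2l; exact: h.
Qed.

Lemma continuous_continuous_in (V : normedModType R) (A : set V) (f : V -> R) :
  (forall p, A p -> {for p, continuous f}) -> continuous_in A f.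
Proof.
move=> cf p Ap e e0; have [r r0 h] := (continuous_for_closed_ball f p).1 (cf p Ap) e e0.
by exists r => // q _; exact: h.
Qed.

Lemma compact_bounded_closed n (A : set 'rV[R]_n) : compact A ->
  exists2 M : R, 0 <= M & forall q, A q -> `|q| <= M.
Proof.
move=> cA; have [p Ap|M M0 h] := @compact_locally_bounded _ A (fun q => `|q|) cA.
  exists 1 => //; exists (`|p| + 1) => q _ qp; rewrite normr_id.
  by rewrite -[q](subrK p) addrC (le_trans (ler_normD _ _)) // lerD2l.
by exists M => // q /h; rewrite normr_id.
Qed.

Lemma closed_normP (V : normedModType R) (A : set V) :
  closed A <-> forall p, (forall e : R, 0 < e -> exists2 q, A q & `|q - p| <= e) -> A p.
Proof.
split=> [cA p h|h p clp].
  apply: cA => B /nbhs_closed_ball [e e0 eB]; have [q Aq qp] := h e e0.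
  by exists q; split => //; exact: eB.
apply: h => e e0; have [|q [Aq qp]] := clp [set q | `|q - p| <= e].
  by apply/nbhs_closed_ball; exists e.
by exists q.
Qed.

Lemma smooth_rel_continuous m (S : set 'rV[R]_m) g : smooth_rel S g -> continuous_in S g.
Proof.
move=> sg p Sp e e0; have [U [G [oU Up sG E]]] := sg p Sp.
have [r r0 h] := (continuous_for_closed_ball G p).1 (smooth_on_continuous sG Up) e e0.
have /nbhs_closed_ball [r' r'0 h'] : nbhs p U by exact: open_nbhs_nbhs.
exists (Num.min r r'); first by rewrite lt_min r0.
move=> q Sq; rewrite le_min => /andP[qr qr'].
by rewrite -!E //; [exact: h|exact: h'].
Qed.

Lemma smooth_smooth_rel m (S : set 'rV[R]_m) g : smooth g -> smooth_rel S g.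
Proof.
move=> sg p Sp; exists setT, g; split => //; exact: openT.
Qed.

Lemma open_preimage_smooth k m (io : 'rV[R]_k -> 'rV[R]_m) (U : set 'rV[R]_m) :
  (forall j, smooth (fun x => io x 0 j)) -> open U -> open (io @^-1` U).
Proof.
move=> sio oU; rewrite openE => p Up; apply/nbhs_closed_ball.
have /nbhs_closed_ball [r r0 h] : nbhs (io p) U by exact: open_nbhs_nbhs.
have : nbhs p [set y | forall j, `|io y 0 j - io p 0 j| <= r].
  apply: nbhs_forall_fin => j; apply/nbhs_closed_ball.
  have cj := smooth_continuous (sio j) (x := p).
  by have [d d0 h'] := (continuous_for_closed_ball _ _).1 cj r r0; exists d.
move=> /nbhs_closed_ball [d d0 hd]; exists d => // y /hd /= H; apply: h.
by apply: norm_le_coord => [|j]; [exact: ltW|rewrite !mxE].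
Qed.

Lemma smooth_rel_comp k m (S' : set 'rV[R]_k) (S : set 'rV[R]_m) (io : 'rV[R]_k -> 'rV[R]_m) g :
  (forall j, smooth (fun x => io x 0 j)) -> (forall x, S' x -> S (io x)) ->
  smooth_rel S g -> smooth_rel S' (fun x => g (io x)).
Proof.
move=> sio SS sg p Sp; have [U [G [oU Up sG E]]] := sg _ (SS _ Sp).
exists (io @^-1` U), (fun x => G (io x)); split => //.
- exact: open_preimage_smooth.
- apply: (smooth_on_comp _ oU) => //; first exact: open_preimage_smooth.
  by move=> j; apply: smooth_smooth_on.
- by move=> q Sq Uq; apply: E => //; exact: SS.
Qed.

Lemma smooth_rel_mul m (S : set 'rV[R]_m) f g : smooth_rel S f -> smooth_rel S g ->
  smooth_rel S (fun x => f x * g x).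
Proof.
move=> sf sg p Sp; have [U [F [oU Up sF E]]] := sf p Sp.
have [W [G [oW Wp sG E']]] := sg p Sp.
exists (U `&` W), (fun x => F x * G x); split => //.
- exact: openI.
- apply: smooth_on_mul; first exact: openI.
    by apply: smooth_on_subset sF => x [].
  by apply: smooth_on_subset sG => x [].
- by move=> q Sq [Uq Wq]; rewrite E // E'.
Qed.

Definition cyl n m (K : set 'rV[R]_m) : set 'rV[R]_(n + m) := [set p | K (rsubmx p)].

Lemma partials_row_mx n m (G : 'rV[R]_(n + m) -> R) (r : 'rV[R]_m) s :
  partials s (fun x : 'rV[R]_n => G (row_mx x r)) =
  (fun x => partials (map (@lshift n m) s) G (row_mx x r)).
Proof.
have key i (h : R) (x : 'rV[R]_n) :
    row_mx (h *: e_ i + x) r = h *: e_ (lshift m i) + row_mx x r.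
  apply/rowP => j; case: (splitP j) => k jk.
    have -> : j = lshift m k by apply/val_inj.
    rewrite row_mxEl [LHS]mxE [RHS]mxE row_mxEl; congr (_ + _).
    by rewrite !mxE; congr (_ * (_ && _)%:R); rewrite (inj_eq (@lshift_inj _ _)).
  have -> : j = rshift n k by apply/val_inj.
  rewrite row_mxEr [RHS]mxE row_mxEr [X in _ = X + _]mxE mxE.
  by rewrite eq_rlshift andbF mulr0 add0r.
elim: s => [|i s ih] //=; rewrite ih; apply/funext => x.
set Q := partials _ G.
have E : (fun h : R => h^-1 *: (((fun x : 'rV[R]_n => Q (row_mx x r)) \o shift x) (h *: e_ i) - Q (row_mx x r))) =
  (fun h : R => h^-1 *: ((Q \o shift (row_mx x r)) (h *: e_ (lshift m i)) - Q (row_mx x r))).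
  by apply/funext => h; rewrite /= key.
by rewrite /partial /derive E.
Qed.

Lemma smooth_row_mx n m (r : 'rV[R]_m) j : smooth (fun x : 'rV[R]_n => row_mx x r 0 j).
Proof.
case: (splitP j) => k jk.
  have -> : j = lshift m k by apply/val_inj.
  under eq_fun do rewrite row_mxEl; exact: smooth_coord.
have -> : j = rshift n k by apply/val_inj.
under eq_fun do rewrite row_mxEr; exact: smooth_cst.
Qed.

Section Slices.
Variables (n m : nat) (K : set 'rV[R]_m).
Implicit Types (Psi : 'rV[R]_(n + m) -> R).

Definition xpartial (i : 'I_n) Psi (p : 'rV[R]_(n + m)) : R :=
  partial i (fun x => Psi (row_mx x (rsubmx p))) (lsubmx p).

Definition xpartials (s : seq 'I_n) Psi := foldr xpartial Psi s.

Lemma xpartialsE s Psi r :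
  (fun x => xpartials s Psi (row_mx x r)) = partials s (fun x => Psi (row_mx x r)).
Proof.
elim: s => [|i s ih] //=; apply/funext => x.
by rewrite /xpartial row_mxKl row_mxKr ih.
Qed.

Lemma smooth_slice Psi r : smooth_rel (@cyl n m K) Psi -> K r ->
  smooth (fun x => Psi (row_mx x r)).
Proof.
move=> sP Kr; apply: smooth_on_local => x _.
have [|U [G [oU Up sG E]]] := sP (row_mx x r); first by rewrite /cyl /= row_mxKr.
have oW : open ((fun x => row_mx x r) @^-1` U).
  by apply: open_preimage_smooth => // j; exact: smooth_row_mx.
exists ((fun x => row_mx x r) @^-1` U); first by split.
apply: (@smooth_on_eq _ _ _ (fun x => G (row_mx x r))) => //.
  by move=> y Uy; apply: E => //; rewrite /cyl /= row_mxKr.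
apply: (smooth_on_comp oW oU) => // j.
by apply: smooth_smooth_on; exact: smooth_row_mx.
Qed.

(** The set [cyl K] is full in the first group of variables, so derivatives in these
    variables only depend on the values on [cyl K]. *)
Lemma smooth_rel_xpartial Psi i : smooth_rel (@cyl n m K) Psi ->
  smooth_rel (@cyl n m K) (xpartial i Psi).
Proof.
move=> sP p Kp; have [U [G [oU Up sG E]]] := sP p Kp.
exists U, (partial (lshift m i) G); split; [exact: oU|exact: Up|exact: (smooth_on_partial (lshift m i) sG)|].
move=> q Kq Uq; rewrite /xpartial.
pose r := rsubmx q.
have Er : q = row_mx (lsubmx q) r by rewrite hsubmxK.
have oW : open ((fun x => row_mx x r) @^-1` U).
  by apply: open_preimage_smooth => // j; exact: smooth_row_mx.
transitivity (partial i (fun x => G (row_mx x r)) (lsubmx q)).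
  have := congr1 (fun f => f (lsubmx q)) (partials_row_mx G r [:: i]).
  by move=> /= ->; rewrite -Er.
apply: (partial_eq_on oW); last by rewrite /preimage /= -Er.
by move=> y Uy; apply: E => //; rewrite /cyl /= row_mxKr.
Qed.

Lemma smooth_rel_xpartials Psi s : smooth_rel (@cyl n m K) Psi ->
  smooth_rel (@cyl n m K) (xpartials s Psi).
Proof. by move=> sP; elim: s => [|i s ih] //=; exact: smooth_rel_xpartial. Qed.

Lemma norm_row_mx_le (x : 'rV[R]_n) (r : 'rV[R]_m) M : 0 <= M ->
  `|x| <= M -> `|r| <= M -> `|row_mx x r| <= M.
Proof.
move=> M0 xM rM; apply: norm_le_coord => // j; case: (splitP j) => k jk.
  have -> : j = lshift m k by apply/val_inj.
  by rewrite row_mxEl; exact: le_trans (coord_le_norm _ _) xM.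
have -> : j = rshift n k by apply/val_inj.
by rewrite row_mxEr; exact: le_trans (coord_le_norm _ _) rM.
Qed.

Lemma norm_lsubmx_le (p : 'rV[R]_(n + m)) : `|lsubmx p| <= `|p|.
Proof. by apply: norm_le_coord => // i; rewrite mxE; exact: coord_le_norm. Qed.

Lemma norm_rsubmx_le (p : 'rV[R]_(n + m)) : `|rsubmx p| <= `|p|.
Proof. by apply: norm_le_coord => // i; rewrite mxE; exact: coord_le_norm. Qed.

Lemma cyl_bounded Psi x0 : compact K -> smooth_rel (@cyl n m K) Psi ->
  exists2 M, 0 <= M & forall x, `|x - x0| <= 1 -> forall r, K r -> `|Psi (row_mx x r)| <= M.
Proof.
move=> cK sP.
have [N N0 hN] := compact_bounded_closed cK.
have clK : closed K by apply: compact_closed => //; exact: norm_hausdorff.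
pose B : set 'rV[R]_(n + m) := [set p | `|lsubmx p - x0| <= 1 /\ K (rsubmx p)].
have cB : compact B.
  apply: bounded_closed_compact.
    exists (`|x0| + 1 + N); split; first exact: num_real.
    move=> M hM p [h1 h2]; apply: le_trans (ltW hM).
    rewrite -(hsubmxK p); apply: norm_row_mx_le; first by rewrite !addr_ge0.
      rewrite -(subrK x0 (lsubmx p)) (le_trans (ler_normD _ _)) //.
      by rewrite addrC -addrA lerD2l (le_trans h1) // lerDl.
    by rewrite (le_trans (hN _ h2)) // lerDr addr_ge0.
  apply/closed_normP => p hp; split.
    apply/ler_addgt0Pr => e e0; have [q [h1 h2] qp] := hp e e0.
    have -> : lsubmx p - x0 = (lsubmx q - x0) - lsubmx (q - p).
      by rewrite [lsubmx (q - p)]raddfB /= opprB [RHS]addrC addrA subrK.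
    rewrite (le_trans (ler_normB _ _)) // lerD //.
    exact: le_trans (norm_lsubmx_le _) qp.
  apply: (closed_normP K).1 => // e e0; have [q [h1 h2] qp] := hp e e0.
  exists (rsubmx q) => //; rewrite -raddfB; exact: le_trans (norm_rsubmx_le _) qp.
have cP : continuous_in B Psi.
  move=> p [_ Kp] e e0; have [r r0 h] := smooth_rel_continuous sP Kp e0.
  by exists r => // q [_ Kq]; exact: h.
have [M M0 h] := compact_bounded_in cB cP.
exists M => // x xx0 r Kr; apply: h; split; first by rewrite row_mxKl.
by rewrite row_mxKr.
Qed.

Variables (d : measure_display) (T : measurableType d) (mu : {measure set T -> \bar R}).
Variables (D : set T) (rho : T -> 'rV[R]_m).
Hypotheses (cK : compact K) (mD : measurable D) (Doo : (mu D < +oo)%E).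
Hypotheses (mrho : forall j, measurable_fun setT (fun t => rho t 0 j)).
Hypothesis rhoK : forall t, D t -> K (rho t).

Definition slice_on Psi (x : 'rV[R]_n) (t : T) : R :=
  if t \in D then Psi (row_mx x (rho t)) else 0.

Lemma partials_slice_on Psi s t :
  partials s (slice_on Psi ^~ t) = (slice_on (xpartials s Psi) ^~ t).
Proof.
rewrite /slice_on; case: (t \in D); first by rewrite -xpartialsE.
elim: s => [|i s ih] //=; rewrite ih; apply/funext => x; exact: partial_cst.
Qed.

Lemma measurable_slice_on Psi x : smooth_rel (@cyl n m K) Psi ->
  measurable_fun setT (slice_on Psi x).
Proof.
move=> sP.
have clK : closed K by apply: compact_closed => //; exact: norm_hausdorff.
pose g (r : 'rV[R]_m) := if r \in K then Psi (row_mx x r) else 0.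
have mK : mset K.
  have := mset_open (closed_openC clK); rewrite /mset => /measurableC.
  by congr measurable; apply/seteqP; split=> t /=; [move/contrapT|move=> ? ?].
have mg : mrV g.
  apply: (@mrV_within _ _ K (fun r => Psi (row_mx x r))) => //.
  - move=> r Kr e e0.
    have [|e' e'0 h] := smooth_rel_continuous sP (p := row_mx x r) _ e0.
      by rewrite /cyl /= row_mxKr.
    exists e' => // r' Kr' rr'; apply: h; first by rewrite /cyl /= row_mxKr.
    rewrite opp_row_mx add_row_mx subrr.
    by apply: norm_row_mx_le => //; rewrite ?normr0 ltW.
  - by move=> r Kr; rewrite /g mem_set.
  - by move=> r Kr; rewrite /g memNset.
rewrite (_ : slice_on Psi x = fun t => \1_D t * g (rho t)).
  apply: measurable_funM; first exact: measurable_indic.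
  exact: (measurable_comp_rV mrho mg).
apply/funext => t; rewrite /slice_on /g indicE; case: ifPn => tD; last by rewrite mul0r.
by rewrite mul1r mem_set //; apply: rhoK; exact: set_mem.
Qed.

(** On [K] all the derivatives in the first group of variables are continuous in the
    relative sense, so they are bounded, locally uniformly in [x]. *)
Lemma dominated_slice_on Psi : smooth_rel (@cyl n m K) Psi ->
  dominated_smooth mu (slice_on Psi).
Proof.
move=> sP; split.
- move=> t; rewrite /slice_on; case tD: (t \in D); last exact: smooth_cst.
  by apply: smooth_slice => //; apply: rhoK; exact: set_mem.
- move=> s x; rewrite (_ : (fun t => _) = slice_on (xpartials s Psi) x).
    exact: measurable_slice_on (smooth_rel_xpartials s sP).
  by apply/funext => t; rewrite partials_slice_on.
- move=> s x0; have [M M0 h] := cyl_bounded x0 cK (smooth_rel_xpartials s sP).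
  exists 1, (fun t => M * \1_D t); split => //.
    apply: itg_scale; apply/integrableP; split; first by apply/measurable_EFinP; exact: measurable_indic.
    under eq_integral do rewrite /= ger0_norm //.
    by rewrite integral_indic // setIT.
  move=> x xx0 t; rewrite partials_slice_on /slice_on indicE.
  case: ifPn => tD; last by rewrite normr0 mulr0.
  by rewrite mulr1; apply: h => //; apply: rhoK; exact: set_mem.
Qed.

End Slices.
End CompactParameters.

(** * Compactly supported distributions and continuous operators *)

Section Seminorms.
Context {R : realType}.
Local Notation e_ i := (delta_mx 0 i).

Lemma partial_comp n m (io : 'rV[R]_m -> 'rV[R]_n) (h : 'rV[R]_n -> R) i x :
  (forall j, smooth (fun x => io x 0 j)) -> smooth h ->
  partial i (fun y => h (io y)) x =
    \sum_j partial i (fun y => io y 0 j) x * partial j h (io x).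
Proof.
move=> sio sh.
by have [_] := @is_derive_comp_smooth R m n setT setT io openT sio (fun x _ => I) h x i sh I.
Qed.

Definition cball n (N : R) : set 'rV[R]_n := [set x | `|x| <= N].

Lemma compact_cball n N : compact (@cball n N).
Proof.
apply: bounded_closed_compact.
  exists N; split; first exact: num_real.
  by move=> M NM x xN; apply: le_trans xN (ltW NM).
apply/closed_normP => p h; apply/ler_addgt0Pr => e e0; have [q qN qp] := h e e0.
rewrite -[p](subKr q) (le_trans (ler_normB _ _)) // lerD //.
Qed.

Lemma compact_cballP n (K : set 'rV[R]_n) : compact K -> exists2 N, 0 <= N & K `<=` cball N.
Proof. exact: compact_bounded_closed. Qed.

Lemma partials_bounded n (K : set 'rV[R]_n) m g : compact K -> smooth g ->
  exists2 M : R, 0 <= M & forall s x, (size s <= m)%N -> K x -> `|partials s g x| <= M.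
Proof.
move=> cK; elim: m g => [|m ih] g sg.
  have [|M M0 h] := @compact_bounded_in R _ K g cK.
    by apply: continuous_continuous_in => x _; exact: smooth_continuous.
  by exists M => // -[|? ?] // x _; exact: h.
have [M0 M00 h0] := ih g sg.
have H i : exists M : R, 0 <= M /\ forall s x, (size s <= m)%N -> K x ->
    `|partials s (partial i g) x| <= M.
  by have [M hM h] := ih _ (smooth_partial i sg); exists M.
have [M hM] := choice H.
exists (M0 + \sum_i M i); first by rewrite addr_ge0 // sumr_ge0 // => i _; have [] := hM i.
move=> s x; case/lastP: s => [|s i] sm Kx.
  rewrite (le_trans (h0 [::] x _ Kx)) // lerDl sumr_ge0 // => i _; by have [] := hM i.
rewrite partials_rcons; rewrite size_rcons ltnS in sm.
have [_ h] := hM i; rewrite (le_trans (h s x sm Kx)) //.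
rewrite (bigD1 i) //= addrCA lerDl addr_ge0 // sumr_ge0 // => j _; by have [] := hM j.
Qed.

Section SeminormTheory.
Variables (n : nat).
Implicit Types (g h : 'rV[R]_n -> R) (K : set 'rV[R]_n).

Lemma seminorm_ub K m g s x : compact K -> smooth g -> (size s <= m)%N -> K x ->
  `|partials s g x| <= seminorm K m g.
Proof.
move=> cK sg sm Kx; have [M M0 h] := partials_bounded m cK sg.
apply: ub_le_sup; last by exists s, x.
by exists M => _ [s' [x' [sm' Kx' ->]]]; exact: h.
Qed.

Lemma seminorm_le K m g M : 0 <= M ->
  (forall s x, (size s <= m)%N -> K x -> `|partials s g x| <= M) -> seminorm K m g <= M.
Proof.
move=> M0 h; rewrite /seminorm; set A := [set r | _].
have [A0|/set0P Ane] := eqVneq A set0; first by rewrite A0 sup0.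
by apply: ge_sup => // _ [s [x [sm Kx ->]]]; exact: h.
Qed.

Lemma seminorm_ge0 K m g : 0 <= seminorm K m g.
Proof.
rewrite /seminorm; set A := [set r | _].
have [A0|/set0P [r Ar]] := eqVneq A set0; first by rewrite A0 sup0.
have [hs|hs] := pselect (has_sup A); last by rewrite sup_out.
apply: le_trans (ub_le_sup _ Ar); first by case: Ar => s [x [_ _ ->]].
by case: hs.
Qed.

Lemma seminorm_mono K K' m m' g : compact K' -> K `<=` K' -> (m <= m')%N -> smooth g ->
  seminorm K m g <= seminorm K' m' g.
Proof.
move=> cK' KK mm sg; apply: seminorm_le; first exact: seminorm_ge0.
move=> s x sm Kx; apply: seminorm_ub => //; [exact: leq_trans sm mm|exact: KK].
Qed.

Lemma seminorm_cball_mono (N N' : R) m m' g : N <= N' -> (m <= m')%N -> smooth g ->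
  seminorm (cball N) m g <= seminorm (cball N') m' g.
Proof.
move=> NN mm sg; apply: seminorm_mono => //; first exact: compact_cball.
by move=> x xN; exact: le_trans xN NN.
Qed.

Section Distribution.
Variable u : functional (R := R) n.
Hypothesis cu : compact_distribution u.

Lemma cd_lin a g h : smooth g -> smooth h -> u (fun x => a * g x + h x) = a * u g + u h.
Proof. by have [h1 _] := cu; exact: h1. Qed.

Lemma cd_bound : exists N (m : nat) C, [/\ 0 <= N, 0 <= C & forall g, smooth g ->
  `|u g| <= C * seminorm (cball N) m g].
Proof.
have [_ [K [m [C [cK h]]]]] := cu; have [N N0 KN] := compact_cballP cK.
exists N, m, `|C|; split => // g sg; apply: le_trans (h g sg) _.
apply: (@le_trans _ _ (`|C| * seminorm K m g)).
  by rewrite ler_wpM2r ?seminorm_ge0 // ler_norm.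
by rewrite ler_wpM2l //; apply: seminorm_mono => //; exact: compact_cball.
Qed.

Lemma cd0 : u (fun=> 0) = 0.
Proof.
have := @cd_lin 1 _ _ (@smooth_cst R n 0) (@smooth_cst R n 0).
rewrite (_ : (fun x => _) = (fun=> 0)); last by apply/funext => x; rewrite mulr0 addr0.
by rewrite mul1r => /esym/eqP; rewrite -subr_eq0 addrK => /eqP.
Qed.

Lemma cd_add g h : smooth g -> smooth h -> u (fun x => g x + h x) = u g + u h.
Proof.
move=> sg sh; rewrite -[u g]mul1r -cd_lin //; congr u; apply/funext => x.
by rewrite mul1r.
Qed.

Lemma cd_scale a g : smooth g -> u (fun x => a * g x) = a * u g.
Proof.
move=> sg; rewrite -[RHS]addr0 -cd0 -(cd_lin a sg (@smooth_cst R n 0)).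
by congr u; apply/funext => x; rewrite addr0.
Qed.

Lemma cd_opp g : smooth g -> u (fun x => - g x) = - u g.
Proof.
move=> sg; rewrite -mulN1r -cd_scale //; congr u; apply/funext => x.
by rewrite mulN1r.
Qed.

Lemma cd_sub g h : smooth g -> smooth h -> u (fun x => g x - h x) = u g - u h.
Proof. by move=> sg sh; rewrite (cd_add sg (smooth_opp sh)) (cd_opp sh). Qed.

Lemma cd_sum m (F : 'I_m -> 'rV[R]_n -> R) : (forall k, smooth (F k)) ->
  u (fun x => \sum_k F k x) = \sum_k u (F k).
Proof.
elim: m F => [|m ih] F sF.
  rewrite big_ord0; transitivity (u (fun=> 0)); last exact: cd0.
  by congr u; apply/funext => x; rewrite big_ord0.
rewrite big_ord_recl -ih // -cd_add //; last by apply: smooth_sum => k _.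
by congr u; apply/funext => x; rewrite big_ord_recl.
Qed.

(** The seminorm that bounds [u] only sees a neighbourhood of its compact set. *)
Lemma cd_local : exists2 L : R, 0 < L & forall g h, smooth g -> smooth h ->
  (forall x, `|x| < L -> g x = h x) -> u g = u h.
Proof.
have [N [m [C [N0 C0 hu]]]] := cd_bound.
exists (N + 1); first by rewrite ltr_wpDl.
move=> g h sg sh gh; apply/eqP; rewrite -subr_eq0 -cd_sub // -normr_le0.
have sd := smooth_sub sg sh.
apply: le_trans (hu _ sd) _.
rewrite -(mulr0 C) ler_wpM2l //.
apply: seminorm_le => // s x sm xN.
have oU : open [set x : 'rV[R]_n | `|x| < N + 1].
  rewrite openE => y yN; apply/nbhs_closed_ball; exists ((N + 1 - `|y|) / 2).
    by rewrite divr_gt0 // subr_gt0.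
  move=> z zy; rewrite /= -(subrK y z) (le_lt_trans (ler_normD _ _)) //.
  rewrite /= in yN; lra.
rewrite (@partials_eq_on _ _ _ _ (fun=> 0) _ _ oU).
- rewrite (_ : partials s (fun=> 0) = (fun=> 0)) ?normr0 //.
  elim: s {sm} => [|i s ih] //=; rewrite ih; apply/funext => y; exact: partial_cst.
- by move=> y yN; rewrite gh ?subrr.
- by rewrite /= (le_lt_trans xN) // ltrDl.
Qed.

End Distribution.
End SeminormTheory.

(** The continuous linear operators between the spaces of smooth functions; they are
    the operators whose transposes act on compactly supported distributions. *)
Record tame n m (T : ('rV[R]_n -> R) -> ('rV[R]_m -> R)) : Prop := Tame {
  tame_smooth : forall h, smooth h -> smooth (T h) ;
  tame_lin : forall a g h, smooth g -> smooth h ->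
     T (fun x => a * g x + h x) = (fun x => a * T g x + T h x) ;
  tame_bound : forall (N : R) (k : nat), 0 <= N -> exists (N' : R) (k' : nat) (C : R),
    [/\ 0 <= N', 0 <= C & forall h, smooth h -> forall s x, (size s <= k)%N -> `|x| <= N ->
       `|partials s (T h) x| <= C * seminorm (cball N') k' h] }.

Lemma compact_distribution_tame n m (u : functional (R := R) m)
    (T : ('rV[R]_n -> R) -> ('rV[R]_m -> R)) :
  compact_distribution u -> tame T -> compact_distribution (fun h => u (T h)).
Proof.
move=> cu [sT lT bT]; split.
  by move=> a g h sg sh; rewrite lT // cd_lin //; exact: sT.
have [N [k [C [N0 C0 hu]]]] := cd_bound cu.
have [N' [k' [C' [N'0 C'0 hT]]]] := bT N k N0.
exists (cball N'), k', (C * C'); split; first exact: compact_cball.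
move=> g sg; apply: le_trans (hu _ (sT _ sg)) _; rewrite -mulrA ler_wpM2l //.
apply: seminorm_le; first by rewrite mulr_ge0 // seminorm_ge0.
by move=> s x sk xN; exact: hT.
Qed.

Lemma compact_distribution_add n (u v : functional (R := R) n) :
  compact_distribution u -> compact_distribution v ->
  compact_distribution (fun h => u h + v h).
Proof.
move=> cu cv; split.
  move=> a g h sg sh; rewrite (cd_lin cu) // (cd_lin cv) //; ring.
have [N [k [C [N0 C0 hu]]]] := cd_bound cu.
have [N' [k' [C' [N'0 C'0 hv]]]] := cd_bound cv.
exists (cball (N + N')), (k + k')%N, (C + C'); split; first exact: compact_cball.
move=> g sg; rewrite (le_trans (ler_normD _ _)) // mulrDl lerD //.
  rewrite (le_trans (hu _ sg)) // ler_wpM2l // seminorm_cball_mono // ?lerDl //.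
  exact: leq_addr.
rewrite (le_trans (hv _ sg)) // ler_wpM2l // seminorm_cball_mono // ?lerDr //.
exact: leq_addl.
Qed.

Lemma compact_distribution_opp n (u : functional (R := R) n) :
  compact_distribution u -> compact_distribution (fun h => - u h).
Proof.
move=> cu; split.
  move=> a g h sg sh; rewrite (cd_lin cu) //; ring.
have [N [k [C [N0 C0 hu]]]] := cd_bound cu.
by exists (cball N), k, C; split; [exact: compact_cball|move=> g sg; rewrite normrN; exact: hu].
Qed.

Lemma compact_distribution_sum n m (u : 'I_m -> functional (R := R) n) :
  (forall k, compact_distribution (u k)) -> compact_distribution (fun h => \sum_k u k h).
Proof.
elim: m u => [|m ih] u cu.
  split; first by move=> *; rewrite !big_ord0 mulr0 addr0.
  exists (cball 0), 0%N, 0; split; first exact: compact_cball.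
  by move=> g _; rewrite big_ord0 normr0 mul0r.
rewrite (_ : (fun h => _) = (fun h => u ord0 h + \sum_k u (lift ord0 k) h)).
  by apply: compact_distribution_add => //; exact: ih.
by apply/funext => h; rewrite big_ord_recl.
Qed.

Lemma tame_partial n (i : 'I_n) : tame (@partial R n i).
Proof.
split; first by move=> h; exact: smooth_partial.
  move=> a g h sg sh; apply/funext => x.
  by rewrite (partialD _ (smooth_scale a sg) sh (U := setT)) // (partialZ _ _ sg (U := setT)).
move=> N k N0; exists N, k.+1, 1; split => // h sh s x sk xN.
rewrite mul1r -partials_rcons; apply: seminorm_ub => //; first exact: compact_cball.
by rewrite size_rcons.
Qed.

(** Induction on the number of derivatives, for all multipliers [a] at once: the chain
    rule replaces [a] by other multipliers. *)
Lemma tame_pullback n m (io : 'rV[R]_m -> 'rV[R]_n) (a : 'rV[R]_m -> R) :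
  (forall j, smooth (fun x => io x 0 j)) -> smooth a ->
  tame (fun (h : 'rV[R]_n -> R) x => a x * h (io x)).
Proof.
move=> sio sa; split.
- by move=> h sh; exact: (smooth_mul sa (smooth_comp sio sh)).
- by move=> c g h _ _; apply/funext => x; ring.
move=> N k N0.
have [N' N'0 hN'] : exists2 N' : R, 0 <= N' & forall x, `|x| <= N -> `|io x| <= N'.
  have [|M M0 h] := @compact_locally_bounded R _ (cball N) (fun x => `|io x|) (@compact_cball m N).
    move=> p _.
    have : nbhs p [set y | forall j, `|io y 0 j - io p 0 j| <= 1].
      apply: nbhs_forall_fin => j; apply/nbhs_closed_ball.
      have cj := smooth_continuous (sio j) (x := p).
      by have [d d0 h'] := (continuous_for_closed_ball _ _).1 cj 1 ltr01; exists d.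
    move=> /nbhs_closed_ball [d d0 hd]; exists d => //; exists (`|io p| + 1) => q _ /hd /= H.
    rewrite normr_id -[io q](subrK (io p)) addrC (le_trans (ler_normD _ _)) // lerD2l.
    by apply: norm_le_coord => // j; rewrite !mxE.
  by exists M => // x xN; have := h x xN; rewrite normr_id.
suff H : exists C : R, 0 <= C /\ forall h : 'rV[R]_n -> R, smooth h ->
    forall s x, (size s <= k)%N -> `|x| <= N ->
    `|partials s (fun x => a x * h (io x)) x| <= C * seminorm (cball N') k h.
  by have [C [C0 hC]] := H; exists N', k, C; split.
elim: k a sa => [|k ih] a sa.
  have [C C0 hC] := partials_bounded 0 (@compact_cball m N) sa.
  exists C; split => // h sh [|//] x _ xN; rewrite /= normrM ler_pM //.
    exact: (hC [::]).
  by apply: (@seminorm_ub _ _ _ h [::]) => //; [exact: compact_cball|exact: hN'].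
have [C0 [C00 hC0]] := ih a sa.
have H i : exists C : R, 0 <= C /\ forall h : 'rV[R]_n -> R, smooth h ->
    forall s x, (size s <= k)%N -> `|x| <= N ->
    `|partials s (fun x => partial i a x * h (io x)) x| <= C * seminorm (cball N') k h.
  by apply: ih; exact: smooth_partial.
have [C1 hC1] := choice H.
have H2 (p : 'I_n * 'I_m) : exists C : R, 0 <= C /\ forall h : 'rV[R]_n -> R, smooth h ->
    forall s x, (size s <= k)%N -> `|x| <= N ->
    `|partials s (fun x => (a x * partial p.2 (fun y => io y 0 p.1) x) * h (io x)) x|
      <= C * seminorm (cball N') k h.
  exact: (ih _ (smooth_mul sa (smooth_partial p.2 (sio p.1)))).
have [C2 hC2] := choice H2.
exists (C0 + \sum_i C1 i + \sum_j \sum_i C2 (j, i)).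
have C10 i : 0 <= C1 i by have [] := hC1 i.
have C20 p : 0 <= C2 p by have [] := hC2 p.
have S1 : 0 <= \sum_i C1 i by apply: sumr_ge0.
have S2 : 0 <= \sum_j \sum_i C2 (j, i) by apply: sumr_ge0 => j _; apply: sumr_ge0.
split; first by rewrite !addr_ge0.
move=> h sh s x; have mono : seminorm (cball N') k h <= seminorm (cball N') k.+1 h.
  exact: seminorm_cball_mono.
have mono2 i : seminorm (cball N') k (partial i h) <= seminorm (cball N') k.+1 h.
  apply: seminorm_le; first exact: seminorm_ge0.
  move=> s' y sk yN; rewrite -partials_rcons; apply: seminorm_ub => //; first exact: compact_cball.
  by rewrite size_rcons.
have p0 := seminorm_ge0 (cball N') k.+1 h.
case/lastP: s => [|s i] sk xN.
  rewrite (le_trans (hC0 h sh [::] x _ xN)) // ler_pM ?seminorm_ge0 //.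
  by rewrite -addrA lerDl addr_ge0.
rewrite partials_rcons; rewrite size_rcons ltnS in sk.
have E : partial i (fun x => a x * h (io x)) = (fun x => partial i a x * h (io x) +
    \sum_j (a x * partial i (fun y => io y 0 j) x) * partial j h (io x)).
  apply/funext => y; have sc := smooth_comp sio sh.
  rewrite (partialM _ sa sc (U := setT)) //; congr (_ + _).
  rewrite partial_comp // mulr_sumr; apply: eq_bigr => j _; by rewrite mulrA.
have partials_add (f g : 'rV[R]_m -> R) : smooth f -> smooth g ->
    partials s (fun x => f x + g x) x = partials s f x + partials s g x.
  move=> sf sg; suff -> : partials s (fun x => f x + g x) = (fun x => partials s f x + partials s g x) by [].
  elim: (s) => [|j s' ih'] //=; rewrite ih'; apply/funext => y.
  by rewrite (partialD _ (smooth_partials s' sf) (smooth_partials s' sg) (U := setT)).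
have partials_sum q (F : 'I_q -> 'rV[R]_m -> R) : (forall j, smooth (F j)) ->
    partials s (fun x => \sum_j F j x) x = \sum_j partials s (F j) x.
  elim: q F => [|q ihq] F sF.
    rewrite big_ord0 (_ : (fun x => _) = (fun=> 0)); last by apply/funext => y; rewrite big_ord0.
    suff -> : partials s (fun=> 0) = (fun=> 0) :> ('rV[R]_m -> R) by [].
    by elim: (s) => [|j s' ih'] //=; rewrite ih'; apply/funext => y; exact: partial_cst.
  have sF' : smooth (fun x => \sum_j F (lift ord0 j) x) by apply: smooth_sum => j _; exact: sF.
  rewrite big_ord_recl -(ihq _ (fun j => sF (lift ord0 j))) -(partials_add _ _ (sF ord0) sF').
  by congr (partials s _ x); apply/funext => y; rewrite big_ord_recl.
have sh' j : smooth (fun x => partial j h (io x)) by exact: (smooth_comp sio (smooth_partial j sh)).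
have sm j : smooth (fun x => a x * partial i (fun y => io y 0 j) x * partial j h (io x)).
  exact: (smooth_mul (smooth_mul sa (smooth_partial i (sio j))) (sh' j)).
have ssm : smooth (fun x => \sum_j a x * partial i (fun y => io y 0 j) x * partial j h (io x)).
  by apply: smooth_sum => j _; exact: sm.
rewrite E (partials_add _ _ (smooth_mul (smooth_partial i sa) (smooth_comp sio sh)) ssm).
rewrite partials_sum // (le_trans (ler_normD _ _)) //.
set P := seminorm (cball N') k.+1 h in mono mono2 p0 *.
have h1 : `|partials s (fun x => partial i a x * h (io x)) x| <= (\sum_i C1 i) * P.
  have [_ h1] := hC1 i; apply: le_trans (h1 h sh s x sk xN) _.
  apply: ler_pM => //; first exact: seminorm_ge0.
  by rewrite (bigD1 i) //= lerDl sumr_ge0.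
have h2 : `|\sum_j partials s (fun x => a x * partial i (fun y => io y 0 j) x * partial j h (io x)) x|
    <= (\sum_j \sum_i C2 (j, i)) * P.
  rewrite mulr_suml (le_trans (ler_norm_sum _ _ _)) //; apply: ler_sum => j _.
  have [_ h2] := hC2 (j, i); apply: le_trans (h2 _ (smooth_partial j sh) s x sk xN) _.
  rewrite ler_pM ?seminorm_ge0 //.
  by rewrite (bigD1 i) //= lerDl sumr_ge0.
by rewrite -addrA mulrDl mulrDl (le_trans (lerD h1 h2)) // lerDr mulr_ge0.
Qed.
End Seminorms.

(** * Antiderivatives in one variable *)

Section Antiderivative.
Context {R : realType}.
Local Notation e_ i := (delta_mx 0 i).
Local Notation lam := (@lebesgue_measure R).

Definition upd n (i : 'I_n) (x : 'rV[R]_n) (v : R) : 'rV[R]_n :=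
  \row_j (if j == i then v else x 0 j).

Definition seg n (a : R) (i : 'I_n) (t : R) (x : 'rV[R]_n) := upd i x (a + t * (x 0 i - a)).

(** The integral of [h] from [a] to [x_i] in the variable of index [i], over the unit
    interval, so that the set of parameters is compact and independent of [x]. *)
Definition antideriv n (a : R) (i : 'I_n) (h : 'rV[R]_n -> R) (x : 'rV[R]_n) : R :=
  \int[lam]_(t in `[0, 1]) ((x 0 i - a) * h (seg a i t x)).

Lemma FTC_unit (F f : R -> R) : (forall t : R, is_derive t 1 F (f t)) ->
  (forall t : R, {for t, continuous f}) -> \int[lam]_(t in `[0, 1]) f t = F 1 - F 0.
Proof.
move=> dF cf.
have cF t : {for t, continuous F}.
  by apply: differentiable_continuous; apply/derivable1_diffP; case: (dF t).
have E := @continuous_FTC2 R f F 0 1 ltr01.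
rewrite /Rintegral E //.
- by apply: continuous_subspaceT.
- split; first by move=> x _; case: (dF x).
  + by apply: cvg_at_right_filter; exact: cF.
  + by apply: cvg_at_left_filter; exact: cF.
- by move=> x _; rewrite derive1E; case: (dF x).
Qed.

Lemma is_derive_upd n (h : 'rV[R]_n -> R) i (x : 'rV[R]_n) (a c t : R) : smooth h ->
  is_derive t 1 (fun t => h (upd i x (a + t * c))) (c * partial i h (upd i x (a + t * c))).
Proof.
move=> sh; have [dh Dh] := smooth_on_differentiable openT sh (I : setT (upd i x (a + t * c))).
have D0 : is_derive t 1 (fun t : R => a + t * c) c.
  have D1 := is_derive_scale c (is_derive_id t (1 : R)).
  have D2 := is_derive_add (is_derive_cst a t (1 : R)) D1.
  rewrite add0r mulr1 in D2.
  rewrite (_ : (fun t => a + t * c) = (fun y => cst a y + c * id y)) //.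
  by apply/funext => y; rewrite /= mulrC.
have Dj j : is_derive t 1 (fun t : R => upd i x (a + t * c) 0 j) (if j == i then c else 0).
  case: eqP => [->|/eqP ji].
    by rewrite (_ : (fun y => _) = (fun t => a + t * c)) //; apply/funext => y; rewrite mxE eqxx.
  rewrite (_ : (fun y => _) = (fun=> x 0 j)); first exact: is_derive_cst.
  by apply/funext => y; rewrite mxE (negbTE ji).
have [dd DD] := is_derive_comp_rV Dj dh; split => //; rewrite [LHS]DD.
rewrite (bigD1 i) //= eqxx big1 => [|j ji]; last by rewrite (negbTE ji) mul0r.
rewrite addr0 Dh (bigD1 i) //= big1 => [|k kj]; first by rewrite mxE !eqxx mul1r addr0.
by rewrite mxE eqxx (negbTE kj) mul0r.
Qed.

Section Fixed.
Variables (n : nat) (a : R) (i : 'I_n).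
Implicit Types (h : 'rV[R]_n -> R).

Let seg' (p : 'rV[R]_(n + 1)) : 'rV[R]_n :=
  \row_j (if j == i then a + p 0 (rshift n 0) * (p 0 (lshift 1 i) - a) else p 0 (lshift 1 j)).

Let Psi h (p : 'rV[R]_(n + 1)) : R := (p 0 (lshift 1 i) - a) * h (seg' p).

Let seg'E x (r : 'rV[R]_1) : seg' (row_mx x r) = seg a i (r 0 0) x.
Proof.
apply/rowP => j; rewrite [LHS]mxE [RHS]mxE; case: ifP => _; last by rewrite row_mxEl.
by rewrite row_mxEr row_mxEl.
Qed.

Let smooth_seg' j : smooth (fun p => seg' p 0 j).
Proof.
have [ji|/negbTE ji] := eqVneq j i.
  rewrite (_ : (fun p => _) = (fun p : 'rV[R]_(n + 1) => a + p 0 (rshift n 0) * (p 0 (lshift 1 i) - a))).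
    apply: smooth_add; first exact: smooth_cst.
    by apply: smooth_mul; [exact: smooth_coord|apply: smooth_sub; [exact: smooth_coord|exact: smooth_cst]].
  by apply/funext => p; rewrite mxE ji eqxx.
rewrite (_ : (fun p => _) = (fun p : 'rV[R]_(n + 1) => p 0 (lshift 1 j))); first exact: smooth_coord.
by apply/funext => p; rewrite mxE ji.
Qed.

Let smooth_Psi h : smooth h -> smooth (Psi h).
Proof.
move=> sh; apply: smooth_mul; last exact: smooth_comp.
by apply: smooth_sub; [exact: smooth_coord|exact: smooth_cst].
Qed.

Let K : set 'rV[R]_1 := cball 1.
Let D : set (measurableTypeR R) := `[0, 1]%classic.
Let rho (t : measurableTypeR R) : 'rV[R]_1 := (t : R)%:M.

Let lamD : lebesgue_measure D = 1%E.
Proof. by rewrite /D lebesgue_measure_itv /= lte01 -EFinB subr0. Qed.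

Let itgD : itg lam (\1_D : _ -> R).
Proof.
have mD : measurable D by exact: measurable_itv.
apply/integrableP; split; first by apply/measurable_EFinP; apply: measurable_indic.
under eq_integral do rewrite /= ger0_norm //.
by rewrite integral_indic // setIT [X in (X < _)%E]lamD ltry.
Qed.

Let ds h : smooth h -> dominated_smooth lam (slice_on D rho (Psi h)).
Proof.
move=> sh; apply: (@dominated_slice_on R n 1 K).
- exact: compact_cball.
- exact: measurable_itv.
- by rewrite [X in (X < _)%E]lamD ltry.
- move=> j; rewrite (_ : (fun t => _) = id); first exact: measurable_id.
  by apply/funext => t; rewrite (ord1 j) mxE eqxx mulr1n.
- move=> t; rewrite /D /= in_itv /= => /andP[t0 t1].
  by apply: norm_le_coord => // j; rewrite mxE (ord1 j) eqxx mulr1n ger0_norm.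
- by apply: smooth_smooth_rel; exact: smooth_Psi.
Qed.

Let antiderivE h x : antideriv a i h x = \int[lam]_t slice_on D rho (Psi h) x t.
Proof.
rewrite /antideriv Rintegral_mkcond; apply: eq_Rintegral => t _.
rewrite patchE /slice_on; case: ifP => // _.
by rewrite /Psi row_mxEl seg'E /rho mxE eqxx mulr1n.
Qed.

Lemma smooth_antideriv h : smooth h -> smooth (antideriv a i h).
Proof.
move=> sh; rewrite (_ : antideriv a i h = fun x => \int[lam]_t slice_on D rho (Psi h) x t).
  exact: smooth_integral (ds sh).
by apply/funext => x; exact: antiderivE.
Qed.

Lemma smooth_seg t j : smooth (fun x : 'rV[R]_n => seg a i t x 0 j).
Proof.
have [ji|/negbTE ji] := eqVneq j i.
  rewrite (_ : (fun p => _) = (fun x : 'rV[R]_n => a + t * (x 0 i - a))).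
    apply: smooth_add; first exact: smooth_cst.
    by apply: smooth_scale; apply: smooth_sub; [exact: smooth_coord|exact: smooth_cst].
  by apply/funext => p; rewrite mxE ji eqxx.
rewrite (_ : (fun p => _) = (fun p : 'rV[R]_n => p 0 j)); first exact: smooth_coord.
by apply/funext => p; rewrite mxE ji.
Qed.

Lemma partial_seg t j k (x : 'rV[R]_n) :
  partial j (fun x : 'rV[R]_n => seg a i t x 0 k) x = (if k == i then t else 1) * (k == j)%:R.
Proof.
case: eqP => [->|/eqP ki].
  rewrite (_ : (fun p => _) = (fun x : 'rV[R]_n => t * x 0 i + (a - t * a))).
    rewrite (partialD _ (U := setT)) //; [|exact: (smooth_scale t (@smooth_coord R n i))|exact: smooth_cst].
    by rewrite partial_cst addr0 (partialZ _ _ (@smooth_coord R n i) (U := setT)) // partial_coord.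
  by apply/funext => p; rewrite mxE eqxx; ring.
rewrite (_ : (fun p => _) = (fun p : 'rV[R]_n => p 0 k)); first by rewrite partial_coord mul1r.
by apply/funext => p; rewrite mxE (negbTE ki).
Qed.

Lemma partial_comp_seg h t j x : smooth h ->
  partial j (fun x => h (seg a i t x)) x = (if j == i then t else 1) * partial j h (seg a i t x).
Proof.
move=> sh; rewrite (partial_comp j x (smooth_seg t) sh).
rewrite (bigD1 j) //= big1 => [|k kj]; first by rewrite partial_seg eqxx mulr1 addr0.
by rewrite partial_seg (negbTE kj) mulr0 mul0r.
Qed.

Let partial_slice h j x t : smooth h -> D t ->
  partial j (fun x => slice_on D rho (Psi h) x t) x =
  (i == j)%:R * h (seg a i t x) + (x 0 i - a) * ((if j == i then t else 1) * partial j h (seg a i t x)).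
Proof.
move=> sh Dt.
have -> : (fun x => slice_on D rho (Psi h) x t) = (fun x => (x 0 i - a) * h (seg a i t x)).
  apply/funext => y; rewrite /slice_on mem_set // /Psi row_mxEl seg'E.
  by rewrite /rho mxE eqxx mulr1n.
have s1 : smooth (fun x : 'rV[R]_n => x 0 i - a) by apply: smooth_sub; [exact: smooth_coord|exact: smooth_cst].
have s2 : smooth (fun x => h (seg a i t x)) by exact: (smooth_comp (smooth_seg t) sh).
rewrite (partialM _ s1 s2 (U := setT)) // partial_comp_seg //; congr (_ * _ + _).
rewrite (partialB _ (@smooth_coord R n i) (@smooth_cst R n a) (U := setT)) //.
by rewrite partial_coord partial_cst subr0.
Qed.

Lemma partial_antideriv_neq h j : smooth h -> j != i ->
  partial j (antideriv a i h) = antideriv a i (partial j h).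
Proof.
move=> sh ji; apply/funext => x.
rewrite (_ : antideriv a i h = fun x => \int[lam]_t slice_on D rho (Psi h) x t); last first.
  by apply/funext => y; exact: antiderivE.
rewrite (partial_integral j x (ds sh)) /antideriv [RHS]Rintegral_mkcond.
apply: eq_Rintegral => t _; rewrite patchE; case: ifPn => tD.
  rewrite partial_slice //; last exact: set_mem.
  by rewrite eq_sym (negbTE ji) mul0r add0r mul1r.
rewrite (_ : (fun x => _) = (fun=> 0)); first exact: partial_cst.
by apply/funext => y; rewrite /slice_on (negbTE tD).
Qed.

Lemma partial_antideriv h : smooth h -> partial i (antideriv a i h) = h.
Proof.
move=> sh; apply/funext => x.
rewrite (_ : antideriv a i h = fun x => \int[lam]_t slice_on D rho (Psi h) x t); last first.
  by apply/funext => y; exact: antiderivE.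
rewrite (partial_integral i x (ds sh)).
transitivity (\int[lam]_(t in `[0, 1]) (1 * h (seg a i t x) + t * ((x 0 i - a) * partial i h (seg a i t x)))).
  rewrite [RHS]Rintegral_mkcond; apply: eq_Rintegral => t _; rewrite patchE; case: ifPn => tD.
    rewrite partial_slice //; last exact: set_mem.
    by rewrite eqxx; congr (_ + _); rewrite mulrCA.
  rewrite (_ : (fun x => _) = (fun=> 0)); first exact: partial_cst.
  by apply/funext => y; rewrite /slice_on (negbTE tD).
pose f (t : R) := 1 * h (seg a i t x) + t * ((x 0 i - a) * partial i h (seg a i t x)).
have df (t : R) : is_derive t 1 (fun t => t * h (seg a i t x)) (f t).
  exact: (is_derive_mul (is_derive_id t (1 : R)) (is_derive_upd i x a (x 0 i - a) t sh)).
have cf (t : R) : {for t, continuous f}.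
  have ch (g : 'rV[R]_n -> R) : smooth g -> {for t, continuous (fun t => g (seg a i t x))}.
    move=> sg; apply: differentiable_continuous; apply/derivable1_diffP.
    by have [] := is_derive_upd i x a (x 0 i - a) t sg.
  apply: continuous_for_add; first by apply: continuous_for_mul; [exact: cst_continuous|exact: ch].
  apply: continuous_for_mul; first exact: id.
  by apply: continuous_for_mul; [exact: cst_continuous|apply: ch; exact: smooth_partial].
rewrite (FTC_unit df cf) mul1r mul0r subr0; congr h; apply/rowP => j.
by rewrite mxE mul1r addrC subrK; case: eqP => [->|].
Qed.

Lemma antideriv_partial h x : smooth h -> antideriv a i (partial i h) x = h x - h (upd i x a).
Proof.
move=> sh; have df (t : R) := is_derive_upd i x a (x 0 i - a) t sh.
have cf (t : R) : {for t, continuous (fun t : R => (x 0 i - a) * partial i h (upd i x (a + t * (x 0 i - a))))}.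
  apply: continuous_for_mul; first exact: cst_continuous.
  apply: differentiable_continuous; apply/derivable1_diffP.
  by have [] := is_derive_upd i x a (x 0 i - a) t (smooth_partial i sh).
rewrite /antideriv (FTC_unit df cf); congr (h _ - h _); apply/rowP => j; rewrite !mxE.
  by rewrite mul1r [a + _]addrC subrK; case: eqP => [->|].
by rewrite mul0r addr0.
Qed.

Let itg_seg h x : smooth h -> itg lam (slice_on D rho (Psi h) x).
Proof. by move=> sh; exact: ds_itg (ds sh). Qed.

Lemma antideriv_lin c g h : smooth g -> smooth h ->
  antideriv a i (fun x => c * g x + h x) = (fun x => c * antideriv a i g x + antideriv a i h x).
Proof.
move=> sg sh; apply/funext => x; rewrite !antiderivE -int_scale; last exact: itg_seg.
rewrite -int_add; [|by apply: itg_scale; exact: itg_seg|exact: itg_seg].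
apply: eq_Rintegral => t _; rewrite /slice_on; case: ifP => _; last by rewrite mulr0 addr0.
by rewrite /Psi; ring.
Qed.

(** Only the values on the segment from [x_i = a] to [x] enter. *)
Lemma antideriv_bound h x M : smooth h ->
  (forall t, 0 <= t <= 1 -> `|h (seg a i t x)| <= M) ->
  `|antideriv a i h x| <= `|x 0 i - a| * M.
Proof.
move=> sh hM; rewrite antiderivE.
have M0 : 0 <= M by apply: le_trans (hM 0 _) => //; rewrite lexx ler01.
apply: (@le_trans _ _ (\int[lam]_t (`|x 0 i - a| * M * \1_D t))).
  apply: int_norm_le; [exact: itg_seg|exact: itg_scale|].
  move=> t; rewrite /slice_on indicE; case: ifPn => tD; last by rewrite normr0 mulr0.
  rewrite mulr1 /Psi row_mxEl seg'E /rho mxE eqxx mulr1n normrM ler_wpM2l //.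
  by apply: hM; have := set_mem tD; rewrite /D /= in_itv.
rewrite int_scale // /Rintegral integral_indic //; last exact: measurable_itv.
by rewrite setIT [X in fine X]lamD /= mulr1.
Qed.

Lemma norm_seg_le t (x : 'rV[R]_n) N : `|a| <= N -> `|x| <= N -> 0 <= t <= 1 -> `|seg a i t x| <= N.
Proof.
move=> aN xN /andP[t0 t1].
apply: norm_le_coord => [|j]; first exact: le_trans aN.
rewrite mxE; case: eqP => _; last exact: le_trans (coord_le_norm _ _) xN.
have -> : a + t * (x 0 i - a) = (1 - t) * a + t * x 0 i by ring.
have xi := le_trans (coord_le_norm x i) xN.
rewrite (le_trans (ler_normD _ _)) // !normrM (ger0_norm t0) ger0_norm; last lra.
have -> : N = (1 - t) * N + t * N by ring.
by rewrite lerD // ler_wpM2l //; lra.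
Qed.

Lemma antideriv_cball_bound h N M x : smooth h -> `|a| <= N ->
  (forall y, `|y| <= N -> `|h y| <= M) -> `|x| <= N -> `|antideriv a i h x| <= (N + N) * M.
Proof.
move=> sh aN hM xN.
have M0 : 0 <= M by exact: le_trans (hM x xN).
have N0 : 0 <= N by apply: le_trans xN.
apply: le_trans (antideriv_bound sh (M := M) _) _.
  by move=> t t01; apply: hM; exact: norm_seg_le.
rewrite ler_wpM2r // (le_trans (ler_normB _ _)) // lerD //.
exact: le_trans (coord_le_norm _ _) xN.
Qed.

Lemma tame_antideriv : tame (@antideriv n a i).
Proof.
split; [exact: smooth_antideriv|by move=> *; exact: antideriv_lin|].
move=> N k N0; pose N' := N + `|a|.
have N'0 : 0 <= N' by rewrite addr_ge0.
have NN : N <= N' by rewrite lerDl.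
have aN : `|a| <= N' by rewrite lerDr.
exists N', k, (1 + (N' + N')); split => //; first by rewrite !addr_ge0.
elim: k => [|k ih] h sh s x.
  case: s => [|//] _ xN.
  apply: le_trans (antideriv_cball_bound sh aN (M := seminorm (cball N') 0 h) _ _) _.
  - by move=> y yN; apply: (@seminorm_ub _ _ _ _ h [::]) => //; exact: compact_cball.
  - exact: le_trans xN NN.
  - by rewrite ler_wpM2r ?seminorm_ge0 // lerDr.
have C0 : 0 <= 1 + (N' + N') by rewrite !addr_ge0.
have mono : seminorm (cball N') k h <= seminorm (cball N') k.+1 h.
  exact: seminorm_cball_mono.
case/lastP: s => [|s j] sk xN.
  by rewrite (le_trans (ih h sh [::] x _ xN)) // ler_wpM2l.
rewrite partials_rcons; rewrite size_rcons ltnS in sk.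
have [->|ji] := eqVneq j i.
  rewrite partial_antideriv // mulrDl mul1r -[leLHS]addr0 lerD //.
    apply: seminorm_ub => //; [exact: compact_cball|exact: leq_trans sk _|exact: le_trans xN NN].
  by rewrite mulr_ge0 ?addr_ge0 // seminorm_ge0.
rewrite partial_antideriv_neq // (le_trans (ih _ (smooth_partial j sh) s x sk xN)) //.
rewrite ler_wpM2l //; apply: seminorm_le; first exact: seminorm_ge0.
move=> s' y sk' yN; rewrite -partials_rcons; apply: seminorm_ub => //; first exact: compact_cball.
by rewrite size_rcons.
Qed.
End Fixed.
End Antiderivative.

(** * Powers of the norm, and plateaus *)

Section Bumps.
Context {R : realType}.
Local Notation e_ i := (delta_mx 0 i).

(** The inverse square root: [isq (dot x x) ^+ k] is [|x|^-k], for even and odd [k]. *)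
Definition isq (t : R) : R := (Num.sqrt t)^-1.

Lemma isq_gt0 t : 0 < t -> 0 < isq t.
Proof. by move=> t0; rewrite invr_gt0 sqrtr_gt0. Qed.

Lemma isq_sqr t : 0 <= t -> isq t ^+ 2 = t^-1.
Proof. by move=> t0; rewrite exprVn sqr_sqrtr. Qed.

Lemma is_derive_horner (p : {poly R}) (x : R) : is_derive x 1 (horner p) p^`().[x].
Proof.
apply: DeriveDef; first exact: derivable_horner.
by rewrite derivE derive1E.
Qed.

Lemma is_derive_inv (t : R) : t != 0 -> is_derive t 1 (fun t : R => t^-1) (- (t ^- 2)).
Proof.
move=> t0; have := @is_deriveV R id t 1 1 t0 (is_derive_id t 1).
by rewrite [_ *: _]mulr1.
Qed.

Lemma is_derive_isqX k (t : R) : 0 < t ->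
  is_derive t 1 (fun t => isq t ^+ k) (- (k%:R / 2) * isq t ^+ (k + 2)).
Proof.
move=> t0; have s0 : Num.sqrt t != 0 by rewrite gt_eqF // sqrtr_gt0.
have D1 := is_derive1_sqrt t0.
have D2 := is_derive_comp1 (is_derive_inv s0) D1.
have D3 := is_derive_comp1 (k := fun y : R => (Num.sqrt y)^-1) (is_derive_horner 'X^k ((Num.sqrt t)^-1)) D2.
rewrite (_ : (fun t => isq t ^+ k) = (fun y => ('X^k).[(Num.sqrt y)^-1])).
  apply: is_derive_eq; rewrite derivXn hornerMn hornerXn /isq.
  case: k D3 => [|k] _; first by rewrite mulr0n mulr0 mul0r oppr0 mul0r.
  rewrite -mulr_natl /= expr2 !invfM exprD exprS.
  by move: (Num.sqrt t)^-1 => y; rewrite expr2; field.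
by apply/funext => y; rewrite hornerXn.
Qed.

Section IsqSmooth.
Variables (n : nat) (U : set 'rV[R]_n) (q : 'rV[R]_n -> R).
Hypotheses (oU : open U) (sq : smooth_on U q) (q0 : forall x, U x -> 0 < q x).

Lemma smooth_on_isqX k : smooth_on U (fun x => isq (q x) ^+ k).
Proof.
pose E (e : R -> R) := exists c k, e = fun t => c * isq t ^+ k.
have H : E (fun t => 1 * isq t ^+ k) by exists 1, k.
apply: (@smooth_on_eq _ _ _ (fun x => 1 * isq (q x) ^+ k) _ oU).
  by move=> x _; rewrite mul1r.
apply: (@smooth_on_comp1 _ _ U [set t | 0 < t] E q oU sq q0 _ _ H) => _ [c [l ->]].
exists (fun t => (c * (- (l%:R / 2))) * isq t ^+ (l + 2)).
  by exists (c * (- (l%:R / 2))), (l + 2)%N.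
by move=> t /= t0; rewrite -mulrA; apply: is_derive_scale; exact: is_derive_isqX.
Qed.

Lemma partial_isqX k i x : U x ->
  partial i (fun x => isq (q x) ^+ k) x = - (k%:R / 2) * isq (q x) ^+ (k + 2) * partial i q x.
Proof.
move=> Ux; have D := is_derive_partial i sq Ux.
by have [_] := is_derive_comp1 (k := q) (is_derive_isqX k (q0 Ux)) D; rewrite mulrC.
Qed.
End IsqSmooth.

Lemma smooth_on_inv n (U : set 'rV[R]_n) f : open U -> smooth_on U f ->
  (forall x, U x -> f x != 0) -> smooth_on U (fun x => (f x)^-1).
Proof.
move=> oU sf f0; have s2 := smooth_on_mul oU sf sf.
have p2 x : U x -> 0 < f x * f x.
  by move=> Ux; rewrite -expr2 lt_neqAle sqr_ge0 eq_sym sqrf_eq0 f0.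
apply: smooth_on_eq (smooth_on_mul oU sf (smooth_on_isqX oU s2 p2 2)) => // x Ux.
by rewrite isq_sqr ?(ltW (p2 _ Ux)) // invfM mulrA divff ?mul1r // f0.
Qed.

(** The functions [p(1/t) exp(-1/t)], extended by zero: as a family, indexed by the
    polynomial [p], they are stable under differentiation. *)
Definition flatp (p : {poly R}) (t : R) : R := if 0 < t then p.[t^-1] * expR (- t^-1) else 0.

Lemma poly_exp_bound (p : {poly R}) : exists2 C : R, 0 <= C & forall y, 0 < y ->
  `|p.[y]| * expR (- y) <= C * y^-1.
Proof.
exists (\sum_(i < size p) `|p`_i| * (i.+1)`!%:R).
  by apply: sumr_ge0 => i _; rewrite mulr_ge0.
move=> y y0; rewrite horner_coef.
rewrite ler_pdivlMr // -mulrA.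
rewrite (le_trans (ler_wpM2r _ (ler_norm_sum _ _ _))) ?mulr_ge0 ?expR_ge0 ?(ltW y0) // mulr_suml.
apply: ler_sum => i _; rewrite normrM -mulrA ler_wpM2l // normrX (gtr0_norm y0).
rewrite expRN mulrCA -exprSr mulrC ler_pdivrMr ?expR_gt0 //.
rewrite mulrC -ler_pdivrMr ?ltr0n ?fact_gt0 //.
by apply: le_trans (expR_ge1Dxn i (ltW y0)); rewrite lerDr.
Qed.

Lemma is_derive_flatp p (t : R) : is_derive t 1 (flatp p) (flatp ((p - p^`()) * 'X^2) t).
Proof.
have [t0|t0|->] := ltgtP t 0.
- rewrite {2}/flatp ltNge (ltW t0) /=.
  refine (near_eq_is_derive (f := cst 0) _ (is_derive_cst 0 t 1)).
  near=> s; rewrite /flatp ltNge ltW //; near: s; exact: lt_nbhsl.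
- rewrite {2}/flatp t0.
  have D1 := is_derive_inv (lt0r_neq0 t0).
  have D2 := is_derive_comp1 (k := fun y : R => y^-1) (is_derive_horner p t^-1) D1.
  have D3 := is_derive_comp1 (k := fun y : R => -1 * y^-1) (is_derive_expR (-1 * t^-1)) (is_derive_scale (-1) D1).
  have D := is_derive_mul D2 D3.
  have E : (p - p^`()) * 'X^2 = (p - p^`()) * 'X * 'X by rewrite expr2 mulrA.
  have D' : is_derive t 1 (fun y : R => p.[y^-1] * expR (-1 * y^-1))
      (((p - p^`()) * 'X^2).[t^-1] * expR (- t^-1)).
    have EP y : ((p - p^`()) * 'X * 'X).[y] = (p.[y] - p^`().[y]) * y * y by rewrite !hornerE.
    by apply: is_derive_eq; rewrite E EP mulN1r expr2 invfM; ring.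
  refine (near_eq_is_derive _ D').
  near=> s; rewrite /flatp ifT ?mulN1r //; near: s; exact: lt_nbhsr.
- rewrite {2}/flatp ltxx.
  have [C C0 hC] := poly_exp_bound (p * 'X).
  have bnd s : `|flatp p s| <= C * s ^+ 2.
    rewrite /flatp; case: ifP => s0; last by rewrite normr0 mulr_ge0 // sqr_ge0.
    have := hC s^-1; rewrite invr_gt0 => /(_ s0); rewrite hornerMX normrM invrK.
    rewrite (gtr0_norm (_ : 0 < s^-1)) ?invr_gt0 // mulrAC ler_pdivrMr //.
    by rewrite normrM (ger0_norm (expR_ge0 _)) -mulrA expr2.
  suff C' : h^-1 *: ((flatp p \o shift 0) (h *: 1) - flatp p 0) @[h --> 0^'] --> (0 : R).
    split; first by apply/cvg_ex; exists 0.
    exact: cvg_lim C'.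
  apply/cvgrPdist_le => e e0; near=> h.
  have h0 : h != 0 by near: h; exact: nbhs_dnbhs_neq.
  rewrite sub0r normrN /= [_ *: 1]mulr1 addr0 {2}/flatp ltxx subr0.
  rewrite normrM normfV mulrC ler_pdivrMr ?normr_gt0 //.
  apply: le_trans (bnd h) _; rewrite -normr_id -real_normK ?num_real // expr2 mulrA normr_id.
  rewrite ler_wpM2r //.
  have : `|h| <= e / (C + 1) by near: h; apply: dnbhs0_le; rewrite divr_gt0 // ltr_wpDl.
  move=> he; apply: (@le_trans _ _ ((C + 1) * `|h|)); first by rewrite ler_wpM2r // lerDl.
  by rewrite mulrC -ler_pdivlMr // ltr_wpDl.
Unshelve. all: by end_near. Qed.

Definition flat (t : R) := flatp 1 t.

Lemma flat_gt0 t : 0 < t -> 0 < flat t.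
Proof. by move=> t0; rewrite /flat /flatp t0 hornerE mul1r expR_gt0. Qed.

Lemma flat_eq0 t : t <= 0 -> flat t = 0.
Proof. by move=> t0; rewrite /flat /flatp ltNge t0. Qed.

Lemma flat_ge0 t : 0 <= flat t.
Proof. by have [/flat_eq0 ->|/flat_gt0/ltW] := leP t 0. Qed.

Lemma smooth_flat n (g : 'rV[R]_n -> R) : smooth g -> smooth (fun x => flat (g x)).
Proof.
move=> sg; pose E (e : R -> R) := exists p, e = flatp p.
have H : E flat by exists 1.
apply: (@smooth_on_comp1 _ _ setT setT E g openT sg (fun _ _ => I) _ _ H) => _ [p ->].
exists (flatp ((p - p^`()) * 'X^2)); first by exists ((p - p^`()) * 'X^2).
by move=> t _; exact: is_derive_flatp.
Qed.

Definition plateau (a b t : R) := flat (b - t) / (flat (b - t) + flat (t - a)).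

Section Plateau.
Variables (a b : R).
Hypothesis ab : a < b.

Lemma plateau_den t : 0 < flat (b - t) + flat (t - a).
Proof.
have [tb|bt] := ltP t b; first by rewrite ltr_pwDl ?flat_ge0 // flat_gt0 // subr_gt0.
by rewrite ltr_wpDl ?flat_ge0 // flat_gt0 // subr_gt0 (lt_le_trans ab).
Qed.

Lemma plateau1 t : t <= a -> plateau a b t = 1.
Proof.
move=> ta; rewrite /plateau [flat (t - a)]flat_eq0 ?subr_le0 // addr0 divff // gt_eqF //.
by rewrite flat_gt0 // subr_gt0 (le_lt_trans ta).
Qed.

Lemma plateau0 t : b <= t -> plateau a b t = 0.
Proof. by move=> bt; rewrite /plateau flat_eq0 ?mul0r // subr_le0. Qed.

Lemma smooth_plateau n (g : 'rV[R]_n -> R) : smooth g -> smooth (fun x => plateau a b (g x)).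
Proof.
move=> sg; apply: smooth_mul.
  exact: (smooth_flat (smooth_sub (@smooth_cst R n b) sg)).
apply: smooth_on_inv; first exact: openT.
  exact: (smooth_add (smooth_flat (smooth_sub (@smooth_cst R n b) sg)) (smooth_flat (smooth_sub sg (@smooth_cst R n a)))).
by move=> x _; rewrite gt_eqF // plateau_den.
Qed.
End Plateau.

Lemma dotC n (x y : 'rV[R]_n) : dot x y = dot y x.
Proof. by apply: eq_bigr => i _; rewrite mulrC. Qed.

Lemma dotDl n (x y z : 'rV[R]_n) : dot (x + y) z = dot x z + dot y z.
Proof. by rewrite /dot -big_split; apply: eq_bigr => i _; rewrite mxE mulrDl. Qed.

Lemma dotZl n c (x z : 'rV[R]_n) : dot (c *: x) z = c * dot x z.
Proof. by rewrite /dot mulr_sumr; apply: eq_bigr => i _; rewrite mxE mulrA. Qed.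

Lemma dotDr n (x y z : 'rV[R]_n) : dot z (x + y) = dot z x + dot z y.
Proof. by rewrite dotC dotDl !(dotC z). Qed.

Lemma dotZr n c (x z : 'rV[R]_n) : dot z (c *: x) = c * dot z x.
Proof. by rewrite dotC dotZl dotC. Qed.

Lemma dotNl n (x z : 'rV[R]_n) : dot (- x) z = - dot x z.
Proof. by rewrite -scaleN1r dotZl mulN1r. Qed.

Lemma dot_ge0 n (x : 'rV[R]_n) : 0 <= dot x x.
Proof. by apply: sumr_ge0 => i _; rewrite -expr2 sqr_ge0. Qed.

Lemma sqr_coord_le_dot n (x : 'rV[R]_n) i : x 0 i ^+ 2 <= dot x x.
Proof.
rewrite /dot (bigD1 i) //= -expr2 lerDl; apply: sumr_ge0 => j _.
by rewrite -expr2 sqr_ge0.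
Qed.

Lemma coord_le_dot n (x : 'rV[R]_n) i (r : R) : 0 <= r -> dot x x <= r ^+ 2 -> `|x 0 i| <= r.
Proof.
move=> r0 h; rewrite -(ler_pXn2r (ltn0Sn 1)) ?nnegrE // -normrX.
by rewrite ger0_norm ?sqr_ge0 // (le_trans (sqr_coord_le_dot x i)).
Qed.

Lemma norm_le_dot n (x : 'rV[R]_n) (r : R) : 0 <= r -> dot x x <= r ^+ 2 -> `|x| <= r.
Proof. by move=> r0 h; apply: norm_le_coord => // i; exact: coord_le_dot h. Qed.

Lemma dot_le_norm n (x : 'rV[R]_n) : dot x x <= n%:R * `|x| ^+ 2.
Proof.
apply: (@le_trans _ _ (\sum_(i < n) `|x| ^+ 2)); last by rewrite sumr_const card_ord mulr_natl.
apply: ler_sum => i _; rewrite -expr2 -real_normK ?num_real //.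
by rewrite ler_pXn2r ?nnegrE // coord_le_norm.
Qed.

Lemma dot_eq0 n (x : 'rV[R]_n) : dot x x = 0 -> x = 0.
Proof.
move=> h; apply/rowP => i; rewrite mxE; apply/eqP; rewrite -sqrf_eq0 eq_le sqr_ge0 andbT -h.
exact: sqr_coord_le_dot.
Qed.

Lemma smooth_dot n m (f g : 'rV[R]_m -> 'rV[R]_n) : (forall j, smooth (fun x => f x 0 j)) ->
  (forall j, smooth (fun x => g x 0 j)) -> smooth (fun x => dot (f x) (g x)).
Proof. by move=> sf sg; apply: smooth_sum => i _; exact: smooth_mul. Qed.

Lemma smooth_sqn n : smooth (fun x : 'rV[R]_n => dot x x).
Proof. by apply: smooth_dot => j; exact: smooth_coord. Qed.

Lemma partial_sqn n i (x : 'rV[R]_n) : partial i (fun x : 'rV[R]_n => dot x x) x = 2 * x 0 i.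
Proof.
rewrite /dot (partial_sum _ (U := setT)) //; last first.
  by move=> k; apply: smooth_mul; exact: smooth_coord.
rewrite (bigD1 i) //= big1 => [|j ji].
  rewrite (partialM _ (@smooth_coord R n i) (@smooth_coord R n i) (U := setT)) //.
  by rewrite !partial_coord eqxx addr0 mul1r mulr1 mulr_natl mulr2n.
rewrite (partialM _ (@smooth_coord R n j) (@smooth_coord R n j) (U := setT)) //.
by rewrite !partial_coord (negbTE ji) mul0r mulr0 addr0.
Qed.

End Bumps.

(** * Distributions that annihilate the polynomials *)

Section Weierstrass.
Context {R : realType}.
Local Notation e_ i := (delta_mx 0 i).

(** The index bounds the degree; it is needed because homogeneity couples the degree of a
    polynomial with the powers of the norm that accompany it. *)
Inductive polyfun n : nat -> ('rV[R]_n -> R) -> Prop :=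
| PolyCst d c : polyfun d (fun=> c)
| PolyAdd d P Q : polyfun d P -> polyfun d Q -> polyfun d (fun x => P x + Q x)
| PolyMulX d i P : polyfun d P -> polyfun d.+1 (fun x => x 0 i * P x).

Lemma polyfun_smooth n d (P : 'rV[R]_n -> R) : polyfun d P -> smooth P.
Proof.
elim=> [? ?|? ? ? _ sP _ sQ|? i ? _ sP]; first exact: smooth_cst.
  exact: (smooth_add sP sQ).
exact: (smooth_mul (@smooth_coord R n i) sP).
Qed.

Lemma polyfun_le n d e (P : 'rV[R]_n -> R) : (d <= e)%N -> polyfun d P -> polyfun e P.
Proof.
move=> de pP; elim: pP e de => {d P} [d c e _|d P Q _ iP _ iQ e de|d i P _ iP [//|e] de].
- exact: PolyCst.
- by apply: PolyAdd; [exact: iP|exact: iQ].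
- by apply: PolyMulX; exact: iP.
Qed.

Lemma polyfun_scale n d c (P : 'rV[R]_n -> R) : polyfun d P -> polyfun d (fun x => c * P x).
Proof.
elim=> {d P} [d b|d P Q _ iP _ iQ|d i P _ iP]; first exact: PolyCst.
  rewrite (_ : (fun x => _) = (fun x => c * P x + c * Q x)); first exact: PolyAdd.
  by apply/funext => x; rewrite mulrDr.
rewrite (_ : (fun x => _) = (fun x : 'rV[R]_n => x 0 i * (c * P x))); first exact: PolyMulX.
by apply/funext => x; rewrite mulrCA.
Qed.

Lemma polyfun_mul n d e (P Q : 'rV[R]_n -> R) : polyfun d P -> polyfun e Q ->
  polyfun (d + e) (fun x => P x * Q x).
Proof.
move=> pP pQ; elim: pP => {d P} [d b|d P P' _ iP _ iP'|d i P _ iP].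
- by apply: (polyfun_le (leq_addl d e)); exact: polyfun_scale.
- rewrite (_ : (fun x => _) = (fun x => P x * Q x + P' x * Q x)); first exact: PolyAdd.
  by apply/funext => x; rewrite mulrDl.
- rewrite (_ : (fun x => _) = (fun x : 'rV[R]_n => x 0 i * (P x * Q x))); first exact: PolyMulX.
  by apply/funext => x; rewrite mulrA.
Qed.

Lemma polyfun_sub n d (P Q : 'rV[R]_n -> R) : polyfun d P -> polyfun d Q ->
  polyfun d (fun x => P x - Q x).
Proof.
move=> pP pQ; rewrite (_ : (fun x => _) = (fun x => P x + (-1) * Q x)).
  by apply: PolyAdd => //; exact: polyfun_scale.
by apply/funext => x; rewrite mulN1r.
Qed.

Lemma polyfun_coord n i : polyfun 1 (fun x : 'rV[R]_n => x 0 i).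
Proof.
rewrite (_ : (fun x => _) = (fun x : 'rV[R]_n => x 0 i * 1)).
  by apply: PolyMulX; exact: PolyCst.
by apply/funext => x; rewrite mulr1.
Qed.

Section AntiderivPoly.
Variables (n : nat) (a : R) (i : 'I_n).
Local Notation J := (@antideriv R n a i).

Lemma antideriv_base h x : J h (upd i x a) = 0.
Proof.
rewrite /antideriv; under eq_Rintegral do rewrite mxE eqxx subrr mul0r.
by rewrite /Rintegral integral0.
Qed.

Lemma antideriv0 x : J (fun=> 0) x = 0.
Proof.
rewrite /antideriv; under eq_Rintegral do rewrite mulr0.
by rewrite /Rintegral integral0.
Qed.

(** Integration by parts. *)
Lemma antideriv_mulX G : smooth G -> J (fun x : 'rV[R]_n => x 0 i * G x) = (fun x : 'rV[R]_n => x 0 i * J G x - J (J G) x).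
Proof.
move=> sG; have sJ := smooth_antideriv a i sG; have sJJ := smooth_antideriv a i sJ.
have sc := @smooth_coord R n i.
pose F (x : 'rV[R]_n) := x 0 i * J G x - J (J G) x.
have sF : smooth F by exact: (smooth_sub (smooth_mul sc sJ) sJJ).
have dF : partial i F = (fun x : 'rV[R]_n => x 0 i * G x).
  apply/funext => x; rewrite (partialB _ (smooth_mul sc sJ) sJJ (U := setT)) //.
  rewrite (partialM _ sc sJ (U := setT)) // partial_coord eqxx mul1r.
  by rewrite !partial_antideriv // addrC addrA addNr add0r.
apply/funext => x; rewrite -dF antideriv_partial // /F !antideriv_base mulr0 subr0 subr0 //.
Qed.

Lemma antideriv_mulX_neq j G : smooth G -> j != i -> J (fun x : 'rV[R]_n => x 0 j * G x) = (fun x : 'rV[R]_n => x 0 j * J G x).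
Proof.
move=> sG ji; apply/funext => x.
transitivity (J (fun y => x 0 j * G y + 0) x).
  by rewrite /antideriv; apply: eq_Rintegral => t _; rewrite addr0 mxE (negbTE ji).
rewrite (antideriv_lin a i (x 0 j) sG (@smooth_cst R n 0)) antideriv0 addr0 //.
Qed.

Lemma antideriv_polyfun_iter d (P : 'rV[R]_n -> R) : polyfun d P ->
  forall k, exists e, polyfun e (iter k J P).
Proof.
have sJ G k : smooth G -> smooth (iter k J G).
  by move=> sG; elim: k => [|k ih]; [exact: sG|exact: (smooth_antideriv a i ih)].
have lJ c G H k : smooth G -> smooth H ->
    iter k J (fun x => c * G x + H x) = (fun x => c * iter k J G x + iter k J H x).
  move=> sG sH; elim: k => [|k ih] //=; by rewrite ih (antideriv_lin a i c (sJ _ k sG) (sJ _ k sH)).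
have XJ G k : smooth G -> iter k J (fun x : 'rV[R]_n => x 0 i * G x) =
    (fun x : 'rV[R]_n => x 0 i * iter k J G x - k%:R * iter k.+1 J G x).
  move=> sG; elim: k => [|k ih]; first by apply/funext => x /=; rewrite mul0r subr0.
  have s1 := sJ _ k sG; have s2 := sJ _ k.+1 sG.
  have s3 : smooth (fun x : 'rV[R]_n => x 0 i * iter k J G x) by exact: (smooth_mul (@smooth_coord R n i) s1).
  rewrite iterS ih.
  rewrite (_ : (fun x => _) = (fun x : 'rV[R]_n => (- k%:R) * iter k.+1 J G x + x 0 i * iter k J G x)); last first.
    by apply/funext => x; rewrite mulNr addrC.
  rewrite (antideriv_lin a i _ s2 s3) antideriv_mulX //.
  by apply/funext => x; rewrite -!iterS -natr1; ring.
have C1 k : exists e, polyfun e (iter k J (fun=> 1)).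
  elim: k => [|k [e pe]]; first by exists 0%N; exact: PolyCst.
  exists e.+1.
  have s1 := @smooth_cst R n 1.
  have E : iter k.+1 J (fun=> 1) = (fun x : 'rV[R]_n => k.+1%:R^-1 *
      (x 0 i * iter k J (fun=> 1) x - a * iter k J (fun=> 1) x)).
    have E1 : J (fun=> 1) = (fun x : 'rV[R]_n => (- a) * 1 + x 0 i * 1).
      have sx : smooth (fun x : 'rV[R]_n => (- a) * 1 + x 0 i * 1).
        apply: smooth_add; first exact: smooth_cst.
        by apply: smooth_mul; [exact: smooth_coord|exact: smooth_cst].
      have dx : partial i (fun x : 'rV[R]_n => (- a) * 1 + x 0 i * 1) = (fun=> 1).
        have s2 := smooth_mul (@smooth_coord R n i) (@smooth_cst R n 1).
        apply/funext => x; apply: (etrans (partialD (U := setT) i (@smooth_cst R n (- a * 1)) s2 I)).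
        rewrite partial_cst add0r (partialM _ (@smooth_coord R n i) (@smooth_cst R n 1) (U := setT)) //.
        by rewrite partial_coord partial_cst eqxx mulr0 addr0 mul1r.
      by rewrite -{1}dx; apply/funext => x; rewrite antideriv_partial // mxE eqxx; ring.
    have sx1 : smooth (fun x : 'rV[R]_n => x 0 i * 1).
      by apply: smooth_mul; [exact: smooth_coord|exact: smooth_cst].
    have := lJ (- a) _ _ k s1 sx1; rewrite -E1 XJ // -iterSr => E2.
    apply/funext => x; have E3 := congr1 (fun f => f x) E2; rewrite /= in E3 *.
    have k0 : k.+1%:R != 0 :> R by rewrite pnatr_eq0.
    apply: (mulfI k0); rewrite [RHS]mulrA divff // mul1r -natr1 mulrDl mul1r [X in _ + X = _]E3.
    ring.
  rewrite E; apply: polyfun_scale; apply: polyfun_sub; first exact: PolyMulX.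
  by apply: (polyfun_le (leqnSn e)); exact: polyfun_scale.
elim=> {d P} [d c k|d P Q pP iP pQ iQ k|d j P pP iP k].
- have [e pe] := C1 k; exists e.
  rewrite (_ : iter k J (fun=> c) = (fun x => c * iter k J (fun=> 1) x)); first exact: polyfun_scale.
  have := lJ c _ _ k (@smooth_cst R n 1) (@smooth_cst R n 0).
  rewrite (_ : (fun x => c * 1 + 0) = (fun=> c)) => [->|]; last by apply/funext => x; rewrite mulr1 addr0.
  apply/funext => x; rewrite (_ : iter k J (fun=> 0) = (fun=> 0)) ?addr0 //.
  by elim: k {pe} => [|k ih] //=; rewrite ih; apply/funext => y; exact: antideriv0.
- have [e1 p1] := iP k; have [e2 p2] := iQ k; exists (maxn e1 e2).
  have := lJ 1 _ _ k (polyfun_smooth pP) (polyfun_smooth pQ).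
  rewrite (_ : (fun x => 1 * P x + Q x) = (fun x => P x + Q x)) => [->|]; last by apply/funext => x; rewrite mul1r.
  rewrite (_ : (fun x => _) = (fun x => iter k J P x + iter k J Q x)); last by apply/funext => x; rewrite mul1r.
  by apply: PolyAdd; [exact: polyfun_le (leq_maxl _ _) p1|exact: polyfun_le (leq_maxr _ _) p2].
- have sP := polyfun_smooth pP.
  have [->|ji] := eqVneq j i.
    have [e1 p1] := iP k; have [e2 p2] := iP k.+1; exists (maxn e1.+1 e2).
    rewrite XJ //; apply: polyfun_sub; first by apply: (polyfun_le (leq_maxl _ _)); exact: PolyMulX.
    by apply: (polyfun_le (leq_maxr _ _)); exact: polyfun_scale.
  have [e1 p1] := iP k; exists e1.+1.
  rewrite (_ : iter k J _ = (fun x : 'rV[R]_n => x 0 j * iter k J P x)); first exact: PolyMulX.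
  by elim: (k) => [|k' ih] //=; rewrite ih (antideriv_mulX_neq (sJ _ k' sP) ji).
Qed.

Lemma antideriv_polyfun d (P : 'rV[R]_n -> R) : polyfun d P -> exists e, polyfun e (J P).
Proof. by move=> pP; exact: (antideriv_polyfun_iter pP 1). Qed.

(** In [partials s (J h)] the last letters act first, so it is the last occurrence of [i]
    that cancels the antiderivative. *)
Fixpoint rmlast (s : seq 'I_n) : seq 'I_n :=
  if s is j :: s' then (if i \in s' then j :: rmlast s' else if j == i then s' else j :: s') else [::].

Lemma size_rmlast s : i \in s -> size (rmlast s) = (size s).-1.
Proof.
elim: s => [|j s ih] //=; rewrite inE; case: ifP => [is_ _|_].
  by rewrite /= ih //; case: s is_ {ih}.
by rewrite orbF eq_sym => /eqP ->; rewrite eqxx.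
Qed.

Lemma size_rmlast_le s : (size (rmlast s) <= size s)%N.
Proof.
have [is_|/negP nis] := boolP (i \in s); first by rewrite size_rmlast // leq_pred.
elim: s nis => [|j s ih] //=; rewrite inE => h.
case: ifP => [is_|_]; first by case: h; rewrite is_ orbT.
by case: ifP.
Qed.

Lemma partials_antideriv s h : smooth h ->
  partials s (J h) = if i \in s then partials (rmlast s) h else J (partials s h).
Proof.
move=> sh; elim: s => [|j s ih] //=; rewrite ih inE.
case: ifP => [_|is_]; first by rewrite orbT.
have ss := smooth_partials s sh.
rewrite orbF eq_sym; case: (eqVneq j i) => [->|ji]; first exact: (partial_antideriv a i ss).
exact: (partial_antideriv_neq a ss ji).
Qed.
End AntiderivPoly.

(** The Bernstein operator of order [N] at the point [t], for the values [phi 0] to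
    [phi N] at the nodes. The Pascal recursion makes positivity, linearity and the formula for the
    variance inductive, without binomial coefficients. *)
Fixpoint bern (N : nat) (t : R) (phi : nat -> R) : R :=
  if N is N'.+1 then (1 - t) * bern N' t phi + t * bern N' t (fun j => phi j.+1) else phi 0%N.

Lemma bern_lin N t c phi psi :
  bern N t (fun j => c * phi j + psi j) = c * bern N t phi + bern N t psi.
Proof. by elim: N phi psi => [|N ih] phi psi //=; rewrite !ih; ring. Qed.

Lemma bern_le N t phi psi : 0 <= t <= 1 -> (forall j, (j <= N)%N -> phi j <= psi j) ->
  bern N t phi <= bern N t psi.
Proof.
move=> /andP[t0 t1]; elim: N phi psi => [|N ih] phi psi h /=; first exact: h.
apply: lerD; apply: ler_wpM2l => //; rewrite ?subr_ge0 //; apply: ih => j jN; apply: h => //.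
exact: leqW.
Qed.

Lemma bern_cst N t c : bern N t (fun=> c) = c.
Proof. by elim: N => [|N ih] //=; rewrite ih; ring. Qed.

Lemma bern_var N t c :
  bern N t (fun j => (j%:R + c) ^+ 2) = (N%:R * t + c) ^+ 2 + N%:R * (t * (1 - t)).
Proof.
elim: N c => [|N ih] c /=; first by rewrite !mul0r addr0.
rewrite ih; under [X in bern _ _ X]eq_fun do rewrite -natr1 -addrA.
by rewrite ih -natr1; ring.
Qed.

Lemma bern_norm N t phi psi : 0 <= t <= 1 -> (forall j, (j <= N)%N -> `|phi j| <= psi j) ->
  `|bern N t phi| <= bern N t psi.
Proof.
move=> t01 h; rewrite ler_norml; apply/andP; split.
  have -> : - bern N t psi = bern N t (fun j => - psi j).
    have := bern_lin N t (-1) psi (fun=> 0); rewrite bern_cst addr0 mulN1r => <-.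
    by congr bern; apply/funext => j; rewrite mulN1r addr0.
  by apply: bern_le => // j /h; rewrite ler_norml => /andP[].
by apply: bern_le => // j /h; rewrite ler_norml => /andP[].
Qed.

Section Annihilator.
Variables (n : nat) (L : R).
Hypothesis L0 : 0 < L.

Section C0.
Variable U : functional (R := R) n.
Hypothesis Ulin : forall a g h, smooth g -> smooth h -> U (fun x => a * g x + h x) = a * U g + U h.
Hypothesis Upoly : forall d P, polyfun d P -> U P = 0.
Variable C : R.
Hypothesis C0 : 0 <= C.
Hypothesis Ubound : forall h M, smooth h -> (forall x, `|x| <= L -> `|h x| <= M) -> `|U h| <= C * M.

(** The functions [k] such that [U] annihilates [k] times any polynomial. They are a class
    that is stable under multiplication with polynomials and under uniform limits. *)
Definition nullfun (k : 'rV[R]_n -> R) :=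
  smooth k /\ forall d P, polyfun d P -> U (fun x => P x * k x) = 0.

Lemma nullfun_bern N i (k : nat -> 'rV[R]_n -> R) : (forall j, nullfun (k j)) ->
  nullfun (fun x => bern N ((x 0 i + L) / (2 * L)) (fun j => k j x)).
Proof.
have ptau : polyfun 1 (fun x : 'rV[R]_n => (x 0 i + L) / (2 * L)).
  rewrite (_ : (fun x => _) = (fun x : 'rV[R]_n => (2 * L)^-1 * (x 0 i + L))).
    by apply: polyfun_scale; apply: PolyAdd; [exact: polyfun_coord|exact: PolyCst].
  by apply/funext => x; rewrite mulrC.
elim: N k => [|N ih] k hk /=; first exact: hk.
have [s1 n1] := ih _ hk; have [s2 n2] := ih _ (fun j => hk j.+1).
have st := polyfun_smooth ptau.
have p1t : polyfun 1 (fun x : 'rV[R]_n => 1 - (x 0 i + L) / (2 * L)).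
  by apply: polyfun_sub => //; exact: PolyCst.
split.
  exact: (smooth_add (smooth_mul (polyfun_smooth p1t) s1) (smooth_mul st s2)).
move=> d P pP.
have pP1 := polyfun_mul pP p1t; have pP2 := polyfun_mul pP ptau.
have E1 := n1 _ _ pP1; have E2 := n2 _ _ pP2.
have t1 := smooth_mul (polyfun_smooth pP1) s1.
have t2 := smooth_mul (polyfun_smooth pP2) s2.
have := Ulin 1 t1 t2; rewrite E1 E2 mulr0 addr0 => <-.
by congr U; apply/funext => x /=; ring.
Qed.

Lemma nullfun_lim k : smooth k ->
  (forall e : R, 0 < e -> exists2 g, nullfun g & forall x, `|x| <= L -> `|k x - g x| <= e) ->
  nullfun k.
Proof.
move=> sk hk; split => // d P pP.
have sP := polyfun_smooth pP.
have [M M0 hM] := partials_bounded 0 (@compact_cball R n L) sP.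
have {}hM x : `|x| <= L -> `|P x| <= M by move=> xL; exact: (hM [::]).
apply/eqP; rewrite -normr_le0; apply/ler_addgt0Pr => e e0; rewrite add0r.
pose e' := e / (C * M + 1).
have CM : 0 < C * M + 1 by rewrite ltr_wpDl // mulr_ge0.
have [g [sg ng] kg] := hk e' (divr_gt0 e0 CM).
have s1 := smooth_mul sP sg; have s2 := smooth_mul sP (smooth_sub sk sg).
have -> : U (fun x => P x * k x) = U (fun x => P x * (k x - g x)).
  have := Ulin 1 s2 s1; rewrite (ng _ _ pP) addr0 mul1r => <-.
  by congr U; apply/funext => x; ring.
apply: le_trans (Ubound (M := M * e') s2 _) _.
  by move=> x xL; rewrite normrM ler_pM //; [exact: hM|exact: kg].
rewrite mulrA /e' mulrA ler_pdivrMr // mulrC ler_wpM2l //; first exact: ltW.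
by rewrite lerDl.
Qed.

Definition depends_only (l : seq 'I_n) (k : 'rV[R]_n -> R) :=
  forall x i v, i \notin l -> k (upd i x v) = k x.

Lemma smooth_upd i v j : smooth (fun x : 'rV[R]_n => upd i x v 0 j).
Proof.
have [ji|/negbTE ji] := eqVneq j i.
  rewrite (_ : (fun x => _) = (fun _ : 'rV[R]_n => v)); first exact: smooth_cst.
  by apply/funext => x; rewrite mxE ji eqxx.
rewrite (_ : (fun x => _) = (fun x : 'rV[R]_n => x 0 j)); first exact: smooth_coord.
by apply/funext => x; rewrite mxE ji.
Qed.

(** Chebyshev: the mean value theorem bounds the error at a node by [M] times its
    distance [y] from [N t], and [2 |y| <= K + y^2 / K] turns the formula for the variance
    into a bound of order [1 / K] for [N = K^2]. *)
Lemma bern_approx (k : 'rV[R]_n -> R) (i : 'I_n) K (x : 'rV[R]_n) (M : R) :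
  smooth k -> `|x| <= L -> (0 < K)%N ->
  (forall y, `|y| <= 3 * L -> `|partial i k y| <= M) ->
  `|k x - bern (K ^ 2) ((x 0 i + L) / (2 * L)) (fun j => k (upd i x (- L + 2 * L * (j%:R / (K ^ 2)%:R))))|
     <= 2 * L * M / K%:R.
Proof.
move=> sk xL K0 hM; set N := (K ^ 2)%N; set t := (x 0 i + L) / (2 * L).
have N0 : 0 < N%:R :> R by rewrite ltr0n expn_gt0 K0.
have K0' : 0 < K%:R :> R by rewrite ltr0n.
have L2 : 0 < 2 * L by rewrite mulr_gt0.
have M0 : 0 <= M by apply: le_trans (hM x _) => //; lra.
have /andP[xi1 xi2] : - L <= x 0 i <= L by rewrite -ler_norml (le_trans (coord_le_norm _ _)).
have t01 : 0 <= t <= 1.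
  rewrite /t divr_ge0 ?(ltW L2) //=; last lra.
  by rewrite ler_pdivrMr //; lra.
have xt : x 0 i = - L + 2 * L * t by rewrite /t mulrC divfK ?gt_eqF //; ring.
have tN := bern_var N t (- (N%:R * t)).
rewrite subrr expr0n /= add0r in tN.
pose err (j : nat) := 2 * L / N%:R * M * ((K%:R + (j%:R - N%:R * t) ^+ 2 / K%:R) / 2).
have -> : k x - bern N t (fun j => k (upd i x (- L + 2 * L * (j%:R / N%:R)))) =
   bern N t (fun j => k x - k (upd i x (- L + 2 * L * (j%:R / N%:R)))).
  have := bern_lin N t (-1) (fun j => k (upd i x (- L + 2 * L * (j%:R / N%:R)))) (fun=> k x).
  rewrite bern_cst mulN1r addrC => <-; congr bern; apply/funext => j; by rewrite mulN1r addrC.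
apply: (@le_trans _ _ (bern N t err)).
  apply: bern_norm => // j jN.
  set v := - L + _.
  have vE : v - x 0 i = 2 * L / N%:R * (j%:R - N%:R * t).
    rewrite /v xt mulrBr; have N0' := gt_eqF N0; field; by rewrite N0'.
  have vL : `|v| <= L.
    have : 0 <= (j%:R / N%:R : R) <= 1 by rewrite divr_ge0 // ler_pdivrMr // mul1r ler_nat.
    rewrite /v => /andP[j0 j1]; rewrite ler_norml.
    have : 2 * L * (j%:R / N%:R) <= 2 * L by rewrite ler_piMr // ltW.
    have : 0 <= 2 * L * (j%:R / N%:R) by rewrite mulr_ge0 // ltW.
    by move=> h1 h2; apply/andP; split; lra.
  have Eu : upd i x v = x + (v - x 0 i) *: e_ i.
    apply/rowP => l; rewrite !mxE eqxx /=; case: eqP => [->|] /=; first by rewrite mulr1 addrC subrK.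
    by rewrite mulr0 addr0.
  have [|s sv E] := @partial_mvt R n k x i (v - x 0 i); first by move=> *; exact: smooth_derivable.
  rewrite -normrN opprB Eu E normrM.
  have hs : `|x + s *: e_ i| <= 3 * L.
    rewrite (le_trans (ler_normD _ _)) //; have := norm_delta_le i s.
    have := ler_normB v (x 0 i); have : `|x 0 i| <= L by rewrite (le_trans (coord_le_norm _ _)).
    lra.
  set y := j%:R - N%:R * t in vE *.
  have hy : `|y| <= (K%:R + y ^+ 2 / K%:R) / 2.
    have h2 : 0 <= (`|y| - K%:R) ^+ 2 by apply: sqr_ge0.
    rewrite sqrrB real_normK ?num_real // in h2.
    rewrite ler_pdivlMr // -(ler_pM2r K0') mulrDl divfK ?gt_eqF // -expr2.
    move: h2; rewrite -mulr_natr; lra.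
  rewrite vE normrM (ger0_norm (ltW (divr_gt0 L2 N0))) /err -/y.
  have /ltW c0 := divr_gt0 L2 N0; have hp := hM _ hs.
  move: (normr_ge0 (partial i k (x + s *: e_ i))) (normr_ge0 y) => p0 y0.
  have := ler_pM p0 (mulr_ge0 c0 y0) hp (ler_wpM2l c0 hy).
  move=> H; rewrite [leLHS]mulrC; apply: le_trans H _.
  by rewrite le_eqVlt; apply/orP; left; apply/eqP; rewrite mulrA [M * _]mulrC.
have -> : err = (fun j => (2 * L / N%:R * M / (2 * K%:R)) * (j%:R - N%:R * t) ^+ 2 + 2 * L / N%:R * M * (K%:R / 2)).
  by apply/funext => j; rewrite /err; field; rewrite !gt_eqF.
rewrite bern_lin tN bern_cst.
have NK : N%:R = K%:R ^+ 2 :> R by rewrite /N natrX.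
have -> : 2 * L / N%:R * M / (2 * K%:R) * (N%:R * (t * (1 - t))) = L * M / K%:R * (t * (1 - t)).
  by field; rewrite !gt_eqF.
have -> : 2 * L / N%:R * M * (K%:R / 2) = L * M / K%:R.
  by rewrite NK; field; rewrite gt_eqF.
have -> : 2 * L * M / K%:R = L * M / K%:R * 1 + L * M / K%:R by ring.
have ltt : t * (1 - t) <= 1 by case/andP: t01 => t0 t1; nra.
by rewrite lerD2r ler_wpM2l // divr_ge0 ?ler0n // mulr_ge0 // ltW.
Qed.

(** Bernstein approximation in one variable at a time: the nodes are functions that depend
    on one variable less. *)
Lemma nullfun_all k : smooth k -> nullfun k.
Proof.
move=> sk0; suff H l : forall k, smooth k -> depends_only l k -> nullfun k.
  by apply: (H (enum 'I_n)) => // x i v; rewrite mem_enum.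
elim: l {k sk0} => [|i l ih] k sk dk.
  have kc x : k x = k 0.
    have H (s : seq 'I_n) : k (foldr (fun i y => upd i y 0) x s) = k x.
      by elim: s => [|j s ihs] //=; rewrite dk.
    rewrite -(H (enum 'I_n)); congr k; apply/rowP => j; rewrite [RHS]mxE.
    have : j \in enum 'I_n by rewrite mem_enum.
    elim: (enum 'I_n) => [|j' s ihs]; first by rewrite in_nil.
    by rewrite inE /= mxE; case: eqP => //= _ /ihs.
  rewrite (_ : k = (fun=> k 0)); last by apply/funext.
  split; first exact: smooth_cst.
  move=> d P pP; apply: (Upoly (d := d)).
  rewrite (_ : (fun x => _) = (fun x => k 0 * P x)); first exact: polyfun_scale.
  by apply/funext => x; rewrite mulrC.
apply: nullfun_lim => // e e0.
have [M M0 hM] := partials_bounded 1 (@compact_cball R n (3 * L)) sk.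
have {}hM y : `|y| <= 3 * L -> `|partial i k y| <= M by move=> yL; exact: (hM [:: i]).
pose K := (Num.truncn (2 * L * M / e)).+1.
have K0 : (0 < K)%N by [].
exists (fun x : 'rV[R]_n => bern (K ^ 2) ((x 0 i + L) / (2 * L))
   (fun j => k (upd i x (- L + 2 * L * (j%:R / (K ^ 2)%:R))))).
  apply: (nullfun_bern _ _ (k := fun (j : nat) (x : 'rV[R]_n) => k (upd i x (- L + 2 * L * (j%:R / (K ^ 2)%:R))))) => j.
  apply: ih; first by apply: (smooth_comp (io := fun x => upd i x _) _ sk) => j'; exact: smooth_upd.
  move=> x i' w hi'.
  have [->|ii'] := eqVneq i' i.
    by congr k; apply/rowP => j'; rewrite !mxE; case: eqP.
  rewrite -[RHS](dk _ i' w); last by rewrite inE negb_or ii'.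
  congr k; apply/rowP => j'; rewrite !mxE; case: (eqVneq j' i) => [->|//].
  by rewrite eq_sym (negbTE ii').
move=> x xL; apply: le_trans (bern_approx sk xL K0 hM) _.
rewrite ler_pdivrMr ?ltr0n // [e * _]mulrC -ler_pdivrMr //.
rewrite /K; apply: ltW; exact: truncnS_gt.
Qed.

Lemma annihilator_C0 k : smooth k -> U k = 0.
Proof.
move=> /nullfun_all [_ /(_ 0%N _ (PolyCst _ 0 1))].
by under eq_fun do rewrite mul1r.
Qed.
End C0.

(** Induction on the total number of derivatives that control [U]: on functions that
    vanish to the left, [h] is the antiderivative of [partial i h], and [U o J] is
    controlled by fewer derivatives and still annihilates the polynomials. *)
Lemma annihilator_words N (S : seq (seq 'I_n)) (U : functional (R := R) n) (C : R) :
  (sumn (map size S) <= N)%N ->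
  (forall a g h, smooth g -> smooth h -> U (fun x => a * g x + h x) = a * U g + U h) ->
  (forall d P, polyfun d P -> U P = 0) -> 0 <= C ->
  (forall h M, smooth h ->
     (forall s, s \in S -> forall x : 'rV[R]_n, `|x| <= L -> `|partials s h x| <= M) -> 0 <= M -> `|U h| <= C * M) ->
  forall h L', L' < L -> smooth h -> (forall x : 'rV[R]_n, (exists i, x 0 i < - L') -> h x = 0) -> U h = 0.
Proof.
elim: N S U C => [|N ih] S U C SN Ulin Upoly C0 Ub h L' L'L sh hv.
  apply: (@annihilator_C0 U Ulin Upoly C C0 _ h sh) => g M sg gM.
  apply: Ub => // [s sS x xL|]; last by apply: le_trans (gM 0 _); rewrite ?normr0 ?(ltW L0).
  suff -> : s = [::] by exact: gM.
  move: SN; rewrite leqn0 => /eqP; elim: S sS => [|s' S ihS] //=.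
  by rewrite inE => /orP[/eqP <-|sS] /eqP; rewrite addn_eq0 => /andP[/eqP/size0nil ? /eqP ?] //; exact: ihS.
have [/allP Snil|/allPn [s sS snil]] := boolP (all (fun s : seq 'I_n => s == [::]) S).
  apply: (ih S U C _ Ulin Upoly C0 Ub h L') => //.
  suff -> : sumn (map size S) = 0%N by [].
  elim: S Snil {SN Ub} => [|s S ihS] Snil //=; rewrite (eqP (Snil s _)) ?mem_head // ihS // => s' s'S.
  by apply: Snil; rewrite inE s'S orbT.
have [i iS] : exists i, i \in s.
  by case: s snil {sS} => [|i s] // _; exists i; exact: mem_head.
pose a := - L; pose J := @antideriv R n a i.
have sJ g : smooth g -> smooth (J g) by exact: smooth_antideriv.
have Eh : U h = U (J (partial i h)).
  congr U; apply/funext => x; rewrite /J antideriv_partial // [h (upd _ _ _)]hv ?subr0 //.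
  by exists i; rewrite mxE eqxx /a ltrN2.
rewrite Eh; pose S' := map (rmlast i) S.
apply: (ih S' (fun k => U (J k)) (C * (1 + (L + L))) _ _ _ _ _ (partial i h) L') => //.
- rewrite -ltnS; apply: leq_trans SN; rewrite /S'.
  elim: S sS {Ub S'} => [|s' S ihS] //=; rewrite inE => /orP[/eqP <-|sS].
    rewrite -addSn leq_add //; first by rewrite size_rmlast // prednK //; case: (s) iS.
    elim: (S) => [|s'' S'' ih''] //=; by rewrite leq_add // size_rmlast_le.
  by rewrite -addnS leq_add ?size_rmlast_le ?ihS.
- by move=> c f g sf sg; rewrite /J (antideriv_lin a i c sf sg) (Ulin _ _ _ (sJ _ sf) (sJ _ sg)).
- by move=> d P /(antideriv_polyfun a i) [e pe]; exact: Upoly pe.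
- by rewrite mulr_ge0 // !addr_ge0 // ltW.
- move=> k M sk hM M0; rewrite -mulrA; apply: Ub; first exact: sJ.
    move=> w wS x xL; rewrite /J partials_antideriv //.
    have LM : 0 <= (L + L) * M by rewrite mulr_ge0 // addr_ge0 // ltW.
    have hw : forall y, `|y| <= L -> `|partials (rmlast i w) k y| <= M.
      by apply: hM; apply: map_f.
    case: ifP => iw; first by rewrite mulrDl mul1r (le_trans (hw x xL)) // lerDl.
    have Ew : rmlast i w = w.
      elim: w iw {wS hw} => [|j w ihw] //=; rewrite inE => /norP [ij iw].
      by rewrite (negbTE iw) eq_sym (negbTE ij).
    have aL : `|a| <= L by rewrite /a normrN gtr0_norm.
    rewrite Ew in hw.
    have := @antideriv_cball_bound _ _ _ i _ L M _ (smooth_partials w sk) aL hw xL.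
    by move=> /le_trans; apply; rewrite [leRHS]mulrDl mul1r lerDr.
  by rewrite mulr_ge0 // !addr_ge0 // ltW.
- exact: smooth_partial.
- move=> x xv; have oV : open [set x : 'rV[R]_n | exists i, x 0 i < - L'].
    rewrite openE => y [j yj]; apply/nbhs_closed_ball.
    exists ((- L' - y 0 j) / 2); first by rewrite divr_gt0 // subr_gt0.
    move=> z zy; exists j; have := le_trans (coord_le_norm (z - y) j) zy; rewrite !mxE ler_norml => /andP[_ h2].
    lra.
  by rewrite (partial_eq_on oV (g := fun=> 0)) ?partial_cst.
Qed.
End Annihilator.

Fixpoint words (n m : nat) : seq (seq 'I_n) :=
  if m is m'.+1 then words n m' ++ [seq i :: s | i <- enum 'I_n, s <- words n m'] else [:: [::]].

Lemma words_mem n m (s : seq 'I_n) : (size s <= m)%N -> s \in words n m.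
Proof.
elim: m s => [|m ih] s /=; first by case: s.
case: s => [|i s] h; rewrite mem_cat; first by rewrite ih.
by apply/orP; right; apply: allpairs_f; rewrite ?mem_enum // ih.
Qed.

Lemma open_norm_lt n (r : R) : open [set x : 'rV[R]_n | `|x| < r].
Proof.
rewrite openE => y yN; apply/nbhs_closed_ball; exists ((r - `|y|) / 2).
  by rewrite divr_gt0 // subr_gt0.
move=> z zy; rewrite /= -(subrK y z) (le_lt_trans (ler_normD _ _)) //.
rewrite /= in yN; lra.
Qed.

(** After a cutoff outside the support, antiderivatives that start to the left invert
    derivatives; this reduces the order of the distribution to zero, where the
    approximation theorem of Weierstrass suffices. *)
Theorem cd_polyfun_eq0 n (u : functional (R := R) n) : compact_distribution u ->
  (forall d P, polyfun d P -> u P = 0) -> forall h, smooth h -> u h = 0.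
Proof.
move=> cu up h sh.
have [N [m [C [N0 C0 hu]]]] := cd_bound cu.
(* [chi] is 1 on a neighbourhood of the ball of radius [N], and is supported in the
   ball of squared Euclidean radius [r2]. *)
pose r1 : R := n.+1%:R * (N + 1) ^+ 2; pose r2 : R := r1 + 1; pose L := r2 + N + 2.
have N1 : 0 < N + 1 by rewrite ltr_wpDl.
have r10 : 0 < r1 by rewrite mulr_gt0 // exprn_gt0.
have r12 : r1 < r2 by rewrite ltrDl.
have L0 : 0 < L by rewrite /L /r2; lra.
pose chi (x : 'rV[R]_n) := plateau r1 r2 (dot x x).
have schi : smooth chi := smooth_plateau r12 (@smooth_sqn R n).
have sch := smooth_mul schi sh.
have -> : u h = u (fun x => chi x * h x).
  apply/eqP; rewrite -subr_eq0 -(cd_sub cu) // -normr_le0.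
  have sd := smooth_sub sh sch.
  apply: le_trans (hu _ sd) _; rewrite -(mulr0 C) ler_wpM2l //.
  apply: seminorm_le => // s x sm xN.
  rewrite (@partials_eq_on _ _ _ _ (fun=> 0) _ _ (@open_norm_lt n (N + 1))).
  - rewrite (_ : partials s (fun=> 0) = (fun=> 0)) ?normr0 //.
    elim: s {sm} => [|i s ih] //=; rewrite ih; apply/funext => y; exact: partial_cst.
  - move=> y /= yN; rewrite /chi plateau1 ?mul1r ?subrr //.
    apply: le_trans (dot_le_norm y) _; rewrite /r1; apply: ler_pM => //.
      by rewrite ler_nat.
    by rewrite ler_pXn2r ?nnegrE ?(ltW N1) ?(ltW yN).
  - by rewrite /= (le_lt_trans xN) // ltrDl.
apply: (@annihilator_words n L L0 _ (words n m) u C (leqnn _) (cd_lin cu) up C0 _ _ (r2 + 1) _ sch).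
- move=> g M sg gM M0; apply: le_trans (hu _ sg) _; rewrite ler_wpM2l //.
  apply: seminorm_le => // s x sm xN; apply: gM; first exact: words_mem.
  by apply: le_trans xN _; rewrite /L /r2; lra.
- rewrite /L; lra.
- move=> x [i xi]; rewrite /chi plateau0 ?mul0r //.
  apply: le_trans (sqr_coord_le_dot x i).
  have h1 : r2 + 1 <= - x 0 i by lra.
  have : (r2 + 1) ^+ 2 <= (- x 0 i) ^+ 2.
    by rewrite ler_pXn2r ?nnegrE //; rewrite /r2 in h1 *; lra.
  rewrite sqrrN; apply: le_trans; rewrite /r2; nra.
Qed.
End Weierstrass.

(** * Rigidity of the Riesz kernel *)

Section Regsqn.
Context {R : realType}.
Local Notation e_ i := (delta_mx 0 i).
Variable n : nat.

(** Agrees with the squared norm where the latter is at least [d], and is positive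
    everywhere, so that its powers are smooth functions on the whole space. *)
Definition regsqn (d : R) (x : 'rV[R]_n) : R := dot x x + plateau (d / 2) d (dot x x).

Variable d : R.
Hypothesis d0 : 0 < d.

Let dh : d / 2 < d. Proof. by rewrite ltr_pdivrMr // ltr_pMr // ltrDl. Qed.

Lemma smooth_regsqn : smooth (regsqn d).
Proof. by apply: smooth_add; [|apply: smooth_plateau => //]; exact: smooth_sqn. Qed.

Lemma regsqnE x : d <= dot x x -> regsqn d x = dot x x.
Proof. by move=> dx; rewrite /regsqn plateau0 // addr0. Qed.

Lemma plateau_ge0 (a b t : R) : 0 <= plateau a b t.
Proof. by rewrite /plateau divr_ge0 // ?addr_ge0 // flat_ge0. Qed.

Lemma regsqn_gt0 x : 0 < regsqn d x.
Proof.
rewrite /regsqn; have [xd|xd] := leP (dot x x) (d / 2).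
  by rewrite plateau1 // ltr_wpDl // dot_ge0.
by rewrite ltr_wpDr ?plateau_ge0 // (lt_trans _ xd) // divr_gt0.
Qed.

Lemma smooth_isq_regsqn k : smooth (fun x => isq (regsqn d x) ^+ k).
Proof.
by apply: smooth_on_isqX; [exact: openT|exact: smooth_regsqn|move=> x _; exact: regsqn_gt0].
Qed.

Lemma open_dot_gt (c : R) : open [set x : 'rV[R]_n | c < dot x x].
Proof.
rewrite (_ : [set x | _] = (fun x : 'rV[R]_n => dot x x) @^-1` [set t | c < t]) //.
apply: open_comp; last exact: open_gt.
by move=> x _; exact: smooth_continuous (@smooth_sqn R n).
Qed.

Lemma open_dot_lt (c : R) : open [set x : 'rV[R]_n | dot x x < c].
Proof.
rewrite (_ : [set x | _] = (fun x : 'rV[R]_n => dot x x) @^-1` [set t | t < c]) //.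
apply: open_comp; last exact: open_lt.
by move=> x _; exact: smooth_continuous (@smooth_sqn R n).
Qed.

Lemma partial_regsqn i x : d < dot x x -> partial i (regsqn d) x = 2 * x 0 i.
Proof.
move=> dx; rewrite -partial_sqn; apply: (partial_eq_on (open_dot_gt (c := d))) => // y /= dy.
by rewrite regsqnE // ltW.
Qed.

Lemma partial_isq_regsqn k i x : d < dot x x ->
  partial i (fun x => isq (regsqn d x) ^+ k) x = - k%:R * isq (regsqn d x) ^+ (k + 2) * x 0 i.
Proof.
move=> dx; have q0 y : setT y -> 0 < regsqn d y by move=> _; exact: regsqn_gt0.
have := @partial_isqX R n setT (regsqn d) smooth_regsqn q0 k i x I.
by rewrite partial_regsqn // => ->; field.
Qed.

Lemma isq_regsqn_sqr x : d <= dot x x -> isq (regsqn d x) ^+ 2 * dot x x = 1.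
Proof.
move=> dx; rewrite isq_sqr ?(ltW (regsqn_gt0 _)) // regsqnE // mulVf // gt_eqF //.
exact: lt_le_trans dx.
Qed.
End Regsqn.

Section Rigidity.
Context {R : realType}.
Local Notation e_ i := (delta_mx 0 i).

Lemma partials_lin n (s : seq 'I_n) a (f g : 'rV[R]_n -> R) : smooth f -> smooth g ->
  partials s (fun x => a * f x + g x) = (fun x => a * partials s f x + partials s g x).
Proof.
move=> sf sg; elim: s => [|i s ih] //=; rewrite ih; apply/funext => x.
have sF := smooth_scale a (smooth_partials s sf); have sG := smooth_partials s sg.
apply: (etrans (partialD (U := setT) i sF sG I)).
by rewrite (partialZ (U := setT) a i (smooth_partials s sf) I).
Qed.

Variables (n : nat) (u : functional (R := R) n) (d e : R).
Hypotheses (n2 : (2 <= n)%N) (cu : compact_distribution u) (d0 : 0 < d) (de : d < e).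
Hypothesis uloc : forall h, smooth h -> (forall x, e <= dot x x -> h x = 0) -> u h = 0.

Let w (x : 'rV[R]_n) := isq (regsqn d x).
Hypothesis ukappa : forall s, u (partials s (fun x => w x ^+ n.-1)) = 0.

Let O := [set x : 'rV[R]_n | d < dot x x].
Let oO : open O := @open_dot_gt R n d.

Let sw k : smooth (fun x => w x ^+ k). Proof. exact: smooth_isq_regsqn. Qed.

Let kills (k : 'rV[R]_n -> R) := smooth k /\ forall s, u (partials s k) = 0.

Let kills_eq k k' : smooth k' -> (forall x, O x -> k x = k' x) -> kills k -> kills k'.
Proof.
move=> sk' kk' [sk uk]; split => // s.
have h1 := smooth_partials s sk; have h2 := smooth_partials s sk'.
apply/eqP; rewrite -[u _](subr0) -{1}(uk s) -cd_sub //; apply/eqP.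
apply: uloc => [|x ex]; first exact: smooth_sub.
by rewrite (partials_eq_on s oO kk') ?subrr //; exact: lt_le_trans ex.
Qed.

Let kills_lin a k k' : kills k -> kills k' -> kills (fun x => a * k x + k' x).
Proof.
move=> [sk uk] [sk' uk']; split; first exact: (smooth_add (smooth_scale a sk) sk').
move=> s; rewrite (partials_lin s a sk sk') (cd_lin cu a (smooth_partials s sk) (smooth_partials s sk')).
by rewrite uk uk' mulr0 addr0.
Qed.

Let kills0 : kills (fun=> 0).
Proof.
split=> [|s]; first exact: smooth_cst.
apply: uloc => [|x _]; first by apply: smooth_partials; exact: smooth_cst.
by elim: s x => [|i s ih] x //=; rewrite (_ : partials s _ = fun=> 0) ?partial_cst //; exact/funext.
Qed.

Let kills_add k k' : kills k -> kills k' -> kills (fun x => k x + k' x).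
Proof.
move=> K K'; have := kills_lin 1 K K'; congr kills; apply/funext => x; by rewrite mul1r.
Qed.

Let kills_scale a k : kills k -> kills (fun x => a * k x).
Proof.
move=> K; have := kills_lin a K kills0; congr kills; apply/funext => x; by rewrite addr0.
Qed.

Let kills_sum m (F : 'I_m -> 'rV[R]_n -> R) : (forall i, kills (F i)) -> kills (fun x => \sum_i F i x).
Proof.
elim: m F => [|m ih] F KF.
  by rewrite (_ : (fun x => _) = (fun=> 0)) //; apply/funext => x; rewrite big_ord0.
rewrite (_ : (fun x => _) = (fun x => F ord0 x + \sum_i F (lift ord0 i) x)).
  by apply: kills_add => //; exact: ih.
by apply/funext => x; rewrite big_ord_recl.
Qed.

Let kills_partial i k : kills k -> kills (partial i k).
Proof.
by move=> [sk uk]; split=> [|s]; [exact: smooth_partial|rewrite -partials_rcons].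
Qed.

(** The Laplacian of [|x|^-p] is [p (p + 2 - n) |x|^(-p-2)]. *)
Let kills_power j : kills (fun x => w x ^+ (n.-1 + j.*2)).
Proof.
elim: j => [|j ih]; first by rewrite double0 addn0; split.
set p := (n.-1 + j.*2)%N in ih *.
have -> : (n.-1 + j.+1.*2 = p + 2)%N by rewrite /p doubleS addn2 !addnS.
pose c : R := p%:R * (p%:R + 2 - n%:R).
have c0 : c != 0.
  rewrite /c -natrD -natrB; last by rewrite /p; lia.
  by rewrite -natrM pnatr_eq0; rewrite /p; lia.
clearbody p.
have K := kills_scale c^-1 (kills_sum (fun i => kills_partial i (kills_partial i ih))).
apply: kills_eq K; first exact: sw.
move=> x Ox /=.
have Ei i : partial i (partial i (fun x => w x ^+ p)) x =
    p%:R * (p%:R + 2) * w x ^+ (p + 4) * x 0 i ^+ 2 - p%:R * w x ^+ (p + 2).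
  rewrite (@partial_eq_on R n O (partial i (fun x => w x ^+ p))
    (fun x => - p%:R * (w x ^+ (p + 2) * x 0 i)) oO) //; last first.
    by move=> y Oy; rewrite partial_isq_regsqn // mulrA.
  rewrite (partialZ (U := setT)) //; last by apply: smooth_mul; [exact: sw|exact: smooth_coord].
  rewrite (partialM (U := setT)) //; [|exact: sw|exact: smooth_coord].
  rewrite partial_coord eqxx mulr1n partial_isq_regsqn // natrD -/(w x) !exprD; ring.
under eq_bigr do rewrite Ei.
rewrite sumrB -mulr_sumr sumr_const card_ord -[X in _ - X]mulr_natr.
have -> : \sum_i x 0 i ^+ 2 = dot x x by apply: eq_bigr => i _; rewrite expr2.
have := isq_regsqn_sqr d0 (ltW Ox); rewrite -/(w x) => H.
rewrite (_ : (p + 4 = (p + 2) + 2)%N) ; last by rewrite -addnA.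
rewrite !exprD.
have -> : p%:R * (p%:R + 2) * (w x ^+ p * w x ^+ 2 * w x ^+ 2) * dot x x =
   p%:R * (p%:R + 2) * (w x ^+ p * w x ^+ 2) * (w x ^+ 2 * dot x x) by ring.
by rewrite H; apply: (canLR (mulKf c0)); rewrite /c; ring.
Qed.

Let polyfun_partial m i (P : 'rV[R]_n -> R) : polyfun m P -> polyfun m (partial i P).
Proof.
elim=> {m P} [m c|m P Q pP iP pQ iQ|m k P pP iP].
- rewrite (_ : partial i _ = (fun=> 0)); first exact: PolyCst.
  by apply/funext => x; exact: partial_cst.
- rewrite (_ : partial i _ = (fun x => partial i P x + partial i Q x)); first exact: PolyAdd.
  by apply/funext => x; rewrite (partialD (U := setT)) //; [exact: polyfun_smooth pP|exact: polyfun_smooth pQ].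
- rewrite (_ : partial i _ = (fun x : 'rV[R]_n => (k == i)%:R * P x + x 0 k * partial i P x)).
    by apply: PolyAdd; [apply: (polyfun_le (leqnSn m)); exact: polyfun_scale|exact: PolyMulX].
  apply/funext => x; rewrite (partialM (U := setT)) ?partial_coord //.
    exact: smooth_coord.
  exact: polyfun_smooth pP.
Qed.

Let kills_polyfun m (P : 'rV[R]_n -> R) j : polyfun m P -> (m <= j)%N ->
  kills (fun x => P x * w x ^+ (n.-1 + j.*2)).
Proof.
move=> pP; move: {2}m (leqnn m) => N; elim: N m P pP j => [|N ih] m P pP j.
all: elim: pP j => {m P} [m c|m P Q pP iP pQ iQ|m i P pP _] j mN mj.
- exact: (kills_scale c (kills_power j)).
- rewrite (_ : (fun x => _) = (fun x => P x * w x ^+ (n.-1 + j.*2) + Q x * w x ^+ (n.-1 + j.*2))).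
    exact: (kills_add (iP j mN mj) (iQ j mN mj)).
  by apply/funext => x; rewrite mulrDl.
- by [].
- exact: (kills_scale c (kills_power j)).
- rewrite (_ : (fun x => _) = (fun x => P x * w x ^+ (n.-1 + j.*2) + Q x * w x ^+ (n.-1 + j.*2))).
    exact: (kills_add (iP j mN mj) (iQ j mN mj)).
  by apply/funext => x; rewrite mulrDl.
case: j mj => [//|j] mj; set p := (n.-1 + j.*2)%N.
have -> : (n.-1 + j.+1.*2 = p + 2)%N by rewrite /p doubleS addn2 !addnS.
have p0 : p%:R != 0 :> R by rewrite pnatr_eq0 /p; lia.
have K1 := ih _ _ pP _ mN mj.
have K2 := ih _ _ (polyfun_partial i pP) _ mN mj.
have := kills_scale p%:R^-1 (kills_lin (-1) (kills_partial i K1) K2).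
apply: kills_eq.
  by apply: smooth_mul (sw _); apply: smooth_mul; [exact: smooth_coord|exact: polyfun_smooth pP].
move=> x Ox /=; rewrite (partialM (U := setT)) //; [|exact: polyfun_smooth pP|exact: sw].
rewrite partial_isq_regsqn // -/(w x) -/p !exprD; apply: (canLR (mulKf p0)); ring.
Qed.

Let kills_inverted m (P : 'rV[R]_n -> R) : polyfun m P -> forall l Q, polyfun l Q ->
  kills (fun x => Q x * w x ^+ (n.-1 + l.*2) * P (w x ^+ 2 *: x)).
Proof.
elim=> {m P} [m c|m P P' pP iP pP' iP'|m i P pP iP] l Q pQ.
- rewrite (_ : (fun x => _) = (fun x => c * (Q x * w x ^+ (n.-1 + l.*2)))).
    by apply: kills_scale; exact: kills_polyfun pQ _.
  by apply/funext => x; rewrite mulrC.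
- rewrite (_ : (fun x => _) = (fun x => Q x * w x ^+ (n.-1 + l.*2) * P (w x ^+ 2 *: x)
    + Q x * w x ^+ (n.-1 + l.*2) * P' (w x ^+ 2 *: x))).
    by apply: kills_add; [exact: iP|exact: iP'].
  by apply/funext => x; rewrite mulrDr.
- have := iP _ _ (PolyMulX i pQ); congr kills; apply/funext => x.
  have -> : (n.-1 + l.+1.*2 = n.-1 + l.*2 + 2)%N by rewrite doubleS addn2 !addnS.
  by rewrite exprD mxE; ring.
Qed.

(** The functional that maps [k] to the value of [u] on [|x|^(1-n) k (x / |x|^2)] is a
    compactly supported distribution that annihilates the polynomials, and so it is
    zero. As inversion is an involution, any [h] is
    [|x|^(1-n) k (x / |x|^2)] for a suitable [k], except near the origin, where [u]
    vanishes, and except far away, out of the support of [u]. *)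
Theorem riesz_kernel_rigidity h : smooth h -> u h = 0.
Proof.
move=> sh.
have sinv i : smooth (fun x : 'rV[R]_n => (w x ^+ 2 *: x) 0 i).
  rewrite (_ : (fun x => _) = (fun x : 'rV[R]_n => w x ^+ 2 * x 0 i)).
    by apply: smooth_mul; [exact: sw|exact: smooth_coord].
  by apply/funext => x; rewrite mxE.
have tU := tame_pullback sinv (sw n.-1).
have U0 := cd_polyfun_eq0 (compact_distribution_tame cu tU).
have {}U0 : forall k, smooth k -> u (fun x => w x ^+ n.-1 * k (w x ^+ 2 *: x)) = 0.
  apply: U0 => m P pP.
  have [_ /(_ [::])] := kills_inverted pP (PolyCst n 0 1); rewrite /= double0 addn0 => <-.
  by congr u; apply/funext => x; rewrite mul1r.
have [L L0 hL] := cd_local cu.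
(* Inversion maps the part of the support of [u] off the origin to [b <= dot y y]. *)
pose b : R := (n%:R * L ^+ 2 + 1)^-1.
have b0 : 0 < b by rewrite invr_gt0 ltr_wpDl // mulr_ge0 // sqr_ge0.
pose v (y : 'rV[R]_n) := isq (regsqn b y).
have sv k : smooth (fun x => v x ^+ k) by exact: smooth_isq_regsqn.
pose H (y : 'rV[R]_n) := v y ^+ n.-1 * h (v y ^+ 2 *: y).
have sH : smooth H.
  apply: (smooth_mul (sv _)); apply: (smooth_comp (io := fun x => v x ^+ 2 *: x) _ sh) => j.
  rewrite (_ : (fun x => _) = (fun x : 'rV[R]_n => v x ^+ 2 * x 0 j)).
    by apply: smooth_mul; [exact: sv|exact: smooth_coord].
  by apply/funext => x; rewrite mxE.
pose D x := w x ^+ n.-1 * H (w x ^+ 2 *: x) - h x.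
have sHw : smooth (fun x => w x ^+ n.-1 * H (w x ^+ 2 *: x)).
  exact: (smooth_mul (sw _) (smooth_comp sinv sH)).
have sD : smooth D := smooth_sub sHw sh.
have D0 x : d <= dot x x -> `|x| < L -> D x = 0.
  move=> dx xL; have hw := isq_regsqn_sqr d0 dx; rewrite -/(w x) in hw.
  have x0 : 0 < dot x x by exact: lt_le_trans dx.
  have w0 : 0 < w x by apply: isq_gt0; exact: regsqn_gt0.
  have wE : w x ^+ 2 = (dot x x)^-1 by apply: (mulIf (lt0r_neq0 x0)); rewrite hw mulVf // gt_eqF.
  have xxL : dot x x <= b^-1.
    rewrite /b invrK (le_trans (dot_le_norm x)) // ler_wpDr // ler_wpM2l //.
    by rewrite ler_pXn2r ?nnegrE ?(ltW L0) ?(ltW xL).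
  have yy : dot (w x ^+ 2 *: x) (w x ^+ 2 *: x) = w x ^+ 2.
    by rewrite dotZl dotZr hw mulr1.
  have by' : b <= dot (w x ^+ 2 *: x) (w x ^+ 2 *: x).
    rewrite yy wE -(invrK b) lef_pV2; first exact: xxL.
      by rewrite posrE invr_gt0.
    by rewrite posrE.
  have hv := isq_regsqn_sqr b0 by'; rewrite -/(v _) yy in hv.
  have v0 : 0 < v (w x ^+ 2 *: x) by apply: isq_gt0; exact: regsqn_gt0.
  have vw : v (w x ^+ 2 *: x) * w x = 1.
    apply/eqP; rewrite -(@pexpr_eq1 _ _ 2) //; last by rewrite mulr_ge0 ?ltW.
    by rewrite exprMn hv.
  rewrite /D /H scalerA hv scale1r mulrA -exprMn [w x * _]mulrC vw expr1n mul1r subrr //.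
have -> : u h = - u D by rewrite /D cd_sub // U0 // sub0r opprK.
pose chi (x : 'rV[R]_n) := plateau d e (dot x x).
have schi : smooth chi := smooth_plateau de (@smooth_sqn R n).
have scD := smooth_mul schi sD.
rewrite (hL D (fun x => chi x * D x) sD scD).
  by rewrite uloc ?oppr0 // => x ex; rewrite /chi plateau0 // mul0r.
move=> x xL; have [dx|dx] := leP d (dot x x); first by rewrite D0 // mulr0.
by rewrite /chi plateau1 ?mul1r // ltW.
Qed.
End Rigidity.

(** * Polar coordinates *)

Section Polar.
Context {R : realType}.
Local Notation mR := (measurableTypeR R).
Local Notation tupR n := (n.-tuple mR).
Local Notation lam := (@lebesgue_measure R).
Local Notation e_ i := (delta_mx 0 i).

Lemma is_derive_invX k (t : R) : t != 0 ->
  is_derive t 1 (fun t : R => t ^- k.+1) (- (k.+1%:R * t ^- k.+2)).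
Proof.
move=> t0; have D := @is_deriveX _ _ _ k.+1 _ _ _ (is_derive_inv t0).
rewrite (_ : (fun t : R => t ^- k.+1) = (fun t : R => t^-1) ^+ k.+1); last first.
  by apply/funext => s; rewrite fctE exprVn.
suff <- : (k.+1%:R * t^-1 ^+ k) *: (- t ^- 2) = - (k.+1%:R * t ^- k.+2) by exact: D.
rewrite /GRing.scale /= mulrN -mulrA; congr (- (_ * _)).
by rewrite exprVn -invfM -exprD addnC.
Qed.

Lemma power_half_integral k (a : R) : 0 < a ->
  (\int[lam]_(t in `[a, +oo[) (t ^- k.+2)%:E = (a ^- k.+1 / k.+1%:R)%:E)%E.
Proof.
move=> a0.
have tn0 (t : R) : a <= t -> t != 0 by move=> h; rewrite gt_eqF // (lt_le_trans a0).
pose F (t : R) : R := - (k.+1%:R^-1) * t ^- k.+1.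
have dF (t : R) : a <= t -> is_derive t 1 F (t ^- k.+2).
  move=> at'; have := is_derive_scale (- (k.+1%:R^-1)) (is_derive_invX k (tn0 _ at')).
  by rewrite mulrNN mulKf // pnatr_eq0.
have cF (t : R) : a <= t -> {for t, continuous F}.
  move=> at'; have [d _] := dF t at'; apply: differentiable_continuous; exact/derivable1_diffP.
have cf (t : R) : a <= t -> {for t, continuous (fun t : R => t ^- k.+2)}.
  move=> at'; have [d _] := is_derive_invX k.+1 (tn0 _ at').
  by apply: differentiable_continuous; exact/derivable1_diffP.
rewrite (@ge0_continuous_FTC2y R (fun t => t ^- k.+2) F a 0).
- rewrite /F sub0e -EFinN mulNr opprK mulrC //.
- by move=> t at'; rewrite invr_ge0 exprn_ge0 // (le_trans (ltW a0)).
- apply: continuous_in_subspaceT => t; rewrite inE /= in_itv /= andbT; exact: cf.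
- rewrite /F -[X in _ --> X](mulr0 (- (k.+1%:R^-1))); apply: cvgMl_tmp.
  apply/cvgrPdist_le => e e0; near=> t.
  have t1 : 1 <= t by near: t; apply: nbhs_pinfty_ge; rewrite num_real.
  have te : e^-1 <= t by near: t; apply: nbhs_pinfty_ge; rewrite num_real.
  have t0 : 0 < t by exact: lt_le_trans t1.
  rewrite sub0r normrN ger0_norm ?invr_ge0 ?exprn_ge0 ?(ltW t0) //.
  rewrite -[e]invrK lef_pV2 ?posrE ?exprn_gt0 ?invr_gt0 //.
  by rewrite (le_trans te) // ler_eXnr.
- by move=> t at'; have [] := dF t (ltW at').
- by apply: cvg_at_right_filter; exact: cF.
- by move=> t; rewrite in_itv /= andbT => at'; rewrite derive1E; have [_ ->] := dF t (ltW at').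
Unshelve. all: by end_near. Qed.

Lemma measurable_invr : measurable_fun setT (fun u : mR => (u^-1 : mR)).
Proof.
have H : mrV (fun x : 'rV[R]_1 => (x 0 0)^-1).
  have E (x : 'rV[R]_1) : (0 < dot x x) = (x 0 0 != 0).
    by rewrite /dot big_ord_recl big_ord0 addr0 -expr2 exprn_even_gt0.
  apply: (@mrV_within _ _ [set x : 'rV[R]_1 | 0 < dot x x] (fun x => (x 0 0)^-1)) => //.
  - exact: mset_open (@open_dot_gt R 1 0).
  - move=> x x0; have si : smooth_on [set x : 'rV[R]_1 | 0 < dot x x] (fun x => (x 0 0)^-1).
      apply: smooth_on_inv; [exact: open_dot_gt|apply: smooth_smooth_on; exact: smooth_coord|].
      by move=> y /=; rewrite E.
    move=> e e0; have /continuous_for_closed_ball/(_ e e0) [d d0 h] := smooth_on_continuous si x0.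
    by exists d => // y _; exact: h.
  - by move=> x /= /negP; rewrite E negbK => /eqP ->; rewrite invr0.
have := @measurable_comp_rV R _ mR 1 (fun u => (u : R)%:M) _ mR _ _ H.
under eq_fun do rewrite mxE mulr1n; apply=> i.
by rewrite (_ : (fun w => _) = id) //; apply/funext => u; rewrite mxE (ord1 i) mulr1n.
Qed.

(** The total mass that a point at distance [a] receives from the dilated balls in
    [polar_ge0]. *)
Lemma tail_integral n (a : R) : (0 < n)%N -> 0 < a ->
  (\int[lam]_u (if a <= `|u| then `|u| ^- n.+1 else 0)%:E = (2 * a ^- n / n%:R)%:E)%E.
Proof.
case: n => // n _ a0.
pose h (u : R) : R := if a <= u then u ^- n.+2 else 0.
have mh : measurable_fun setT (fun u : mR => (h u)%:E).
  apply/measurable_EFinP; apply: measurable_fun_ifT.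
  - by apply: measurable_fun_ler => //; exact: measurable_cst.
  - under eq_fun do rewrite -exprVn.
    apply: measurable_funX; exact: measurable_invr.
  - exact: measurable_cst.
have h0 u : (0 <= (h u)%:E)%E.
  rewrite lee_fin /h; case: ifP => // au; rewrite invr_ge0 exprn_ge0 //.
  exact: le_trans (ltW a0) au.
have Ih : (\int[lam]_u (h u)%:E = (a ^- n.+1 / n.+1%:R)%:E)%E.
  rewrite -power_half_integral // [RHS]integral_mkcond; apply: eq_integral => u _.
  rewrite /h patchE; case: ifP => au.
    by rewrite mem_set //= in_itv /= au.
  by rewrite memNset //= in_itv /= au.
have Ih' : (\int[lam]_u (h (- u))%:E = (a ^- n.+1 / n.+1%:R)%:E)%E.
  have N1 : (-1 : R) != 0 by rewrite oppr_eq0 oner_eq0.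
  have := lebesgue_affine1 0 N1 mh h0; rewrite normrN normr1 invr1 mul1e Ih => <-.
  by apply: eq_integral => u _; rewrite add0r mulN1r.
have -> : (2 * a ^- n.+1 / n.+1%:R)%:E = ((a ^- n.+1 / n.+1%:R)%:E + (a ^- n.+1 / n.+1%:R)%:E)%E.
  by rewrite -EFinD -mulrA -mulr2n mulr_natl.
have mh' : measurable_fun setT (fun u : mR => (h (- u))%:E).
  by apply: (measurableT_comp mh); exact: oppr_measurable.
have := @ge0_integralD _ mR R lam setT measurableT _ _ (fun u _ => h0 u) mh (fun u _ => h0 (- u)) mh'.
rewrite Ih Ih' => <-; apply: eq_integral => u _; rewrite -EFinD /h; congr EFin.
have [u0|u0] := leP 0 u.
  have -> : (a <= - u) = false by apply/negbTE; rewrite -ltNge (le_lt_trans _ a0) // oppr_le0.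
  by rewrite addr0 ger0_norm.
have -> : (a <= u) = false by apply/negbTE; rewrite -ltNge (lt_trans u0).
by rewrite add0r ltr0_norm.
Qed.

(** The Jacobian [|y|] of [s = u |y|], cut off to the unit ball. *)
Definition polar_weight n (y : 'rV[R]_n) : R := if 0 < dot y y <= 1 then Num.sqrt (dot y y) else 0.

Lemma mrV_sqrt n : mrV (fun y : 'rV[R]_n => Num.sqrt (dot y y)).
Proof.
apply: (measurableT_comp (continuous_measurable_fun (@sqrt_continuous R))).
exact: (mrV_smooth (@smooth_sqn R n)).
Qed.

Lemma mrV_polar_weight n : mrV (@polar_weight n).
Proof.
have md : mrV (fun y : 'rV[R]_n => dot y y) := mrV_smooth (@smooth_sqn R n).
apply: measurable_fun_ifT; last exact: measurable_cst.
  apply: measurable_and; last by apply: measurable_fun_ler => //; exact: measurable_cst.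
  by apply: measurable_fun_ltr => //; exact: measurable_cst.
exact: mrV_sqrt.
Qed.

Lemma polar_weight_ge0 n (y : 'rV[R]_n) : 0 <= polar_weight y.
Proof. by rewrite /polar_weight; case: ifP => // _; exact: sqrtr_ge0. Qed.

Lemma dot0l n (x : 'rV[R]_n) : dot 0 x = 0.
Proof. by rewrite /dot big1 // => i _; rewrite mxE mul0r. Qed.

Lemma polar_weight0 n : polar_weight (0 : 'rV[R]_n) = 0.
Proof. by rewrite /polar_weight dot0l ltxx. Qed.

Definition dirv n (y : 'rV[R]_n) : 'rV[R]_n := isq (dot y y) *: y.

Lemma dirv_dot n (y : 'rV[R]_n) : 0 < dot y y -> dot (dirv y) (dirv y) = 1.
Proof.
move=> y0; rewrite /dirv dotZl dotZr mulrA -expr2 isq_sqr ?(ltW y0) // mulVf //.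
by rewrite gt_eqF.
Qed.

Lemma isq_sqrt (t : R) : 0 < t -> isq t * Num.sqrt t = 1.
Proof. by move=> t0; rewrite /isq mulVf // gt_eqF // sqrtr_gt0. Qed.

Let lamT : {sigma_finite_measure set mR -> \bar R} := lam.

Section PolarGe0.
Variables (n : nat) (G : 'rV[R]_n -> \bar R).
Hypotheses (n0 : (0 < n)%N) (mG : measurable_fun setT (fun t : tupR n => G (row_of t))).
Hypotheses (G0 : forall w, (0 <= G w)%E) (Gz : G 0 = 0%E).

Let row_of_coord_meas i : measurable_fun setT (fun t : tupR n => row_of t 0 i).
Proof. exact: mrV_coord. Qed.

Let ray (y : 'rV[R]_n) := (\int[lam]_s G (s *: dirv y))%E.

Let ray_weight (y : 'rV[R]_n) : 0 < dot y y ->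
  (ray y = \int[lam]_u ((Num.sqrt (dot y y))%:E * G (u *: y)))%E.
Proof.
move=> y0; set N := Num.sqrt (dot y y).
have N0 : 0 < N by rewrite sqrtr_gt0.
have md : measurable_fun setT (fun s : mR => G (s *: dirv y)).
  apply: (measurable_comp_rV _ mG) => i; under eq_fun do rewrite mxE mulrC.
  exact: measurable_funM.
have my : measurable_fun setT (fun s : mR => G (s *: y)).
  apply: (measurable_comp_rV _ mG) => i; under eq_fun do rewrite mxE mulrC.
  exact: measurable_funM.
rewrite ge0_integralZl_EFin ?(ltW N0) //.
have := lebesgue_affine1 0 (lt0r_neq0 N0) md (fun s => G0 _).
rewrite (_ : (fun t => _) = fun t => G (t *: y)); last first.
  apply/funext => t; rewrite add0r /dirv scalerA; congr G; congr (_ *: _).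
  by rewrite mulrAC [N * _]mulrC isq_sqrt // mul1r.
by move=> ->; rewrite muleA -EFinM gtr0_norm // mulfV ?gt_eqF // mul1e.
Qed.

(** Polar coordinates: both sides integrate, over all [u] and all [y] in the unit
    ball, the function [|y| G (u y)]; the left side results from [s = u |y|] at
    fixed [y], the right side from [w = u y] at fixed [u]. *)
Lemma polar_ge0 :
  (\int[leb n]_t (if (0 < dot (row_of t) (row_of t) <= 1)%R then ray (row_of t) else 0)
   = \int[leb n]_t ((2 / n%:R * isq (dot (row_of t) (row_of t)) ^+ n.-1)%:E * G (row_of t)))%E.
Proof.
have mW : measurable_fun setT (fun t : tupR n => (polar_weight (row_of t))%:E).
  by apply/measurable_EFinP; exact: mrV_polar_weight.
have W0 y : (0 <= (@polar_weight n y)%:E)%E by rewrite lee_fin polar_weight_ge0.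
transitivity (\int[leb n]_t \int[lamT]_u ((polar_weight (row_of t))%:E * G (u *: row_of t)))%E.
  apply: eq_integral => t _; rewrite /polar_weight; case: ifPn => [/andP[y0 _]|_].
    by rewrite ray_weight.
  by rewrite integral0_eq // => u _; rewrite mul0e.
pose H (p : tupR n * mR) := ((polar_weight (row_of p.1))%:E * G (p.2 *: row_of p.1))%E.
have mH : measurable_fun setT H.
  apply: emeasurable_funM.
    exact: (measurableT_comp mW).
  apply: (measurable_comp_rV _ mG) => i; under eq_fun do rewrite mxE.
  apply: measurable_funM => //; exact: (measurableT_comp (row_of_coord_meas i)).
have H0 p : (0 <= H p)%E by rewrite mule_ge0.
rewrite (@fubini_tonelli _ _ _ _ R (leb n) lamT H mH H0).
pose K (p : tupR n * mR) : \bar R :=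
  ((`|p.2| ^- n * polar_weight (p.2^-1 *: row_of p.1))%:E * G (row_of p.1))%E.
have mK : measurable_fun setT K.
  apply: emeasurable_funM; last exact: (measurableT_comp mG).
  apply/measurable_EFinP; apply: measurable_funM.
    under eq_fun do rewrite -exprVn; apply: measurable_funX.
    apply: (measurableT_comp measurable_invr).
    by apply: (measurableT_comp (@normr_measurable R setT)).
  apply: (measurable_comp_rV _ (@mrV_polar_weight n)) => i; under eq_fun do rewrite mxE.
  apply: measurable_funM; last exact: (measurableT_comp (row_of_coord_meas i)).
  exact: (measurableT_comp measurable_invr).
have K0 p : (0 <= K p)%E.
  by rewrite mule_ge0 // lee_fin mulr_ge0 ?polar_weight_ge0 // invr_ge0 exprn_ge0.
transitivity (\int[lamT]_u \int[leb n]_t K (t, u))%E.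
  apply: eq_integral => u _; have [->|u0] := eqVneq u 0.
    rewrite !integral0_eq // => t _; rewrite /K /H /= ?scale0r ?Gz ?mule0 //.
    by rewrite invr0 scale0r polar_weight0 mulr0 mul0e.
  pose F (w : 'rV[R]_n) := ((polar_weight (u^-1 *: w))%:E * G w)%E.
  have mF : measurable_fun setT (fun t : tupR n => F (row_of t)).
    apply: emeasurable_funM => //; apply/measurable_EFinP.
    apply: (measurable_comp_rV _ (@mrV_polar_weight n)) => i; under eq_fun do rewrite mxE.
    exact: measurable_funM.
  have F0 w : (0 <= F w)%E by rewrite mule_ge0.
  have := leb_affine 0 u0 mF F0.
  have u0' : 0 <= `|u| ^- n by rewrite invr_ge0 exprn_ge0.
  rewrite -(@ge0_integralZl_EFin _ _ R (leb n) setT measurableT _ (fun t _ => F0 _) mF _ u0').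
  rewrite (_ : (fun t => F _) = fun t => H (t, u)); last first.
    by apply/funext => t; rewrite /F /H add0r /= scalerA mulVf // scale1r.
  by move=> ->; apply: eq_integral => t _; rewrite /K /F /= EFinM muleA.
rewrite -(@fubini_tonelli _ _ _ _ R (leb n) lamT K mK K0).
apply: eq_integral => t _; set w := row_of t.
have [w0|w0] := leP (dot w w) 0.
  have -> : w = 0 by apply: dot_eq0; apply/eqP; rewrite eq_le w0 dot_ge0.
  rewrite Gz mule0 integral0_eq // => u _; rewrite /K /= -/w.
  have -> : w = 0 by apply: dot_eq0; apply/eqP; rewrite eq_le w0 dot_ge0.
  by rewrite Gz mule0.
set N := Num.sqrt (dot w w).
have N0 : 0 < N by rewrite sqrtr_gt0.
have NN : dot w w = N ^+ 2 by rewrite sqr_sqrtr // ltW.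
have EK u : (K (t, u) = G w * (N%:E * (if N <= `|u| then `|u| ^- n.+1 else 0)%:E))%E.
  rewrite /K /= -/w muleC; congr (_ * _)%E; rewrite -EFinM; congr EFin.
  have [->|u0] := eqVneq u 0.
    by rewrite normr0 leNgt N0 /= mulr0 invr0 scale0r polar_weight0 mulr0.
  have u0' : 0 < `|u| by rewrite normr_gt0.
  have dE : dot (u^-1 *: w) (u^-1 *: w) = (N / `|u|) ^+ 2.
    by rewrite dotZl dotZr NN mulrA -expr2 exprMn mulrC -[u^-1 ^+ 2]real_normK ?num_real // normfV.
  have q0 : 0 < N / `|u| by rewrite divr_gt0.
  have -> : polar_weight (u^-1 *: w) = if N <= `|u| then N / `|u| else 0.
    rewrite /polar_weight dE exprn_gt0 //= sqrtr_sqr (gtr0_norm q0).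
    by rewrite (expr_le1 _ (ltW q0)) // ler_pdivrMr // mul1r.
  case: ifP => _; last by rewrite !mulr0.
  rewrite mulrC -mulrA; congr (_ * _).
  by rewrite -invfM -exprS.
under eq_integral do rewrite EK.
have mt : measurable_fun setT (fun u : mR => (if N <= `|u| then `|u| ^- n.+1 else 0)%:E : \bar R).
  apply/measurable_EFinP; apply: measurable_fun_ifT.
  - by apply: measurable_fun_ler => //; exact: measurable_cst.
  - under eq_fun do rewrite -exprVn; apply: measurable_funX.
    exact: (measurableT_comp measurable_invr).
  - exact: measurable_cst.
have t0 (u : mR) : (0 <= (if N <= `|u| then `|u| ^- n.+1 else 0)%:E :> \bar R)%E.
  by rewrite lee_fin; case: ifP => // _; rewrite invr_ge0 exprn_ge0.
have mt' : measurable_fun setT (fun u : mR => N%:E * (if N <= `|u| then `|u| ^- n.+1 else 0)%:E)%E.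
  by apply: emeasurable_funM => //; exact: measurable_cst.
rewrite (@ge0_integralZl _ _ R lamT setT measurableT _ mt') //; last first.
  by move=> u _; rewrite mule_ge0 // lee_fin ltW.
rewrite ge0_integralZl_EFin ?(ltW N0) // tail_integral // muleC -EFinM; congr (_%:E * _)%E.
have -> : N ^- n = N^-1 * N^-1 ^+ n.-1 by rewrite -exprVn -exprS prednK.
rewrite /isq -/N; have n00 : n%:R != 0 :> R by rewrite pnatr_eq0 -lt0n.
by field; rewrite n00 gt_eqF.
Qed.
End PolarGe0.

Lemma itg_indic d (T : measurableType d) (mu : {measure set T -> \bar R}) (D : set T) :
  measurable D -> (mu D < +oo)%E -> itg mu (\1_D : T -> R).
Proof.
move=> mD Doo; apply/integrableP; split.
  by apply/measurable_EFinP; exact: measurable_indic.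
under eq_integral do rewrite /= ger0_norm //.
by rewrite integral_indic // setIT.
Qed.

Lemma lam_itv_oo (K : R) : (lam (`[(- K)%R, K]%classic : set mR) < +oo)%E.
Proof. by rewrite lebesgue_measure_itv /=; case: ifP => _; rewrite ?ltry. Qed.

Lemma measurable_ray n (G : 'rV[R]_n -> R) : mrV G ->
  measurable_fun setT (fun p : tupR n * mR => G (p.2 *: dirv (row_of p.1))).
Proof.
move=> mG; apply: (measurable_comp_rV _ mG) => i; under eq_fun do rewrite !mxE.
apply: measurable_funM => //; apply: measurable_funM.
  apply: (measurableT_comp measurable_invr); exact: (measurableT_comp (@mrV_sqrt n)).
by have := measurableT_comp (@mrV_coord R n i) (@measurable_fst _ _ (tupR n) mR); under eq_fun do rewrite /= mxE.
Qed.

Section PolarReal.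
Variables (n : nat) (M e K : R).
Hypotheses (n0 : (0 < n)%N) (e0 : 0 < e) (K0 : 0 <= K).

Let annular (G : 'rV[R]_n -> R) := [/\ mrV G, (forall w, `|G w| <= M),
  (forall w, dot w w < e -> G w = 0) & (forall w, K ^+ 2 < dot w w -> G w = 0)].

Definition ray_int (G : 'rV[R]_n -> R) (t : tupR n) : R :=
  if 0 < dot (row_of t) (row_of t) <= 1 then \int[lam]_s G (s *: dirv (row_of t)) else 0.

Let itg_ray G (y : 'rV[R]_n) : annular G -> 0 < dot y y -> itg lam (fun s => G (s *: dirv y)).
Proof.
move=> [mG GM _ GK] y0.
apply: (@itg_bounded _ _ _ lam _ (fun s => M * \1_(`[(- K), K]%classic : set mR) s)).
- apply: (measurable_comp_rV _ mG) => i; under eq_fun do rewrite mxE mulrC.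
  exact: measurable_funM.
- move=> s; have [sK|sK] := leP `|s| K.
    have sI : s \in (`[(- K), K]%classic : set mR) by rewrite mem_set //= in_itv /= -ler_norml.
    by rewrite indicE sI mulr1.
  rewrite GK ?normr0 ?mulr_ge0 //; first by apply: le_trans (GM 0).
  rewrite dotZl dotZr dirv_dot // mulr1 -expr2 -[s ^+ 2]real_normK ?num_real //.
  by rewrite ltr_pXn2r // nnegrE // ltW // (le_lt_trans _ sK).
- apply: itg_scale; apply: itg_indic; [exact: measurable_itv|exact: lam_itv_oo].
Qed.

Let weighted (G : 'rV[R]_n -> R) (w : 'rV[R]_n) : R := isq (dot w w) ^+ n.-1 * G w.

Let isq_le (t : R) : e <= t -> isq t <= isq e.
Proof.
move=> et; have t0 : 0 < t := lt_le_trans e0 et.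
by rewrite /isq lef_pV2 ?posrE ?sqrtr_gt0 //; exact: ler_wsqrtr.
Qed.

Let itg_weighted G : annular G -> itg (leb n) (fun t => weighted G (row_of t)).
Proof.
move=> [mG GM Ge GK]; have M0 : 0 <= M by apply: le_trans (GM 0).
apply: (@nice_integrable R n (isq e ^+ n.-1 * M) K); split.
- apply: measurable_funM mG; apply: measurable_funX.
  exact: (measurableT_comp measurable_invr (@mrV_sqrt n)).
- move=> w; have [we|we] := leP e (dot w w); last first.
    by rewrite /weighted Ge // mulr0 normr0 mulr_ge0 // exprn_ge0 // (ltW (isq_gt0 e0)).
  have w0 := lt_le_trans e0 we.
  rewrite normrM ler_pM // normrX gtr0_norm ?isq_gt0 //.
  by rewrite lerXn2r ?nnegrE ?(ltW (isq_gt0 e0)) ?(ltW (isq_gt0 w0)) // isq_le.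
- move=> w [i wi]; rewrite /weighted GK ?mulr0 //; apply: lt_le_trans (sqr_coord_le_dot w i).
  rewrite -[X in _ < X]real_normK ?num_real //.
  by rewrite ltr_pXn2r // nnegrE // ltW // (le_lt_trans _ wi).
Qed.

Let polar_pos G : annular G -> (forall w, 0 <= G w) ->
  itg (leb n) (ray_int G) /\
  \int[leb n]_t ray_int G t = 2 / n%:R * \int[leb n]_t weighted G (row_of t).
Proof.
move=> aG G0; have [mG GM Ge GK] := aG.
have mGE : measurable_fun setT (fun t : tupR n => (G (row_of t))%:E).
  exact/measurable_EFinP.
have Gz : (G 0)%:E = 0%E by rewrite Ge // dot0l.
have P := polar_ge0 n0 mGE (fun w => (G0 w : (0 <= (G w)%:E)%E)) Gz.
have E t : ((ray_int G t)%:E = if (0 < dot (row_of t) (row_of t) <= 1)%R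
    then \int[lam]_s (G (s *: dirv (row_of t)))%:E else 0)%E.
  rewrite /ray_int; case: ifP => // /andP[t0 _]; rewrite /Rintegral fineK //.
  exact: integrable_fin_num (itg_ray aG t0).
have W t : ((2 / n%:R * isq (dot (row_of t) (row_of t)) ^+ n.-1)%:E * (G (row_of t))%:E
    = (2 / n%:R * weighted G (row_of t))%:E)%E by rewrite -EFinM mulrA.
have iW := itg_scale (2 / n%:R) (itg_weighted aG).
have P' : (\int[leb n]_t (ray_int G t)%:E = \int[leb n]_t (2 / n%:R * weighted G (row_of t))%:E)%E.
  by under eq_integral do rewrite E; rewrite P; under eq_integral do rewrite W.
split; last by rewrite /Rintegral P' -int_scale //; exact: itg_weighted.
have r0 t : 0 <= ray_int G t by rewrite /ray_int; case: ifP => // _; exact: Rintegral_ge0.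
apply/integrableP; split; last first.
  under eq_integral do rewrite /= ger0_norm //.
  by rewrite P'; have := integrable_fin_num measurableT iW; rewrite fin_numE => /andP[_]; rewrite ltey.
rewrite (_ : _ \o _ = (fun t : tupR n => if (0 < dot (row_of t) (row_of t) <= 1)%R
    then \int[lam]_s (G (s *: dirv (row_of t)))%:E else 0%E)%E); last by apply/funext => t /=; rewrite E.
apply: measurable_fun_ifT; last exact: measurable_cst.
  have md : mrV (fun y : 'rV[R]_n => dot y y) := mrV_smooth (@smooth_sqn R n).
  apply: measurable_and; first by apply: measurable_fun_ltr => //; exact: measurable_cst.
  by apply: measurable_fun_ler => //; exact: measurable_cst.
apply: (@measurable_fun_fubini_tonelli_F _ _ (tupR n) mR R lamT
  (fun p => (G (p.2 *: dirv (row_of p.1)))%:E)) => //.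
by apply/measurable_EFinP; exact: measurable_ray.
Unshelve. by move=> p; rewrite lee_fin. Qed.

(** Positive and negative parts; away from the origin and infinity all the integrals
    converge absolutely. *)
Lemma polar_real G : annular G ->
  \int[leb n]_t ray_int G t = 2 / n%:R * \int[leb n]_t (isq (dot (row_of t) (row_of t)) ^+ n.-1 * G (row_of t)).
Proof.
move=> aG; have [mG GM Ge GK] := aG.
pose Gp w := Num.max (G w) 0; pose Gm w := Num.max (- G w) 0.
have aGp : annular Gp.
  split.
  - by apply: measurable_maxr => //; exact: measurable_cst.
  - by move=> w; apply: le_trans (GM w); rewrite /Gp; case: (leP (G w) 0) => // _; rewrite normr0.
  - by move=> w /Ge; rewrite /Gp => ->; rewrite maxxx.
  - by move=> w /GK; rewrite /Gp => ->; rewrite maxxx.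
have aGm : annular Gm.
  split.
  - apply: measurable_maxr; last exact: measurable_cst.
    exact: (measurableT_comp (@oppr_measurable R setT)).
  - move=> w; apply: le_trans (GM w); rewrite /Gm; case: (leP (- G w) 0) => // _; rewrite ?normr0 //.
    by rewrite normrN.
  - by move=> w /Ge; rewrite /Gm => ->; rewrite oppr0 maxxx.
  - by move=> w /GK; rewrite /Gm => ->; rewrite oppr0 maxxx.
have GE w : G w = Gp w - Gm w.
  by rewrite /Gp /Gm; have [h|h] := leP (G w) 0; have [h'|h'] := leP (- G w) 0; lra.
have p0 w : 0 <= Gp w by rewrite /Gp le_max lexx orbT.
have m0 w : 0 <= Gm w by rewrite /Gm le_max lexx orbT.
have [ip Pp] := polar_pos aGp p0; have [im Pm] := polar_pos aGm m0.
transitivity (\int[leb n]_t (ray_int Gp t - ray_int Gm t)).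
  congr Rintegral; apply/funext => t; rewrite /ray_int; case: ifP => [/andP[t0 _]|_]; last by rewrite subr0.
  rewrite -int_sub; [|exact: itg_ray|exact: itg_ray].
  by congr Rintegral; apply/funext => s; exact: GE.
rewrite int_sub // Pp Pm -mulrBr -int_sub; [|exact: itg_weighted|exact: itg_weighted].
by congr (_ * Rintegral _ _ _); apply/funext => t; rewrite /weighted -mulrBr -GE.
Qed.
End PolarReal.
End Polar.

(** * The adjoint of the X-ray transform *)

Section XrayAdjoint.
Context {R : realType}.
Local Notation mR := (measurableTypeR R).
Local Notation tupR n := (n.-tuple mR).
Local Notation lam := (@lebesgue_measure R).
Local Notation e_ i := (delta_mx 0 i).

Lemma compact_dot_set n (A : set 'rV[R]_n) N : closed A -> (forall x, A x -> `|x| <= N) -> compact A.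
Proof.
move=> cA bA; apply: (subclosed_compact cA (@compact_cball R n N)); exact: bA.
Qed.

Definition sphere n : set 'rV[R]_n := [set r | dot r r = 1].

Lemma compact_sphere n : compact (@sphere n).
Proof.
apply: (@compact_dot_set _ _ 1).
  have -> : @sphere n = ~` ([set x | 1 < dot x x] `|` [set x | dot x x < 1]).
    apply/seteqP; split=> r /=; rewrite /sphere /=; first by move=> ->; rewrite ltxx => -[].
    move=> h; apply/eqP; rewrite eq_le !leNgt; apply/andP; split; apply/negP => ?; apply: h; [left|right]; done.
  by apply: open_closedC; apply: openU; [exact: open_dot_gt|exact: open_dot_lt].
by move=> r r1; apply: norm_le_dot => //; rewrite expr1n r1.
Qed.

Lemma smooth_lsubmx n m (i : 'I_n) : smooth (fun p : 'rV[R]_(n + m) => lsubmx p 0 i).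
Proof.
rewrite (_ : (fun p => _) = fun p : 'rV[R]_(n + m) => p 0 (lshift m i)); first exact: smooth_coord.
by apply/funext => p; rewrite mxE.
Qed.

Lemma smooth_rsubmx n m (i : 'I_m) : smooth (fun p : 'rV[R]_(n + m) => rsubmx p 0 i).
Proof.
rewrite (_ : (fun p => _) = fun p : 'rV[R]_(n + m) => p 0 (rshift n i)); first exact: smooth_coord.
by apply/funext => p; rewrite mxE.
Qed.

Lemma smooth_row_mx2 k n m (f : 'rV[R]_k -> 'rV[R]_n) (g : 'rV[R]_k -> 'rV[R]_m) :
  (forall j, smooth (fun x => f x 0 j)) -> (forall j, smooth (fun x => g x 0 j)) ->
  forall j, smooth (fun x => row_mx (f x) (g x) 0 j).
Proof.
move=> sf sg j; case: (fintype.splitP j) => l jl.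
  have -> : j = lshift m l by apply/val_inj.
  by rewrite (_ : (fun x => _) = fun x => f x 0 l) //; apply/funext => x; rewrite row_mxEl.
have -> : j = rshift n l by apply/val_inj.
by rewrite (_ : (fun x => _) = fun x => g x 0 l) //; apply/funext => x; rewrite row_mxEr.
Qed.

Variable n : nat.

(** A pair (point, direction) represents a line in redundant form; this is its normal
    form in [Gamma]. *)
Definition line_of (p : 'rV[R]_(n + n)) : 'rV[R]_(n + n) :=
  row_mx (lsubmx p - dot (lsubmx p) (rsubmx p) *: rsubmx p) (rsubmx p).

Lemma smooth_line_of j : smooth (fun p => line_of p 0 j).
Proof.
apply: smooth_row_mx2 => {}j; last exact: smooth_rsubmx.
rewrite (_ : (fun p => _) = fun p : 'rV[R]_(n + n) =>
   lsubmx p 0 j - dot (lsubmx p) (rsubmx p) * rsubmx p 0 j); last by apply/funext => p; rewrite !mxE.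
apply: smooth_sub; first exact: smooth_lsubmx.
apply: smooth_mul; last exact: smooth_rsubmx.
by apply: smooth_dot => {}j; [exact: smooth_lsubmx|exact: smooth_rsubmx].
Qed.

Lemma line_of_Gamma p : sphere (rsubmx p) -> Gamma (line_of p).
Proof.
rewrite /sphere /= => r1; rewrite /Gamma /line_of /= row_mxKl row_mxKr; split => //.
by rewrite dotDl dotNl dotZl r1 mulr1 subrr.
Qed.

Definition adj_slice (phi : 'rV[R]_(n + n) -> R) i (p : 'rV[R]_(n + n)) : R :=
  rsubmx p 0 i * phi (line_of p).

Lemma smooth_rel_adj_slice phi i : smooth_rel (@Gamma R n) phi ->
  smooth_rel (@cyl R n n (@sphere n)) (adj_slice phi i).
Proof.
move=> sphi; apply: smooth_rel_mul; first by apply: smooth_smooth_rel; exact: smooth_rsubmx.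
by apply: (smooth_rel_comp smooth_line_of _ sphi) => p; exact: line_of_Gamma.
Qed.

Definition punctured_ball : set (tupR n) := [set t | 0 < dot (row_of t) (row_of t) <= 1].

Lemma in_punctured_ball t :
  (t \in punctured_ball) = (0 < dot (row_of t) (row_of t) <= 1).
Proof. by apply/idP/idP => [/set_mem|h]; [|exact: mem_set]. Qed.

Lemma measurable_punctured_ball : measurable punctured_ball.
Proof.
have := mset_open (@open_dot_gt R n 0); have := mset_open (@open_dot_gt R n 1); rewrite /mset => m1 m0.
rewrite (_ : punctured_ball = [set t | 0 < dot (row_of t) (row_of t)] `\` [set t | 1 < dot (row_of t) (row_of t)]).
  exact: measurableD.
apply/seteqP; split=> t /=; rewrite /punctured_ball /=.
  by move=> /andP[? ?]; split=> //; apply/negP; rewrite -leNgt.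
by case=> -> /negP; rewrite -leNgt.
Qed.

Lemma punctured_ball_oo : (leb n punctured_ball < +oo)%E.
Proof.
apply: (@le_lt_trans _ _ (leb n (@cubeT R n 1))); last by rewrite leb_cubeT // ltry.
apply: le_measure; rewrite ?inE; [exact: measurable_punctured_ball|exact: measurable_cubeT|].
move=> t /andP[_ t1] i; have := @coord_le_dot R n (row_of t) i 1 ler01; rewrite mxE.
by apply; rewrite expr1n.
Qed.

Lemma measurable_dirv i : measurable_fun setT (fun t : tupR n => dirv (row_of t) 0 i).
Proof.
under eq_fun do rewrite mxE; apply: measurable_funM; last exact: mrV_coord.
exact: (measurableT_comp measurable_invr (@mrV_sqrt R n)).
Qed.

Lemma dirv_sphere t : punctured_ball t -> sphere (dirv (row_of t)).
Proof. by case/andP => t0 _; exact: dirv_dot. Qed.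

Let adj_int phi i x t := slice_on punctured_ball (fun t => dirv (row_of t)) (adj_slice phi i) x t.

Let dominated_adj phi i : smooth_rel (@Gamma R n) phi -> dominated_smooth (leb n) (adj_int phi i).
Proof.
move=> sphi; apply: (dominated_slice_on (@compact_sphere n) measurable_punctured_ball
  punctured_ball_oo measurable_dirv dirv_sphere); exact: smooth_rel_adj_slice.
Qed.

Lemma adj_slice_row_mx phi i x r : adj_slice phi i (row_mx x r) =
  r 0 i * phi (row_mx (x - dot x r *: r) r).
Proof. by rewrite /adj_slice /line_of row_mxKl row_mxKr. Qed.

Let X1_adjE phi i x : smooth_rel (@Gamma R n) phi ->
  X1_adj phi i x = n%:R * \int[leb n]_t adj_int phi i x t.
Proof.
move=> sphi; rewrite /X1_adj /integral_sphere; congr (_ * _).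
set g := (X in integral_rV X).
have gE t : g (row_of t) = adj_int phi i x t.
  by rewrite /g /adj_int /slice_on in_punctured_ball; case: ifPn => // t1; rewrite adj_slice_row_mx.
have [M M0 hM] := cyl_bounded x (@compact_sphere n) (smooth_rel_adj_slice i sphi).
have ng : nice M 1 g.
  split.
  - rewrite /mrV (_ : (fun t => _) = adj_int phi i x); last exact/funext.
    have := ds_meas (dominated_adj i sphi) [::] x; exact.
  - move=> y; rewrite /g; case: ifPn => [/andP[y0 _]|_]; last by rewrite normr0.
    have := hM x; rewrite subrr normr0 ler01 => /(_ isT (dirv y) (dirv_dot y0)).
    by rewrite adj_slice_row_mx.
  - move=> y [j yj]; rewrite /g; case: ifPn => // /andP[_ y1].
    have := @coord_le_dot R n y j 1 ler01; rewrite expr1n => /(_ y1).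
    by rewrite leNgt yj.
by rewrite (integral_rVE ng); congr Rintegral; apply/funext => t.
Qed.

Lemma X1_adj_ray phi i x : smooth_rel (@Gamma R n) phi ->
  X1_adj phi i x = n%:R * \int[leb n]_t
    (if 0 < dot (row_of t) (row_of t) <= 1
     then dirv (row_of t) 0 i * phi (row_mx (x - dot x (dirv (row_of t)) *: dirv (row_of t)) (dirv (row_of t)))
     else 0).
Proof.
move=> sphi; rewrite X1_adjE //; congr (_ * Rintegral _ _ _); apply/funext => t.
by rewrite /adj_int /slice_on in_punctured_ball; case: ifPn => // t1; rewrite adj_slice_row_mx.
Qed.

Lemma smooth_X1_adj phi i : smooth_rel (@Gamma R n) phi -> smooth (X1_adj phi i).
Proof.
move=> sphi; rewrite (_ : X1_adj phi i = fun x => n%:R * \int[leb n]_t adj_int phi i x t).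
  by apply: smooth_scale; apply: smooth_integral; exact: dominated_adj.
by apply/funext => x; exact: X1_adjE.
Qed.

Lemma sum_partial_invariant (h : 'rV[R]_n -> R) (v : 'rV[R]_n) x : smooth h ->
  (forall x s, h (x + s *: v) = h x) -> \sum_i v 0 i * partial i h x = 0.
Proof.
move=> sh hv; have [dh <-] := smooth_on_differentiable openT sh (I : setT x) .
rewrite -deriveE //; have H : is_derive x v h 0.
  apply/is_derive_lineE; rewrite (_ : (fun s => _) = cst (h x)); first exact: is_derive_cst.
  by apply/funext => s; rewrite addrC hv.
by have [_ ->] := H.
Qed.

(** The adjoint superposes the fields [theta phi(., theta)], each of which is
    constant along [theta]. *)
Lemma X1_adj_divergence phi x : smooth_rel (@Gamma R n) phi ->
  \sum_i partial i (X1_adj phi i) x = 0.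
Proof.
move=> sphi.
have E i : partial i (X1_adj phi i) x = n%:R * \int[leb n]_t partial i (adj_int phi i ^~ t) x.
  rewrite (_ : X1_adj phi i = fun x => n%:R * \int[leb n]_t adj_int phi i x t); last first.
    by apply/funext => y; exact: X1_adjE.
  have d := dominated_adj i sphi.
  by rewrite (partialZ (U := setT)) //; [rewrite partial_integral|exact: smooth_integral].
under eq_bigr do rewrite E.
rewrite -mulr_sumr -int_sum; last first.
  move=> i; have := ds_itg x (ds_partials [:: i] (dominated_adj i sphi)); exact.
rewrite (_ : (fun t => _) = fun=> 0) ?Rintegral_cst ?mul0r ?mulr0 //.
apply/funext => t; rewrite /adj_int /slice_on; case tD : (t \in punctured_ball); last first.
  by rewrite big1 // => i _; exact: partial_cst.
have r1 := dirv_sphere (set_mem tD); set r := dirv (row_of t) in r1 *.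
pose h x := phi (row_mx (x - dot x r *: r) r).
have Gh y : Gamma (row_mx (y - dot y r *: r) r).
  have := @line_of_Gamma (row_mx y r); rewrite /line_of !row_mxKl !row_mxKr; exact.
have sh : smooth h.
  have sio j : smooth (fun x => line_of (row_mx x r) 0 j).
    by apply: (smooth_comp (io := fun x => row_mx x r)) (smooth_line_of j) => k; exact: smooth_row_mx.
  have sT : smooth_rel setT h.
    have := @smooth_rel_comp R _ _ setT _ _ phi sio _ sphi.
    rewrite (_ : (fun x => phi (line_of _)) = h); last first.
      by apply/funext => y; rewrite /h /line_of row_mxKl row_mxKr.
    by apply=> y _; apply: line_of_Gamma; rewrite row_mxKr.
  apply: smooth_on_local => y _; have [U [H [oU Uy sH HE]]] := sT y I.
  by exists U; [split|exact: (smooth_on_eq oU (fun z Uz => HE z I Uz) sH)].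
rewrite (eq_bigr (fun i => r 0 i * partial i h x)); last first.
  move=> i _; rewrite -(partialZ (U := setT)) //; congr (partial i _ x).
  by apply/funext => y; rewrite adj_slice_row_mx.
apply: sum_partial_invariant => // y s; rewrite /h; congr (phi (row_mx _ _)).
by rewrite dotDl dotZl r1 mulr1 scalerDl opprD addrACA subrr addr0.
Qed.
End XrayAdjoint.

(** * Correlations *)

Section Correlation.
Context {R : realType}.
Local Notation mR := (measurableTypeR R).
Local Notation tupR n := (n.-tuple mR).
Local Notation lam := (@lebesgue_measure R).
Local Notation e_ i := (delta_mx 0 i).

Lemma Rint_shift (a : R) (f : R -> R) : measurable_fun setT (f : mR -> mR) ->
  \int[lam]_t f (a + t) = \int[lam]_t f t.
Proof.
move=> mf; rewrite /Rintegral; congr fine.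
have mfE : measurable_fun setT (fun t : mR => (f t)%:E) by exact/measurable_EFinP.
have H (g : mR -> \bar R) : measurable_fun setT g -> (forall t, (0 <= g t)%E) ->
    (\int[lam]_t g (a + t)%R = \int[lam]_t g t)%E.
  move=> mg g0; have := lebesgue_affine1 a (oner_neq0 R) mg g0.
  by under eq_integral do rewrite mul1r; rewrite normr1 invr1 mul1e.
rewrite integralE [RHS]integralE; congr (_ - _)%E.
  rewrite -(H _ (measurable_funepos mfE) (fun w => funepos_ge0 _ _)).
  by apply: eq_integral => t _; rewrite !funeposE.
rewrite -(H _ (measurable_funeneg mfE) (fun w => funeneg_ge0 _ _)).
by apply: eq_integral => t _; rewrite !funenegE.
Qed.

(** Translations and the reflection preserve the positive and the negative part
    separately; so integrability is not required. *)
Lemma leb_affine_real n (x : 'rV[R]_n) (s : R) (f : 'rV[R]_n -> R) : `|s| = 1 -> mrV f ->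
  \int[leb n]_t f (x + s *: row_of t) = \int[leb n]_t f (row_of t).
Proof.
move=> s1 mf; rewrite /Rintegral; congr fine.
have s0 : s != 0 by rewrite -normr_eq0 s1 oner_neq0.
have mfE : measurable_fun setT (fun t : tupR n => (f (row_of t))%:E) by exact/measurable_EFinP.
have H (g : 'rV[R]_n -> \bar R) : measurable_fun setT (fun t : tupR n => g (row_of t)) ->
    (forall t, (0 <= g t)%E) ->
    (\int[leb n]_t g (x + s *: row_of t)%R = \int[leb n]_t g (row_of t))%E.
  by move=> mg g0; rewrite (leb_affine x s0 mg g0) s1 expr1n invr1 mul1e.
rewrite integralE [RHS]integralE; congr (_ - _)%E.
  have mp : measurable_fun setT (fun t : tupR n => ((EFin \o f)^\+ (row_of t))%E).
    have := measurable_funepos mfE; congr measurable_fun.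
    by apply/funext => t; rewrite !funeposE.
  have := H ((EFin \o f)^\+)%E mp (fun w => funepos_ge0 _ _); set A := (X in X = _ -> _); set B := (X in _ = X -> _) => AB.
  transitivity A; last transitivity B => //; apply: eq_integral => t _; by rewrite !funeposE.
have mp : measurable_fun setT (fun t : tupR n => ((EFin \o f)^\- (row_of t))%E).
  have := measurable_funeneg mfE; congr measurable_fun.
  by apply/funext => t; rewrite !funenegE.
have := H ((EFin \o f)^\-)%E mp (fun w => funeneg_ge0 _ _); set A := (X in X = _ -> _); set B := (X in _ = X -> _) => AB.
transitivity A; last transitivity B => //; apply: eq_integral => t _; by rewrite !funenegE.
Qed.

Lemma partials_shift n (s : seq 'I_n) (c : 'rV[R]_n) (h : 'rV[R]_n -> R) : smooth h ->
  partials s (fun x => h (x + c)) = (fun x => partials s h (x + c)).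
Proof.
move=> sh; elim: s => [|i s ih] //=; rewrite ih; apply/funext => x.
have ss := smooth_partials s sh.
have sc j : smooth (fun x : 'rV[R]_n => (x + c) 0 j).
  rewrite (_ : (fun x => _) = fun x : 'rV[R]_n => x 0 j + c 0 j); last by apply/funext => y; rewrite mxE.
  by apply: smooth_add; [exact: smooth_coord|exact: smooth_cst].
have E j : partial i (fun y : 'rV[R]_n => (y + c) 0 j) x = (j == i)%:R.
  rewrite (_ : (fun y => _) = fun y : 'rV[R]_n => y 0 j + c 0 j); last by apply/funext => y; rewrite mxE.
  apply: (etrans (partialD (U := setT) i (@smooth_coord R n j) (@smooth_cst R n (c 0 j)) I)).
  by rewrite partial_coord partial_cst addr0.
rewrite (partial_comp i x sc ss) (bigD1 i) //= big1 ?addr0 ?E ?eqxx ?mul1r // => j ji.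
by rewrite E (negbTE ji) mul0r.
Qed.

Lemma smooth_shift n (c : 'rV[R]_n) (h : 'rV[R]_n -> R) : smooth h -> smooth (fun x => h (x + c)).
Proof.
move=> sh; apply: (smooth_comp (io := fun x => x + c) _ sh) => j.
rewrite (_ : (fun x => _) = fun x : 'rV[R]_n => x 0 j + c 0 j); last by apply/funext => y; rewrite mxE.
by apply: smooth_add; [exact: smooth_coord|exact: smooth_cst].
Qed.

Lemma partials_cst0 n (s : seq 'I_n) : partials s (fun=> 0) = (fun=> 0 : R).
Proof.
by elim: s => [|i s ih] //=; rewrite ih; apply/funext => y; exact: partial_cst.
Qed.

Variable n : nat.

Definition supported (L : R) (h : 'rV[R]_n -> R) := forall y, L < `|y| -> h y = 0.

Lemma open_norm_gt (L : R) : open [set y : 'rV[R]_n | L < `|y|].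
Proof.
rewrite openE => y /= yN; apply/nbhs_closed_ball; exists ((`|y| - L) / 2).
  by rewrite divr_gt0 // subr_gt0.
move=> z zy; rewrite /=; have := ler_normB z (z - y); rewrite subKr; lra.
Qed.

Lemma supported_partials L s h : supported L h -> supported L (partials s h).
Proof.
move=> hL y yL; rewrite (partials_eq_on s (open_norm_gt (L := L)) (g := fun=> 0)) ?partials_cst0 //.
Qed.

Lemma supported_bounded L h : smooth h -> supported L h -> exists2 M, 0 <= M & forall y, `|h y| <= M.
Proof.
move=> sh hL; have [M M0 hM] := partials_bounded 0 (@compact_cball R n L) sh.
exists M => // y; have [yL|yL] := leP `|y| L; first exact: (hM [::]).
by rewrite hL // normr0.
Qed.

(** Correlation is used in place of convolution: it avoids reflections of the kernel. *)
Definition cor (k h : 'rV[R]_n -> R) (x : 'rV[R]_n) : R := \int[leb n]_t (k (row_of t) * h (x + row_of t)).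

Section Cor.
Variables (L : R) (k h : 'rV[R]_n -> R).
Hypotheses (sk : smooth k) (sh : smooth h) (hL : supported L h).

Let partials_cor s t : partials s (fun x => k (row_of t) * h (x + row_of t)) =
  (fun x => k (row_of t) * partials s h (x + row_of t)).
Proof.
have ss := smooth_shift (row_of t) sh.
have := partials_lin s (k (row_of t)) ss (@smooth_cst R n 0); rewrite partials_cst0 partials_shift //.
move=> E; rewrite (_ : (fun x => k (row_of t) * h (x + row_of t)) = fun x => k (row_of t) * h (x + row_of t) + 0).
  by rewrite E; apply/funext => x; rewrite addr0.
by apply/funext => x; rewrite addr0.
Qed.

Lemma dominated_cor : dominated_smooth (leb n) (fun x t => k (row_of t) * h (x + row_of t)).
Proof.
split.
- by move=> t; apply: smooth_scale; exact: smooth_shift.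
- move=> s x; under eq_fun do rewrite partials_cor.
  apply: measurable_funM; first exact: mrV_smooth sk.
  have := mrV_smooth (smooth_shift x (smooth_partials s sh)); rewrite /mrV.
  by under eq_fun do rewrite addrC.
- move=> s x0; have sp := supported_partials s hL.
  have [M M0 hM] := supported_bounded (smooth_partials s sh) sp.
  pose K := Num.max 0 (`|x0| + 1 + L).
  have [M' M'0 hM'] := partials_bounded 0 (@compact_cball R n K) sk.
  have K0 : 0 <= K by rewrite /K le_max lexx.
  exists 1, (fun t => M' * M * \1_(@cubeT R n K) t); split => //.
    have lc : (leb n (@cubeT R n K) < +oo)%E by rewrite leb_cubeT // ltry.
    exact: (itg_scale _ (itg_indic (@measurable_cubeT R n K) lc)).
  move=> x xx0 t; rewrite partials_cor normrM indicE.
  case tK : (t \in @cubeT R n K).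
    rewrite mulr1 ler_pM //; apply: (hM' [::]) => //; rewrite /cball /=.
    by apply: norm_le_coord => // i; rewrite mxE; exact: (set_mem tK).
  rewrite mulr0 sp ?normr0 ?mulr0 //.
  have [i hi] : exists i, K < `|tnth t i|.
    apply/not_existsP => H; have : t \in @cubeT R n K by apply/mem_set => i; rewrite leNgt; exact/negP.
    by rewrite tK.
  have := coord_le_norm (row_of t) i; rewrite mxE => hi'.
  have hx : `|x| <= `|x0| + 1 by rewrite -(subrK x0 x) addrC (le_trans (ler_normD _ _)) // lerD2l.
  have : `|row_of t| <= `|x + row_of t| + `|x|.
    by rewrite -[X in `|X| <= _](addKr x) addrC (le_trans (ler_normB _ _)).
  have : `|x0| + 1 + L <= K by rewrite /K le_max lexx orbT.
  lra.
Qed.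

Lemma smooth_cor : smooth (cor k h).
Proof. exact: smooth_integral dominated_cor. Qed.

Lemma partials1_cor i : partial i (cor k h) = cor k (partial i h).
Proof.
apply/funext => x; rewrite /cor (partial_integral i x dominated_cor).
by congr Rintegral; apply/funext => t; have := congr1 (fun f => f x) (partials_cor [:: i] t).
Qed.

Lemma itg_cor x : itg (leb n) (fun t => k (row_of t) * h (x + row_of t)).
Proof. exact: ds_itg dominated_cor. Qed.
End Cor.

(** The integral of the translates of [h] does not depend on the translation. *)
Lemma int_partial0 L h i : smooth h -> supported L h -> \int[leb n]_t partial i h (row_of t) = 0.
Proof.
move=> sh hL; have s1 := @smooth_cst R n 1.
have := congr1 (fun f => f 0) (partials1_cor s1 sh hL i).
rewrite (_ : cor (fun=> 1) h = fun=> \int[leb n]_t h (row_of t)).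
  rewrite partial_cst => E; rewrite [RHS]E /cor; congr Rintegral; apply/funext => t.
  by rewrite mul1r add0r.
apply/funext => x; rewrite -(leb_affine_real x (normr1 R) (mrV_smooth sh)) /cor.
by congr Rintegral; apply/funext => t; rewrite mul1r scale1r.
Qed.

Lemma cor_by_parts L k h i x : smooth k -> smooth h -> supported L h ->
  cor (partial i k) h x = - cor k (partial i h) x.
Proof.
move=> sk sh hL.
have sp : smooth (fun w => h (w + x)) := smooth_shift x sh.
have sL : supported (L + `|x|) (fun w => k w * h (w + x)).
  move=> w wL; rewrite hL ?mulr0 //; have := ler_normB (w + x) x; rewrite addrK; lra.
apply/eqP; rewrite -subr_eq0 opprK; apply/eqP.
have I1 := itg_cor (smooth_partial i sk) sh hL x.
have I2 := itg_cor sk (smooth_partial i sh) (supported_partials [:: i] hL) x.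
rewrite /cor -int_add // -[RHS](int_partial0 i (smooth_mul sk sp) sL).
congr Rintegral; apply/funext => t; apply/esym.
apply: (etrans (partialM (U := setT) i sk sp I)).
have := congr1 (fun f => f (row_of t)) (partials_shift [:: i] x sh); rewrite /= => ->.
by rewrite [x + _]addrC.
Qed.
End Correlation.

(** * Integrals over lines and the normal operator *)

Section LineTests.
Context {R : realType}.
Local Notation mR := (measurableTypeR R).
Local Notation tupR n := (n.-tuple mR).
Local Notation lam := (@lebesgue_measure R).
Local Notation e_ i := (delta_mx 0 i).

Lemma smooth_interval_integral m (L : R) (h : 'rV[R]_(m + 1) -> R) : smooth h ->
  smooth (fun x => \int[lam]_(t in `[(- L), L]) h (row_mx x (t%:M : 'rV[R]_1))).
Proof.
move=> sh; pose D : set mR := `[(- L), L]%classic; pose rho (t : mR) : 'rV[R]_1 := (t : R)%:M.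
rewrite (_ : (fun x => _) = fun x => \int[lam]_t slice_on D rho h x t); last first.
  apply/funext => x; rewrite Rintegral_mkcond; apply: eq_Rintegral => t _.
  by rewrite patchE /slice_on; case: ifP.
apply: smooth_integral; apply: (@dominated_slice_on R m 1 (cball `|L|)).
- exact: compact_cball.
- exact: measurable_itv.
- exact: lam_itv_oo.
- move=> j; rewrite (_ : (fun t => _) = id); first exact: measurable_id.
  by apply/funext => t; rewrite (ord1 j) mxE eqxx mulr1n.
- move=> t; rewrite /D /= in_itv /= => tL.
  apply: norm_le_coord => // j; rewrite mxE (ord1 j) eqxx mulr1n.
  by apply: le_trans (ler_norm L); rewrite ler_norml.
- exact: smooth_smooth_rel.
Qed.

Lemma smooth_continuous_rV n m (io : 'rV[R]_n -> 'rV[R]_m) :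
  (forall j, smooth (fun x => io x 0 j)) -> continuous io.
Proof. by move=> sio; apply/continuousP => A oA; exact: open_preimage_smooth. Qed.

Lemma compact_row_mx n m (A : set 'rV[R]_n) (B : set 'rV[R]_m) : compact A -> compact B ->
  compact [set p : 'rV[R]_(n + m) | A (lsubmx p) /\ B (rsubmx p)].
Proof.
move=> cA cB; have [M M0 hM] := compact_bounded_closed cA; have [N N0 hN] := compact_bounded_closed cB.
have clA : closed A by apply: compact_closed => //; exact: norm_hausdorff.
have clB : closed B by apply: compact_closed => //; exact: norm_hausdorff.
apply: (@compact_dot_set _ _ _ (M + N)).
  apply/closed_normP => p hp; split.
    apply: (closed_normP A).1 => // e e0; have [q [h1 h2] qp] := hp e e0.
    exists (lsubmx q) => //; rewrite -raddfB; exact: le_trans (norm_lsubmx_le _) qp.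
  apply: (closed_normP B).1 => // e e0; have [q [h1 h2] qp] := hp e e0.
  exists (rsubmx q) => //; rewrite -raddfB; exact: le_trans (norm_rsubmx_le _) qp.
move=> p [h1 h2]; rewrite -(hsubmxK p); apply: norm_row_mx_le; first exact: addr_ge0.
  by rewrite (le_trans (hM _ h1)) // lerDl.
by rewrite (le_trans (hN _ h2)) // lerDr.
Qed.

Lemma cauchy_schwarz_unit n (x r : 'rV[R]_n) : dot r r = 1 -> 0 <= dot x x - dot x r ^+ 2.
Proof.
move=> r1; have := dot_ge0 (x + - dot x r *: r).
by rewrite !(dotDl, dotDr, dotZl, dotZr) r1 [dot r x]dotC; congr (_ <= _); ring.
Qed.

Variable n : nat.

Definition line_test (L : R) (h : 'rV[R]_n -> R) (j : 'I_n) (p : 'rV[R]_(n + n)) : R :=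
  rsubmx p 0 j * \int[lam]_(t in `[(- L), L]) h (lsubmx p + t *: rsubmx p).

Lemma smooth_line_test L h j : smooth h -> smooth (line_test L h j).
Proof.
move=> sh; apply: smooth_mul; first exact: smooth_rsubmx.
pose io (q : 'rV[R]_((n + n) + 1)) : 'rV[R]_n := lsubmx (lsubmx q) + rsubmx q 0 0 *: rsubmx (lsubmx q).
have sio k : smooth (fun q => io q 0 k).
  rewrite (_ : (fun q => _) = fun q : 'rV[R]_((n + n) + 1) =>
    lsubmx q 0 (lshift n k) + rsubmx q 0 0 * lsubmx q 0 (rshift n k)); last by apply/funext => q; rewrite !mxE.
  apply: smooth_add; first exact: smooth_lsubmx.
  by apply: smooth_mul; [exact: smooth_rsubmx|exact: smooth_lsubmx].
have := smooth_interval_integral L (smooth_comp sio sh); congr smooth.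
apply/funext => p; apply: eq_Rintegral => t _; rewrite /io !row_mxKl row_mxKr.
by rewrite mxE eqxx mulr1n.
Qed.

(** The support lies over the lines that meet the support of [h]: it is contained
    in the image of a compact set of pairs (point, direction). *)
Lemma line_test_test_rel L h j (B V : set 'rV[R]_n) : smooth h -> compact B -> B `<=` V ->
  (forall y, h y != 0 -> B y) -> test_rel (@Gamma R n) (lines_meeting V) (line_test L h j).
Proof.
move=> sh cB BV hB.
pose C := @line_of R n @` [set p | B (lsubmx p) /\ sphere (rsubmx p)].
have cC : compact C.
  apply: continuous_compact; last exact: compact_row_mx (@compact_sphere R n).
  by apply: continuous_subspaceT; exact: smooth_continuous_rV (@smooth_line_of R n).
have clC : closed C by apply: compact_closed => //; exact: norm_hausdorff.
have SC : closure (@Gamma R n `&` [set p | line_test L h j p != 0]) `<=` C.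
  rewrite closureE; apply: smallest_sub => // p [[/= r1 zr] pn0].
  have [t [tL ht]] : exists t : R, t \in `[(- L), L] /\ h (lsubmx p + t *: rsubmx p) != 0.
    apply/not_existsP => H; move: pn0; rewrite /line_test.
    rewrite (_ : Rintegral _ _ _ = \int[lam]_(t in `[(- L), L]) (cst 0 t)).
      by rewrite Rintegral_cst ?mul0r ?mulr0 ?eqxx //; exact: measurable_itv.
    apply: eq_Rintegral => t /set_mem tL; apply/eqP; apply/negPn/negP => ht.
    by apply: (H t); split.
  exists (row_mx (lsubmx p + t *: rsubmx p) (rsubmx p)).
    by rewrite /= row_mxKl row_mxKr; split => //; exact: hB.
  rewrite /line_of row_mxKl row_mxKr dotDl zr add0r dotZl r1 mulr1 addrK; exact: hsubmxK.
split; first by apply: smooth_smooth_rel; exact: smooth_line_test.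
  exact: subclosed_compact (@closed_closure _ _) cC SC.
move=> p /SC [q [qB qs] <-]; split; first exact: line_of_Gamma.
exists (dot (lsubmx q) (rsubmx q)); rewrite /line_of row_mxKl row_mxKr subrK; exact: BV.
Qed.

(** The normal operator maps the field [h e_j] to the field with the components
    [2 \int w_i w_j |w|^(-n-1) h (x + w) dw]. *)
Definition normal_kernel (d : R) (i j : 'I_n) (w : 'rV[R]_n) : R :=
  w 0 i * w 0 j * isq (regsqn d w) ^+ n.+1.

Definition riesz_kernel (d : R) (w : 'rV[R]_n) : R := isq (regsqn d w) ^+ n.-1.

Section KernelFormula.
Variables (d L : R).
Hypotheses (n0 : (0 < n)%N) (d0 : 0 < d) (L0 : 0 <= L).

Lemma smooth_normal_kernel i j : smooth (normal_kernel d i j).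
Proof.
by apply: smooth_mul (smooth_isq_regsqn d0 _); apply: smooth_mul; exact: smooth_coord.
Qed.

Lemma smooth_riesz_kernel : smooth (riesz_kernel d).
Proof. exact: smooth_isq_regsqn. Qed.

Section OnePoint.
Variables (h : 'rV[R]_n -> R) (x : 'rV[R]_n).
Hypotheses (sh : smooth h) (hL : forall y, L ^+ 2 < dot y y -> h y = 0).
Hypothesis hx : forall y, dot (y - x) (y - x) <= d -> h y = 0.

Let hL' : supported L h.
Proof.
move=> y yL; apply: hL; rewrite ltNge; apply/negP => /(norm_le_dot L0).
by rewrite leNgt yL.
Qed.

Let ray_shift (r : 'rV[R]_n) : dot r r = 1 ->
  \int[lam]_(t in `[(- L), L]) h (x - dot x r *: r + t *: r) = \int[lam]_s h (x + s *: r).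
Proof.
move=> r1; pose f (s : R) := h (x + s *: r).
have mf : measurable_fun setT (f : mR -> mR).
  apply: (measurable_comp_rV _ (mrV_smooth sh)) => k; under eq_fun do rewrite !mxE.
  by apply: measurable_funD => //; apply: measurable_funM.
rewrite -(Rint_shift (- dot x r) mf) Rintegral_mkcond; apply: eq_Rintegral => t _.
rewrite patchE /f; have -> : x - dot x r *: r + t *: r = x + (- dot x r + t) *: r.
  by rewrite scalerDl scaleNr addrA.
case: ifPn => // tL; rewrite hL //.
rewrite !(dotDl, dotDr, dotZl, dotZr) r1 [dot r x]dotC; set a := dot x r.
have tL' : L ^+ 2 < t ^+ 2.
  rewrite -[t ^+ 2]real_normK ?num_real // ltr_pXn2r // ?nnegrE // ltNge; apply/negP => h'.
  by move/negP: tL; apply; rewrite mem_set //= in_itv /= -ler_norml.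
have cs : 0 <= dot x x - a ^+ 2.
  exact: cauchy_schwarz_unit.
apply: lt_le_trans tL' _; rewrite -subr_ge0; apply: le_trans cs _.
by rewrite le_eqVlt; apply/orP; left; apply/eqP; ring.
Qed.

(** Polar coordinates with [G w = w_i w_j |w|^-2 h (x + w)]: on the ray of direction
    [theta] this is [theta_i theta_j h (x + s theta)]. *)
Lemma X1_adj_line_test i j :
  X1_adj (line_test L h j) i x = 2 * cor (normal_kernel d i j) h x.
Proof.
have sphi : smooth_rel (@Gamma R n) (line_test L h j).
  by apply: smooth_smooth_rel; exact: smooth_line_test.
pose G (w : 'rV[R]_n) := w 0 i * w 0 j * (dot w w)^-1 * h (x + w).
have [M M0 hM] := supported_bounded sh hL'.
have hw w : dot w w <= d -> h (x + w) = 0 by move=> wd; apply: hx; rewrite addrC addKr.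
rewrite X1_adj_ray //.
rewrite (_ : Rintegral _ _ _ = \int[leb n]_t ray_int G t); last first.
  apply: eq_Rintegral => t _; rewrite /ray_int; case: ifP => // /andP[t0 _].
  have r1 := dirv_dot t0; move: (dirv (row_of t)) r1 => r r1.
  rewrite /line_test row_mxKl row_mxKr ray_shift // mulrA.
  have hr : itg lam (fun s : mR => h (x + s *: r)).
    have K0 : 0 <= L + `|dot x r| by rewrite addr_ge0.
    apply: (@itg_bounded _ _ _ lam _ (fun s => M * \1_(`[(- (L + `|dot x r|)), (L + `|dot x r|)]%classic : set mR) s)).
    - apply: (measurable_comp_rV _ (mrV_smooth sh)) => k; under eq_fun do rewrite !mxE.
      by apply: measurable_funD => //; apply: measurable_funM.
    - move=> s; have [sK|sK] := leP `|s| (L + `|dot x r|).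
        have sI : s \in (`[(- (L + `|dot x r|)), (L + `|dot x r|)]%classic : set mR).
          by rewrite mem_set //= in_itv /= -ler_norml.
        by rewrite indicE sI mulr1.
      have e : L < `|dot x r + s|.
        have := ler_normB (dot x r + s) (dot x r); rewrite addrC addKr; lra.
      have cs := cauchy_schwarz_unit x r1.
      have e2 : L ^+ 2 < (dot x r + s) ^+ 2.
        by rewrite -[X in _ < X]real_normK ?num_real // ltr_pXn2r // nnegrE.
      have hz : h (x + s *: r) = 0.
        apply: hL; rewrite !(dotDl, dotDr, dotZl, dotZr) r1 [dot r x]dotC.
        by move: cs e2; set a := dot x r; nra.
      by rewrite hz normr0 mulr_ge0.
    - apply: itg_scale; apply: itg_indic; [exact: measurable_itv|exact: lam_itv_oo].
  rewrite -int_scale //; apply: eq_Rintegral => s _; rewrite /G.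
  have [->|s0] := eqVneq s 0.
    by rewrite scale0r addr0 hx ?mulr0 // subrr dot0l ltW.
  rewrite dotZl dotZr r1 mulr1 !mxE; congr (_ * _).
  by rewrite invfM; field.
(* [h (x + w) = 0] if [|w| > |x| + L]; the factor [n] compares the two norms. *)
pose K := n%:R * (`|x| + L).
have K0 : 0 <= K by rewrite mulr_ge0 // addr_ge0.
have aG : [/\ mrV G, (forall w, `|G w| <= M), (forall w, dot w w < d -> G w = 0) &
    (forall w, K ^+ 2 < dot w w -> G w = 0)].
  split.
  - have -> : G = (fun w => w 0 i * w 0 j * (dot w w)^-1 * h (w + x)).
      by apply/funext => w; rewrite /G [x + w]addrC.
    apply: measurable_funM; last exact: mrV_smooth (smooth_shift x sh).
    apply: measurable_funM; first by apply: measurable_funM; exact: mrV_coord.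
    exact: (measurableT_comp measurable_invr (mrV_smooth (@smooth_sqn R n))).
  - move=> w; rewrite normrM -[X in _ <= X]mul1r ler_pM //.
    have [->|w0] := eqVneq (dot w w) 0; first by rewrite invr0 mulr0 normr0.
    have w1 : 0 < dot w w by rewrite lt0r w0 dot_ge0.
    rewrite normrM normfV (gtr0_norm w1) ler_pdivrMr // mul1r normrM.
    have h1 := sqr_coord_le_dot w i; have h2 := sqr_coord_le_dot w j.
    rewrite -[_ ^+ 2]real_normK ?num_real // in h1; rewrite -[_ ^+ 2]real_normK ?num_real // in h2.
    have : 0 <= (`|w 0 i| - `|w 0 j|) ^+ 2 by exact: sqr_ge0.
    move: (`|w 0 i|) (`|w 0 j|) h1 h2 => a b; nra.
  - by move=> w /ltW /hw; rewrite /G => ->; rewrite mulr0.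
  - move=> w wK; rewrite /G hL' ?mulr0 //.
    have wn : `|x| + L < `|w|.
      rewrite ltNge; apply/negP => wn; move: wK; rewrite ltNge => /negP; apply.
      apply: le_trans (dot_le_norm w) _; rewrite /K exprMn; apply: ler_pM => //.
        by rewrite -natrX ler_nat -{1}(expn1 n) leq_pexp2l.
      by rewrite ler_pXn2r ?nnegrE // addr_ge0.
    have := ler_normB (x + w) x; rewrite [x + w]addrC addrK; lra.
rewrite (polar_real n0 d0 K0 aG) mulrA mulrCA mulfV ?mulr1; last by rewrite pnatr_eq0 -lt0n.
congr (_ * _); apply: eq_Rintegral => t _; set w := row_of t.
have [wd|wd] := leP (dot w w) d; first by rewrite /G hw // !mulr0.
rewrite /G /normal_kernel regsqnE ?(ltW wd) // !mulrA; congr (_ * _).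
have w0 : 0 < dot w w := lt_trans d0 wd.
rewrite -(isq_sqr (ltW w0)); have -> : n.+1 = (n.-1 + 2)%N by rewrite addn2 prednK.
by rewrite exprD; ring.
Qed.
End OnePoint.

(** The terms [w_i w_j w_k |w|^(-n-3)] cancel by symmetry; the remaining ones are first
    derivatives of [|w|^(1-n)]. *)
Lemma normal_kernel_curl i j k w : (1 < n)%N -> d < dot w w ->
  partial k (normal_kernel d i j) w - partial j (normal_kernel d i k) w =
  n.-1%:R^-1 * ((i == j)%:R * partial k (riesz_kernel d) w - (i == k)%:R * partial j (riesz_kernel d) w).
Proof.
move=> n1 wd.
have P a b c : partial c (normal_kernel d a b) w =
   ((a == c)%:R * w 0 b + w 0 a * (b == c)%:R) * isq (regsqn d w) ^+ n.+1
   - n.+1%:R * isq (regsqn d w) ^+ (n.+1 + 2) * (w 0 a * w 0 b * w 0 c).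
  rewrite /normal_kernel (partialM (U := setT)) //; last exact: smooth_isq_regsqn.
    rewrite (partialM (U := setT)) ?partial_coord //; [|exact: smooth_coord|exact: smooth_coord].
    by rewrite partial_isq_regsqn //; ring.
  by apply: smooth_mul; exact: smooth_coord.
rewrite !P /riesz_kernel !partial_isq_regsqn //.
have -> : (n.-1 + 2 = n.+1)%N by case: (n) n1 => // m _; rewrite addn2.
have p0 : n.-1%:R != 0 :> R by rewrite pnatr_eq0; lia.
rewrite [(k == j)]eq_sym; field; exact: p0.
Qed.

Lemma X1_adj_curl_test h x i j k : (1 < n)%N -> smooth h ->
  (forall y, L ^+ 2 < dot y y -> h y = 0) -> (exists2 d', d < d' & forall y, dot (y - x) (y - x) <= d' -> h y = 0) ->
  X1_adj (line_test L (partial k h) j) i x - X1_adj (line_test L (partial j h) k) i x =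
  2 / n.-1%:R * ((i == j)%:R * partial k (cor (riesz_kernel d) h) x
               - (i == k)%:R * partial j (cor (riesz_kernel d) h) x).
Proof.
move=> n1 sh hL [d' dd' hx].
have hL' : supported L h.
  by move=> y yL; apply: hL; rewrite ltNge; apply/negP => /(norm_le_dot L0); rewrite leNgt yL.
have hLp l y : L ^+ 2 < dot y y -> partial l h y = 0.
  by move=> yL; rewrite (partial_eq_on (open_dot_gt (c := L ^+ 2)) (g := fun=> 0)) ?partial_cst.
have hxp l y : dot (y - x) (y - x) <= d -> partial l h y = 0.
  move=> yd; rewrite (@partial_eq_on R n [set y : 'rV[R]_n | dot (y - x) (y - x) < d'] h (fun=> 0)) ?partial_cst //=.
  - have := @open_preimage_smooth R n n (fun y => y - x) [set y | dot y y < d'].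
    apply; last exact: open_dot_lt.
    by move=> a; rewrite (_ : (fun y => _) = fun y : 'rV[R]_n => y 0 a - x 0 a);
      [apply: smooth_sub; [exact: smooth_coord|exact: smooth_cst]|apply/funext => z; rewrite !mxE].
  - by move=> z /ltW; exact: hx.
  - exact: le_lt_trans yd dd'.
have sN a b := smooth_normal_kernel a b; have sR := smooth_riesz_kernel.
have E1 a b l : X1_adj (line_test L (partial l h) b) a x = 2 * cor (normal_kernel d a b) (partial l h) x.
  exact: (@X1_adj_line_test (partial l h) x (smooth_partial l sh) (hLp l) (hxp l) a b).
have bp a b l : cor (normal_kernel d a b) (partial l h) x = - cor (partial l (normal_kernel d a b)) h x.
  by rewrite (cor_by_parts l x (sN a b) sh hL') opprK.
have br l : partial l (cor (riesz_kernel d) h) x = - cor (partial l (riesz_kernel d)) h x.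
  by rewrite (partials1_cor sR sh hL') (cor_by_parts l x sR sh hL') opprK.
have I1 a b l : itg (leb n) (fun t => partial l (normal_kernel d a b) (row_of t) * h (x + row_of t)).
  exact: itg_cor (smooth_partial l (sN a b)) sh hL' x.
have I2 l : itg (leb n) (fun t => partial l (riesz_kernel d) (row_of t) * h (x + row_of t)).
  exact: itg_cor (smooth_partial l sR) sh hL' x.
have E : cor (partial k (normal_kernel d i j)) h x - cor (partial j (normal_kernel d i k)) h x =
   n.-1%:R^-1 * ((i == j)%:R * cor (partial k (riesz_kernel d)) h x - (i == k)%:R * cor (partial j (riesz_kernel d)) h x).
  rewrite /cor -int_sub // -!int_scale // -int_sub; [|exact: itg_scale|exact: itg_scale].
  rewrite -int_scale; last by apply: itg_sub; exact: itg_scale.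
  apply: eq_Rintegral => t _; set w := row_of t; have [wd|wd] := leP (dot w w) d.
    have hz : h (x + w) = 0 by apply: hx; rewrite addrC addKr (le_trans wd) // ltW.
    have H0 (a b m p q c e s : R) : s = 0 -> a * s - b * s = m * (p * (c * s) - q * (e * s)).
      by move=> ->; ring.
    exact: (H0 _ _ _ _ _ _ _ _ hz).
  have H2 (a b m p q c e s : R) : a - b = m * (p * c - q * e) ->
      a * s - b * s = m * (p * (c * s) - q * (e * s)) by move=> HE; rewrite -mulrBl HE; ring.
  exact: (H2 _ _ _ _ _ _ _ _ (normal_kernel_curl i j k n1 wd)).
have H (Y1 Y2 P1 P2 C1 C2 K1 K2 q1 q2 m a b : R) : Y1 = 2 * P1 -> Y2 = 2 * P2 ->
    P1 = - C1 -> P2 = - C2 -> q1 = - K1 -> q2 = - K2 -> C1 - C2 = m * (a * K1 - b * K2) ->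
    Y1 - Y2 = 2 * m * (a * q1 - b * q2).
  move=> -> -> -> -> -> -> HE; rewrite (_ : 2 * - C1 - 2 * - C2 = - 2 * (C1 - C2)); last by ring.
  by rewrite HE; ring.
exact: (H _ _ _ _ _ _ _ _ _ _ _ _ _ (E1 i j k) (E1 i k j) (bp i j k) (bp i k j) (br k) (br j) E).
Qed.
End KernelFormula.
End LineTests.

(** * Closed forms and divergence-free fields on a box *)

Section LocalPoincare.
Context {R : realType}.
Local Notation e_ i := (delta_mx 0 i).

Lemma upd_seg n (i : 'I_n) (x : 'rV[R]_n) b : upd i x b = seg b i 0 x.
Proof. by rewrite /seg mul0r addr0. Qed.

Lemma partial_upd n (i j : 'I_n) (h : 'rV[R]_n -> R) b x : smooth h ->
  partial j (fun x => h (upd i x b)) x = if j == i then 0 else partial j h (upd i x b).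
Proof.
move=> sh; under [X in partial _ X]eq_fun do rewrite upd_seg.
by rewrite partial_comp_seg // -upd_seg; case: ifP; rewrite ?mul0r ?mul1r.
Qed.

Lemma smooth_comp_upd n (i : 'I_n) (h : 'rV[R]_n -> R) b : smooth h -> smooth (fun x => h (upd i x b)).
Proof. by move=> sh; apply: (smooth_comp (io := fun x => upd i x b) _ sh) => j; exact: smooth_upd. Qed.

(** The antiderivatives in the variable of index [i] of both sides agree with
    [partial j h] minus its restriction to the hyperplane where this variable is zero. *)
Theorem partialC n (i j : 'I_n) (h : 'rV[R]_n -> R) : smooth h ->
  partial j (partial i h) = partial i (partial j h).
Proof.
move=> sh; have [->//|ji] := eqVneq j i.
have si := smooth_partial i sh; have sj := smooth_partial j sh.
have E : antideriv 0 i (partial j (partial i h)) = antideriv 0 i (partial i (partial j h)).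
  apply: (etrans (esym (partial_antideriv_neq 0 si ji))).
  have E2 : antideriv 0 i (partial i h) = fun x => h x - h (upd i x 0).
    by apply/funext => y; exact: antideriv_partial.
  apply: (etrans (congr1 (partial j) E2)); apply/funext => x.
  apply: (etrans _ (esym (antideriv_partial 0 i x sj))).
  apply: (etrans (partialB (U := setT) j sh (smooth_comp_upd i 0 sh) I)).
  have := partial_upd i j 0 x sh; rewrite (negbTE ji) => E3.
  exact: (congr1 (fun c => partial j h x - c) E3).
have s1 := smooth_partial j si; have s2 := smooth_partial i sj.
exact: (etrans (esym (partial_antideriv 0 i s1)) (etrans (congr1 (partial i) E) (partial_antideriv 0 i s2))).
Qed.

Lemma partial_invariant n (i : 'I_n) (h : 'rV[R]_n -> R) x :
  (forall t, h (x + t *: e_ i) = h x) -> partial i h x = 0.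
Proof.
move=> H; have D : is_derive x (e_ i) h 0.
  apply/is_derive_lineE; rewrite (_ : (fun s => _) = cst (h x)); first exact: is_derive_cst.
  by apply/funext => s; rewrite addrC H.
by case: D.
Qed.

#[local] Opaque partial antideriv.

Lemma antideriv_sum n (a : R) (k : 'I_n) m (F : 'I_m -> 'rV[R]_n -> R) x : (forall i, smooth (F i)) ->
  antideriv a k (fun x => \sum_i F i x) x = \sum_i antideriv a k (F i) x.
Proof.
elim: m F => [|m ih] F sF.
  rewrite big_ord0 (_ : (fun x => _) = fun=> 0) ?antideriv0 //.
  by apply/funext => y; rewrite big_ord0.
rewrite big_ord_recl -ih // (_ : (fun x => _) = fun x => 1 * F ord0 x + \sum_i F (lift ord0 i) x); last first.
  by apply/funext => y; rewrite big_ord_recl mul1r.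
by rewrite antideriv_lin // ?mul1r //; exact: smooth_sum.
Qed.

Variables (n : nat) (x0 : 'rV[R]_n) (r : R) (g : 'I_n -> functional (R := R) n).
Hypotheses (r0 : 0 < r) (cg : forall i, compact_distribution (g i)).

Definition box_supported (h : 'rV[R]_n -> R) := forall (x : 'rV[R]_n) i, r < `|x 0 i - x0 0 i| -> h x = 0.

Hypothesis closed_g : forall h, smooth h -> box_supported h ->
  forall i j, g i (partial j h) = g j (partial i h).

Section Direction.
Variable k : 'I_n.
Let a := x0 0 k - r - 1.
Let b := x0 0 k + r + 1.

Let step (x : 'rV[R]_n) : R := 1 - plateau (x0 0 k - r) (x0 0 k + r) (x 0 k).

Let ab' : x0 0 k - r < x0 0 k + r. Proof. by rewrite ltrD2l gtrN. Qed.

Let smooth_step : smooth step.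
Proof.
by apply: smooth_sub; [exact: smooth_cst|apply: smooth_plateau => //; exact: smooth_coord].
Qed.

Let step0 (x : 'rV[R]_n) : x 0 k < x0 0 k - r -> step x = 0.
Proof. by move=> xa; rewrite /step plateau1 ?subrr // ltW. Qed.

Let step1 (x : 'rV[R]_n) : x0 0 k + r < x 0 k -> step x = 1.
Proof. by move=> xa; rewrite /step plateau0 ?subr0 // ltW. Qed.

Let coord_shift j t (x : 'rV[R]_n) : j != k -> (x + t *: e_ j) 0 k = x 0 k.
Proof. by move=> jk; rewrite !mxE eqxx eq_sym (negbTE jk) /= mulr0 addr0. Qed.

Let partial_step j x : j != k -> partial j step x = 0.
Proof. by move=> jk; apply: partial_invariant => t; rewrite /step coord_shift. Qed.

Let partial_bump j x : j != k -> partial j (partial k step) x = 0.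
Proof.
move=> jk; rewrite partialC // (_ : partial j step = fun=> 0) ?partial_cst //.
by apply/funext => y; exact: partial_step.
Qed.

Let out_cases (x : 'rV[R]_n) : r < `|x 0 k - x0 0 k| -> x 0 k < x0 0 k - r \/ x0 0 k + r < x 0 k.
Proof.
rewrite lter_normr => /orP[h|h]; [right|left]; lra.
Qed.

Let bump0 (x : 'rV[R]_n) : r < `|x 0 k - x0 0 k| -> partial k step x = 0.
Proof.
have sc c : open [set y : 'rV[R]_n | y 0 k < c] /\ open [set y : 'rV[R]_n | c < y 0 k].
  split; [rewrite (_ : [set y | _] = (fun y : 'rV[R]_n => y 0 k) @^-1` [set t | t < c]) //|
          rewrite (_ : [set y | _] = (fun y : 'rV[R]_n => y 0 k) @^-1` [set t | c < t]) //];
  (apply: open_comp; last by [exact: open_lt|exact: open_gt]); by move=> y _; exact: continuous_for_coord.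
case/out_cases => h.
  by rewrite (partial_eq_on (sc _).1 (g := fun=> 0) step0) ?partial_cst.
by rewrite (partial_eq_on (sc _).2 (g := fun=> 1) step1) ?partial_cst.
Qed.

Let total h (x : 'rV[R]_n) : R := antideriv a k h (upd k x b).

Let smooth_total h : smooth h -> smooth (total h).
Proof. by move=> sh; apply: smooth_comp_upd; exact: smooth_antideriv. Qed.

Let partial_total j h x : smooth h -> partial j (total h) x = if j == k then 0 else total (partial j h) x.
Proof.
move=> sh; rewrite /total partial_upd; last exact: smooth_antideriv.
by case: eqVneq => // jk; rewrite (partial_antideriv_neq a sh jk).
Qed.

(** To the right of the box the antiderivative is constant in the direction [k], equal
    to [total h]; the step function removes this constant. *)
Let prim h (x : 'rV[R]_n) : R := antideriv a k h x - step x * total h x.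

Let smooth_prim h : smooth h -> smooth (prim h).
Proof.
move=> sh.
exact: (smooth_sub (smooth_antideriv a k sh) (smooth_mul smooth_step (smooth_total sh))).
Qed.

Let partial_prim j h x : smooth h -> j != k -> partial j (prim h) x = prim (partial j h) x.
Proof.
move=> sh jk; have sA := smooth_antideriv a k sh; have sT := smooth_total sh.
apply: (etrans (partialB (U := setT) j sA (smooth_mul smooth_step sT) I)).
have E1 := congr1 (fun f => f x) (partial_antideriv_neq a sh jk).
have E2 := partialM (U := setT) j smooth_step sT (I : setT x).
have E3 := partial_total j x sh; rewrite (negbTE jk) in E3.
by rewrite E1 E2 E3 (partial_step x jk) mul0r add0r.
Qed.

Let partial_prim_k h x : smooth h -> partial k (prim h) x = h x - partial k step x * total h x.
Proof.
move=> sh; have sA := smooth_antideriv a k sh; have sT := smooth_total sh.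
apply: (etrans (partialB (U := setT) k sA (smooth_mul smooth_step sT) I)).
have E1 := congr1 (fun f => f x) (partial_antideriv a k sh).
have E2 := partialM (U := setT) k smooth_step sT (I : setT x).
have E3 := partial_total k x sh; rewrite eqxx in E3.
by rewrite E1 E2 E3 mulr0 addr0.
Qed.

Let antideriv_eq0 (c : R) h x : smooth h -> (forall t, 0 <= t <= 1 -> h (seg c k t x) = 0) ->
  antideriv c k h x = 0.
Proof.
move=> sh hz; apply/eqP; rewrite -normr_le0.
have := @antideriv_bound R n c k h x 0 sh; rewrite mulr0; apply=> t t01.
by rewrite hz // normr0.
Qed.

Let out_seg (c t : R) (x : 'rV[R]_n) i : i != k -> seg c k t x 0 i = x 0 i.
Proof. by move=> ik; rewrite mxE (negbTE ik). Qed.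

Let total_supp h (x : 'rV[R]_n) i : smooth h -> box_supported h -> i != k -> r < `|x 0 i - x0 0 i| -> total h x = 0.
Proof.
move=> sh hb ik xi; apply: antideriv_eq0 => // t _; apply: (hb _ i).
by rewrite out_seg // mxE (negbTE ik).
Qed.

Let box_prim h : smooth h -> box_supported h -> box_supported (prim h).
Proof.
move=> sh hb x i xi; rewrite /prim; have [ik|ik] := eqVneq i k; last first.
  rewrite (total_supp sh hb ik xi) mulr0 subr0; apply: antideriv_eq0 => // t _.
  by apply: (hb _ i); rewrite out_seg.
rewrite ik in xi; have [xa|xb] := out_cases xi.
  rewrite step0 // mul0r subr0; apply: antideriv_eq0 => // t /andP[t0 t1]; apply: (hb _ k).
  rewrite mxE eqxx lter_normr /a; apply/orP; right.
  have [->|tn0] := eqVneq t 0; first by rewrite mul0r; lra.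
  have : 0 < t * (x0 0 k - r - x 0 k) by rewrite mulr_gt0 ?subr_gt0 // lt0r tn0.
  lra.
rewrite step1 // mul1r /total.
have sA := smooth_antideriv a k sh.
rewrite -(antideriv_partial b k x sA) (partial_antideriv a k sh).
apply: antideriv_eq0 => // t /andP[t0 t1]; apply: (hb _ k).
rewrite mxE eqxx lter_normr /b; apply/orP; left.
have [->|tn0] := eqVneq t 0; first by rewrite mul0r; lra.
have : 0 < t * (x 0 k - (x0 0 k + r)) by rewrite mulr_gt0 ?subr_gt0 // lt0r tn0.
lra.
Qed.

Let corner h (c : R) (x : 'rV[R]_n) : box_supported h -> r < `|c - x0 0 k| -> h (upd k x c) = 0.
Proof. by move=> hb hc; apply: (hb _ k); rewrite mxE eqxx. Qed.

Let a_out : r < `|a - x0 0 k|. Proof. by rewrite /a lter_normr; apply/orP; right; lra. Qed.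
Let b_out : r < `|b - x0 0 k|. Proof. by rewrite /b lter_normr; apply/orP; left; lra. Qed.
Let total_partial h x : smooth h -> box_supported h -> total (partial k h) x = 0.
Proof. by move=> sh hb; rewrite /total antideriv_partial // !corner ?subr0. Qed.

Let reduced (D : 'I_n -> 'rV[R]_n -> R) i (x : 'rV[R]_n) : R :=
  if i == k then 0 else partial k step x * total (D i) x.

Section Reduce.
Variable D : 'I_n -> 'rV[R]_n -> R.
Hypotheses (sD : forall i, smooth (D i)) (bD : forall i, box_supported (D i)).
Hypothesis divD : forall x, \sum_i partial i (D i) x = 0.

Let sdD i : smooth (partial i (D i)). Proof. exact: (smooth_partial i (sD i)). Qed.

Let sum_total x : \sum_(i | i != k) total (partial i (D i)) x = 0.
Proof.
have := antideriv_sum a k (upd k x b) sdD.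
have -> : (fun x => \sum_i partial i (D i) x) = fun=> 0 by exact/funext.
rewrite antideriv0 (bigD1 k) //=.
have E2 : antideriv a k (partial k (D k)) (upd k x b) = 0 := total_partial x (sD k) (bD k).
by rewrite E2 add0r => E; exact: esym E.
Qed.

Let sum_prim x : D k x + \sum_(i | i != k) prim (partial i (D i)) x = 0.
Proof.
have := antideriv_sum a k x sdD.
have -> : (fun x => \sum_i partial i (D i) x) = fun=> 0 by exact/funext.
rewrite antideriv0 (bigD1 k) //=.
have E2 := antideriv_partial a k x (sD k); rewrite (corner x (bD k) a_out) subr0 in E2.
rewrite E2 => E; rewrite [RHS]E; congr (_ + _); rewrite /prim sumrB -mulr_sumr.
have H (A s c : R) : c = 0 -> A - s * c = A by move=> ->; rewrite mulr0 subr0.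
exact: (H _ _ _ (sum_total x)).
Qed.

Lemma reduced_smooth i : smooth (reduced D i).
Proof.
rewrite /reduced; case: (i == k); first exact: smooth_cst.
exact: (smooth_mul (smooth_partial k smooth_step) (smooth_total (sD i))).
Qed.

Lemma reduced_box i : box_supported (reduced D i).
Proof.
move=> x j xj; rewrite /reduced; case: (i == k) => //.
have [jk|jk] := eqVneq j k; first by rewrite bump0 ?mul0r // -jk.
by rewrite (total_supp (sD i) (bD i) jk xj) mulr0.
Qed.

Lemma reduced_div x : \sum_i partial i (reduced D i) x = 0.
Proof.
rewrite (bigD1 k) //= {1}/reduced eqxx partial_cst add0r.
rewrite (eq_bigr (fun i => partial k step x * total (partial i (D i)) x)).
  by rewrite -mulr_sumr sum_total mulr0.
move=> i ik; rewrite /reduced (negbTE ik).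
have s1 := smooth_partial k smooth_step; have s2 := smooth_total (sD i).
apply: (etrans (partialM (U := setT) i s1 s2 I)).
have E := partial_total i x (sD i); rewrite (negbTE ik) in E.
have H (A B c d e : R) : A = 0 -> d = e -> A * B + c * d = c * e by move=> -> ->; rewrite mul0r add0r.
exact: (H _ _ _ _ _ (partial_bump x ik) E).
Qed.

Lemma reduced_pairing : \sum_i g i (D i) = \sum_i g i (reduced D i).
Proof.
rewrite (bigD1 k) //= [RHS](bigD1 k) //= {1}/reduced eqxx (cd0 (cg k)) add0r.
have sp i : smooth (prim (D i)) := smooth_prim (sD i).
have spp j i : smooth (partial j (prim (D i))) := smooth_partial j (sp i).
have Ek : D k = fun x => - \sum_(i | i != k) partial i (prim (D i)) x.
  apply/funext => x; have /eqP := sum_prim x; rewrite addr_eq0 => /eqP E.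
  apply: (etrans E); congr (- _); apply: eq_bigr => i ik; exact: esym (partial_prim x (sD i) ik).
have Egk : g k (D k) = - \sum_(i | i != k) g k (partial i (prim (D i))).
  apply: (etrans (congr1 (g k) Ek)); rewrite (cd_opp (cg k)); last first.
    by apply: smooth_sum => i _; exact: spp.
  congr (- _); rewrite [RHS]big_mkcond /=.
  pose F i (x : 'rV[R]_n) : R := if i != k then partial i (prim (D i)) x else 0.
  have sF i : smooth (F i) by rewrite /F; case: (i != k); [exact: spp|exact: smooth_cst].
  have -> : (fun x => \sum_(i | i != k) partial i (prim (D i)) x) = fun x => \sum_i F i x.
    by apply/funext => x; rewrite big_mkcond.
  rewrite (cd_sum (cg k) sF); apply: eq_bigr => i _; rewrite /F.
  by case: (i != k) => //; exact: cd0 (cg k).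
rewrite Egk addrC -sumrB; apply: eq_bigr => i ik.
have E1 := closed_g (sp i) (box_prim (sD i) (bD i)) k i.
have E2 := cd_sub (cg i) (sD i) (spp k i).
apply: (etrans (congr1 (fun c => g i (D i) - c) E1)); apply: (etrans (esym E2)).
congr (g i); apply/funext => x.
have E3 := partial_prim_k x (sD i).
apply: (etrans (congr1 (fun c => D i x - c) E3)).
by rewrite /reduced (negbTE ik) opprB addrC subrK.
Qed.
End Reduce.

Let reduced_zero D i : (D i = fun=> 0) -> reduced D i = fun=> 0.
Proof.
move=> Di; apply/funext => x; rewrite /reduced Di; case: ifP => // _.
by rewrite /total antideriv0 mulr0.
Qed.

(** Subtract from [D] the fields [d_k H e_i - d_i H e_k] with [H = prim (D i)], which
    [g] annihilates. The component of index [k] becomes zero because [D] has no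
    divergence. *)
Lemma direction_reduction D : (forall i, smooth (D i)) -> (forall i, box_supported (D i)) ->
  (forall x, \sum_i partial i (D i) x = 0) ->
  exists D', [/\ (forall i, smooth (D' i)), (forall i, box_supported (D' i)),
    (forall x, \sum_i partial i (D' i) x = 0),
    (forall i, i = k \/ D i = (fun=> 0) -> D' i = (fun=> 0)) & \sum_i g i (D i) = \sum_i g i (D' i)].
Proof.
move=> sD bD dD; exists (reduced D); split.
- exact: reduced_smooth.
- exact: reduced_box.
- exact: reduced_div.
- move=> i [->|]; last exact: reduced_zero.
  by apply/funext => x; rewrite /reduced eqxx.
- exact: reduced_pairing.
Qed.
End Direction.

(** One component at a time is removed from the field by subtracting fields
    [d_k H e_i - d_i H e_k], which a closed form annihilates. *)
Theorem closed_kills_solenoidal D : (forall i, smooth (D i)) -> (forall i, box_supported (D i)) ->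
  (forall x, \sum_i partial i (D i) x = 0) -> \sum_i g i (D i) = 0.
Proof.
move=> sD bD dD.
suff H (l : seq 'I_n) : forall D, (forall i, smooth (D i)) -> (forall i, box_supported (D i)) ->
    (forall x, \sum_i partial i (D i) x = 0) -> (forall i, i \notin l -> D i = (fun=> 0)) ->
    \sum_i g i (D i) = 0.
  by refine (H (enum 'I_n) D sD bD dD _) => i; rewrite mem_enum.
elim: l {D sD bD dD} => [|k l ih] D sD bD dD Dl.
  by rewrite big1 // => i _; rewrite Dl // (cd0 (cg i)).
have [D' [sD' bD' dD' D'l ->]] := @direction_reduction k D sD bD dD.
apply: ih => // i il; apply: D'l; have [->|ik] := eqVneq i k; [by left|right].
by apply: Dl; rewrite inE negb_or ik.
Qed.
End LocalPoincare.

(** * Removal of the mollifier *)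

Section Unmollification.
Context {R : realType}.
Local Notation mR := (measurableTypeR R).
Local Notation tupR n := (n.-tuple mR).
Local Notation e_ i := (delta_mx 0 i).

Lemma compact_distribution_partials n (s : seq 'I_n) (u : functional (R := R) n) :
  compact_distribution u -> compact_distribution (fun h => u (partials s h)).
Proof.
elim: s u => [|i s ih] u cu //.
exact: (ih _ (compact_distribution_tame cu (tame_partial i))).
Qed.

Lemma smooth_reflect n (c : 'rV[R]_n) (h : 'rV[R]_n -> R) : smooth h -> smooth (fun x => h (c - x)).
Proof.
move=> sh; apply: (smooth_comp (io := fun x => c - x) _ sh) => j.
rewrite (_ : (fun x => _) = fun x : 'rV[R]_n => c 0 j - x 0 j); last by apply/funext => y; rewrite !mxE.
by apply: smooth_sub; [exact: smooth_cst|exact: smooth_coord].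
Qed.

Lemma partials_reflect n (s : seq 'I_n) (c : 'rV[R]_n) (h : 'rV[R]_n -> R) : smooth h ->
  partials s (fun x => h (c - x)) = (fun x => (-1) ^+ size s * partials s h (c - x)).
Proof.
move=> sh; elim: s => [|i s ih] /=; first by apply/funext => x; rewrite expr0 mul1r.
rewrite ih; apply/funext => x; have ss := smooth_partials s sh.
have sc j : smooth (fun x : 'rV[R]_n => (c - x) 0 j).
  rewrite (_ : (fun x => _) = fun x : 'rV[R]_n => c 0 j - x 0 j); last by apply/funext => y; rewrite !mxE.
  by apply: smooth_sub; [exact: smooth_cst|exact: smooth_coord].
have E j : partial i (fun y : 'rV[R]_n => (c - y) 0 j) x = - (j == i)%:R.
  rewrite (_ : (fun y => _) = fun y : 'rV[R]_n => c 0 j - y 0 j); last by apply/funext => y; rewrite !mxE.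
  apply: (etrans (partialB (U := setT) i (@smooth_cst R n (c 0 j)) (@smooth_coord R n j) I)).
  by rewrite partial_coord partial_cst sub0r.
have E2 := partial_comp i x sc ss; rewrite (bigD1 i) //= big1 ?addr0 in E2; last first.
  by move=> j ji; rewrite E (negbTE ji) oppr0 mul0r.
apply: (etrans (partialZ (U := setT) _ i (smooth_reflect c ss) I)).
by rewrite E2 E eqxx exprS mulr1n; ring.
Qed.

#[local] Opaque partial antideriv.

Variable n : nat.

Definition near_supported (x0 : 'rV[R]_n) (d : R) (h : 'rV[R]_n -> R) :=
  forall y, d < `|y - x0| -> h y = 0.

Lemma near_supported_supported x0 d h : near_supported x0 d h -> supported (`|x0| + d) h.
Proof.
move=> hd y hy; apply: hd; have := ler_normD (y - x0) x0; rewrite subrK; lra.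
Qed.

Lemma open_far (x0 : 'rV[R]_n) d : open [set y | d < `|y - x0|].
Proof.
apply: (@open_preimage_smooth R n n (fun y => y - x0) [set y | d < `|y|]); last exact: open_norm_gt.
move=> j; have := smooth_shift (- x0) (@smooth_coord R n j); exact.
Qed.

Lemma near_supported_partials x0 d s h : near_supported x0 d h -> near_supported x0 d (partials s h).
Proof.
move=> hd y hy; apply: (etrans (partials_eq_on s (open_far (x0 := x0) (d := d)) (g := fun=> 0) hd hy)).
by rewrite partials_cst0.
Qed.

(** The integral is bounded below by the volume of a cube on which [h = 1]. *)
Lemma bump_exists (x0 : 'rV[R]_n) d : 0 < d -> exists h : 'rV[R]_n -> R,
  [/\ smooth h, near_supported x0 d h, (forall y, 0 <= h y) & 0 < \int[leb n]_t h (row_of t)].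
Proof.
move=> d0; have d2 : 0 < d ^+ 2 by rewrite exprn_gt0.
have dd : d ^+ 2 / 2 < d ^+ 2 by rewrite ltr_pdivrMr // ltr_pMr // ltrDl.
pose b (y : 'rV[R]_n) := plateau (d ^+ 2 / 2) (d ^+ 2) (dot y y).
have sb : smooth b by apply: smooth_plateau => //; exact: smooth_sqn.
have bs y : d < `|y| -> b y = 0.
  move=> yd; apply: plateau0 => //; rewrite leNgt; apply/negP => /ltW /(norm_le_dot (ltW d0)).
  by rewrite leNgt yd.
exists (fun y => b (y + - x0)); split.
- exact: smooth_shift.
- by move=> y; exact: bs.
- by move=> y; exact: plateau_ge0.
have := leb_affine_real (- x0) (normr1 R) (mrV_smooth sb).
rewrite (_ : (fun t => b (_ + 1 *: _)) = (fun t => b (row_of t - x0))); last first.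
  by apply/funext => t; rewrite scale1r addrC.
move=> ->.
(* On the cube of half-side [a] the bump is equal to 1. *)
pose a : R := d / (2 * n.+1%:R).
have a0 : 0 < a by rewrite divr_gt0 // mulr_gt0.
have lc : (leb n (@cubeT R n a) < +oo)%E by rewrite leb_cubeT ?(ltW a0) // ltry.
have i1 := itg_indic (@measurable_cubeT R n a) lc.
have bL : supported d b := bs.
have i2 : itg (leb n) (fun t => b (row_of t)).
  have := itg_cor (@smooth_cst R n 1) sb bL 0; congr itg; apply/funext => t.
  by rewrite mul1r add0r.
have : `|\int[leb n]_t \1_(@cubeT R n a) t| <= \int[leb n]_t b (row_of t).
  apply: int_norm_le => // t; rewrite indicE; case tc : (t \in _); last by rewrite normr0 plateau_ge0.
  rewrite normr1 /b plateau1 //; apply: le_trans (dot_le_norm _) _.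
  have ta : `|row_of t| <= a by apply: norm_le_coord (ltW a0) _ => i; rewrite mxE; exact: (set_mem tc).
  apply: (@le_trans _ _ (n.+1%:R * a ^+ 2)).
    apply: ler_pM => //; first by rewrite ler_nat.
    by rewrite ler_pXn2r ?nnegrE // ltW.
  have n1 : 1 <= n.+1%:R :> R by rewrite ler1n.
  rewrite /a; move: n1; move: (n.+1%:R : R) => m m1.
  have m0 : 0 < m by exact: lt_le_trans m1.
  have -> : m * (d / (2 * m)) ^+ 2 = d ^+ 2 / (4 * m) by field; rewrite gt_eqF.
  rewrite ler_pM2l // lef_pV2 ?posrE ?mulr_gt0 //; lra.
have mC := @measurable_cubeT R n a.
apply: lt_le_trans; rewrite normr_gt0 /Rintegral integral_indic // setIT.
rewrite [X in fine X](_ : _ = ((2 * a) ^+ n)%:E); last exact: (leb_cubeT n (ltW a0)).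
by rewrite /= expf_neq0 // gt_eqF // mulr_gt0.
Qed.

Section Correlate.
Variables (k : 'rV[R]_n -> R) (sk : smooth k).

Lemma partials_cor_right L s h : smooth h -> supported L h ->
  partials s (cor k h) = cor k (partials s h).
Proof.
move=> sh hL; elim: s => [|i s ih] //=; rewrite ih.
exact: (partials1_cor sk (smooth_partials s sh) (supported_partials s hL)).
Qed.

Lemma partials_cor_left L s h : smooth h -> supported L h ->
  partials s (cor k h) = fun x => (-1) ^+ size s * cor (partials s k) h x.
Proof.
move=> sh hL; elim: s => [|i s ih] /=; first by apply/funext => x; rewrite expr0 mul1r.
rewrite ih; apply/funext => x; have ss := smooth_partials s sk.
apply: (etrans (partialZ (U := setT) _ i (smooth_cor ss sh hL) I)).
have E1 := congr1 (fun f => f x) (partials1_cor ss sh hL i).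
have E2 := cor_by_parts i x ss sh hL.
apply: (etrans (congr1 (fun c => (-1) ^+ size s * c) E1)).
have H (A B c : R) : B = - A -> c * A = -1 * c * B by move=> ->; ring.
by rewrite exprS; exact: H.
Qed.

Lemma cor_translate h x : mrV h -> cor k h x = \int[leb n]_t (k (row_of t - x) * h (row_of t)).
Proof.
move=> mh; have mf : mrV (fun y => k (y - x) * h y).
  by apply: measurable_funM => //; exact: mrV_smooth (smooth_shift (- x) sk).
rewrite -(leb_affine_real x (normr1 R) mf); apply: eq_Rintegral => t _.
by rewrite scale1r [x + _]addrC addrK.
Qed.
End Correlate.

(** All the derivatives of [cor k h] fall on [k]; so for [h >= 0] supported in the ball
    of radius [r], [cor k h] divided by the integral of [h] differs from [k (x0 - x)] by
    O(r) in each seminorm. *)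
Lemma unmollify (v : functional (R := R) n) (k : 'rV[R]_n -> R) (x0 : 'rV[R]_n) (d : R) :
  compact_distribution v -> smooth k -> 0 < d ->
  (forall h, smooth h -> near_supported x0 d h -> v (cor k h) = 0) ->
  v (fun x => k (x0 - x)) = 0.
Proof.
move=> cv sk d0 hv; have [N [m [C [N0 C0 bv]]]] := cd_bound cv.
have [M M0 hM] := partials_bounded m.+1 (@compact_cball R n (N + `|x0| + d)) sk.
have H (r : R) : 0 < r -> r <= d -> `|v (fun x => k (x0 - x))| <= C * (n%:R * M * r).
  move=> r0 rd; have [h [sh hr h0 ih0]] := bump_exists x0 r0.
  have hd : near_supported x0 d h by move=> y /(le_lt_trans rd); exact: hr.
  have hL := near_supported_supported hr.
  set c := Rintegral _ _ _ in ih0.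
  have sc := smooth_cor sk sh hL; have sr := smooth_reflect x0 sk.
  have E : v (fun x => cor k h x - c * k (x0 - x)) = - (c * v (fun x => k (x0 - x))).
    rewrite (cd_sub cv sc (smooth_scale c sr)) (cd_scale cv c sr) hv //.
    by rewrite sub0r.
  have ih : itg (leb n) (fun t => h (row_of t)).
    have := itg_cor (@smooth_cst R n 1) sh hL 0; congr itg; apply/funext => t.
    by rewrite mul1r add0r.
  have B : `|v (fun x => cor k h x - c * k (x0 - x))| <= C * (n%:R * M * r * c).
    apply: le_trans (bv _ (smooth_sub sc (smooth_scale c sr))) _; rewrite ler_wpM2l //.
    apply: seminorm_le => [|s x sm xN]; first by rewrite !mulr_ge0 // ltW.
    have ss := smooth_partials s sk.
    have P : partials s (fun x => cor k h x - c * k (x0 - x)) x =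
        (-1) ^+ size s * (cor (partials s k) h x - c * partials s k (x0 - x)).
      have P1 := congr1 (fun f => f x) (partials_lin s (- c) sr sc).
      have P2 := congr1 (fun f => f x) (partials_reflect s x0 sk).
      have P3 := congr1 (fun f => f x) (partials_cor_left sk s sh hL).
      have P0 : (fun x => cor k h x - c * k (x0 - x)) = (fun x => - c * k (x0 - x) + cor k h x).
        by apply/funext => y; rewrite addrC mulNr.
      rewrite P0; apply: (etrans P1).
      have G (A A' B B' e : R) : A = e * A' -> B = e * B' -> - c * A + B = e * (B' - c * A').
        by move=> -> ->; ring.
      exact: (G _ _ _ _ _ P2 P3).
    rewrite P normrM normrX normrN1 expr1n mul1r.
    have ik := itg_scale (partials s k (x0 - x)) ih.
    have mh := mrV_smooth sh.
    have ikh : itg (leb n) (fun t => partials s k (row_of t - x) * h (row_of t)).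
      have sL : supported (`|x0| + r) (fun y => partials s k (y - x) * h y).
        by move=> y /hL ->; rewrite mulr0.
      have s1 := smooth_mul (smooth_shift (- x) ss) sh.
      have := itg_cor (@smooth_cst R n 1) s1 sL 0; congr itg; apply/funext => t.
      by rewrite mul1r add0r.
    rewrite (cor_translate ss) // [c * _]mulrC /c -(int_scale (partials s k (x0 - x)) ih) -int_sub //.
    rewrite -(int_scale (n%:R * M * r) ih); apply: int_norm_le; [exact: itg_sub|exact: itg_scale|].
    move=> t; set y := row_of t; rewrite -mulrBl normrM (ger0_norm (h0 y)).
    have [yr|yr] := leP `|y - x0| r; last by rewrite (hr _ yr) !mulr0.
    rewrite ler_wpM2r //.
    have [|xi hxi Em] := @mvt_rV R n (partials s k) (x0 - x) (y - x0).
      by move=> z _ i; exact: smooth_derivable.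
    have Ey : x0 - x + (y - x0) = y - x by rewrite addrC addrA subrK.
    rewrite Ey in Em; rewrite Em (le_trans (ler_norm_sum _ _ _)) //.
    have -> : n%:R * M * r = \sum_(i < n) M * r.
      by rewrite sumr_const card_ord -[RHS]mulr_natl mulrA.
    apply: ler_sum => i _; rewrite normrM mulrC; apply: ler_pM => //.
      apply: (hM (i :: s)); first by rewrite /= ltnS.
      rewrite /cball /=; have := hxi i; have := ler_normD (xi i - (x0 - x)) (x0 - x).
      rewrite subrK; have := ler_normB x0 x; move: xN; rewrite /cball /=; lra.
    by apply: le_trans yr; exact: le_trans (coord_le_norm _ _) _.
  move: B; rewrite E normrN normrM (gtr0_norm ih0) => B.
  rewrite -(ler_pM2l ih0); apply: le_trans B _.
  by rewrite le_eqVlt; apply/orP; left; apply/eqP; ring.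
apply/eqP; rewrite -normr_le0; apply/ler_addgt0Pr => e e0; rewrite add0r.
pose r := Num.min d (e / (C * (n%:R * M) + 1)).
have q0 : 0 < C * (n%:R * M) + 1 by rewrite ltr_wpDl // !mulr_ge0.
have r0 : 0 < r by rewrite lt_min d0 divr_gt0.
apply: le_trans (H r r0 _) _; first by rewrite ge_min lexx.
have re : r <= e / (C * (n%:R * M) + 1) by rewrite ge_min lexx orbT.
rewrite mulrA; apply: (@le_trans _ _ ((C * (n%:R * M) + 1) * (e / (C * (n%:R * M) + 1)))).
  by apply: ler_pM => //; rewrite ?mulr_ge0 ?(ltW r0) // lerDl.
by rewrite mulrC divfK // gt_eqF.
Qed.
End Unmollification.

(** * From closed near a point to closed *)

Section CurlFree.
Context {R : realType}.
Local Notation e_ i := (delta_mx 0 i).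
#[local] Opaque partial antideriv cor X1_adj.

Variables (n : nat) (g : 'I_n -> functional (R := R) n) (x0 : 'rV[R]_n) (d : R).
Hypotheses (n2 : (1 < n)%N) (cg : forall i, compact_distribution (g i)) (d0 : 0 < d).
Hypothesis closed_g : forall h, smooth h -> box_supported x0 (3 * d) h ->
  forall i j, g i (partial j h) = g j (partial i h).
Hypothesis g_line : forall L h j, smooth h -> near_supported x0 d h ->
  \sum_i g i (X1_adj (line_test L h j) i) = 0.

Let n0 : (0 < n)%N := ltnW n2.
Let dd : R := d ^+ 2.
Let dd0 : 0 < dd. Proof. exact: exprn_gt0. Qed.

Section Pair.
Variables j k : 'I_n.

Let u (h : 'rV[R]_n -> R) : R := g j (partial k h) - g k (partial j h).

Let cu : compact_distribution u.
Proof.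
have c1 := compact_distribution_tame (cg j) (tame_partial k).
have c2 := compact_distribution_opp (compact_distribution_tame (cg k) (tame_partial j)).
exact: (compact_distribution_add c1 c2).
Qed.

(** The adjoint X-ray fields of two line tests and the field that the Riesz potential of
    [h] defines have, off a neighbourhood of [x0], the same values; both are free of
    divergence. *)
Let u_cor h : smooth h -> near_supported x0 d h -> u (cor (riesz_kernel dd) h) = 0.
Proof.
(* As [dot y y <= n |y|^2], [h] vanishes where [L^2 < dot y y]. *)
move=> sh hd; pose L : R := n%:R * (`|x0| + d).
have L0 : 0 <= L by rewrite mulr_ge0 // addr_ge0 // ltW.
have hL y : L ^+ 2 < dot y y -> h y = 0.
  move=> yL; apply: (near_supported_supported hd); rewrite ltNge; apply/negP => yn.
  move: yL; rewrite ltNge => /negP; apply; apply: le_trans (dot_le_norm y) _.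
  have xd0 : 0 <= `|x0| + d by rewrite addr_ge0 // ltW.
  rewrite /L exprMn; apply: ler_pM => //.
    by rewrite -natrX ler_nat -{1}(expn1 n) leq_pexp2l.
  by rewrite ler_pXn2r ?nnegrE.
have hS := near_supported_supported hd.
pose c : R := 2 / n.-1%:R.
have c0 : c != 0 by rewrite mulf_neq0 // invr_neq0 // pnatr_eq0; lia.
have sK := smooth_cor (@smooth_riesz_kernel R n dd dd0) sh hS.
set K := cor (riesz_kernel dd) h in sK *.
have sKp l := smooth_partial l sK.
have shp l := smooth_partial l sh.
have hdp l : near_supported x0 d (partial l h) := near_supported_partials [:: l] hd.
pose phi l m := line_test L (partial l h) m.
have sphi l m : smooth_rel (@Gamma R n) (phi l m).
  by apply: smooth_smooth_rel; apply: smooth_line_test; exact: shp.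
pose Y i x := X1_adj (phi k j) i x - X1_adj (phi j k) i x.
pose Z i x := c * ((i == j)%:R * partial k K x - (i == k)%:R * partial j K x).
have sX l m i : smooth (X1_adj (phi l m) i) := smooth_X1_adj i (sphi l m).
have sY i : smooth (Y i) := smooth_sub (sX k j i) (sX j k i).
have sZ1 i : smooth (fun x => (i == j)%:R * partial k K x - (i == k)%:R * partial j K x).
  exact: (smooth_sub (smooth_scale _ (sKp k)) (smooth_scale _ (sKp j))).
have sZ i : smooth (Z i) := smooth_scale c (sZ1 i).
have sD i : smooth (fun x => Y i x - Z i x) := smooth_sub (sY i) (sZ i).
have bD i : box_supported x0 (3 * d) (fun x => Y i x - Z i x).
  move=> x l xl; apply/eqP; rewrite subr_eq0; apply/eqP.
  apply: (@X1_adj_curl_test R n dd L n0 dd0 L0 h x i j k n2 sh hL).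
  exists ((2 * d) ^+ 2) => [|y yx].
    by rewrite exprMn; have := dd0; rewrite /dd; lra.
  apply: hd; have := norm_le_dot (r := 2 * d) _ yx; rewrite mulr_ge0 ?(ltW d0) // => /(_ isT) yn.
  have := lt_le_trans xl (_ : _ <= `|x - x0|).
  have -> : x 0 l - x0 0 l = (x - x0) 0 l by rewrite !mxE.
  move=> /(_ (coord_le_norm _ _)) xn.
  have := ler_normB (y - x0) (y - x).
  have -> : y - x0 - (y - x) = x - x0 by rewrite opprB addrC addrA subrK.
  lra.
have dY x : \sum_i partial i (Y i) x = 0.
  have E i : partial i (Y i) x = partial i (X1_adj (phi k j) i) x - partial i (X1_adj (phi j k) i) x.
    exact: (partialB (U := setT) i (sX k j i) (sX j k i) I).
  rewrite (eq_bigr _ (fun i _ => E i)) sumrB.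
  have H (a b : R) : a = 0 -> b = 0 -> a - b = 0 by move=> -> ->; rewrite subrr.
  exact: (H _ _ (X1_adj_divergence x (sphi k j)) (X1_adj_divergence x (sphi j k))).
have delta_sum (m : 'I_n) (F : 'I_n -> R) : \sum_i (i == m)%:R * F i = F m.
  rewrite (bigD1 m) //= eqxx mul1r big1 ?addr0 // => i /negbTE ->.
  by rewrite mul0r.
have dZ x : \sum_i partial i (Z i) x = 0.
  have E i : partial i (Z i) x =
      c * ((i == j)%:R * partial i (partial k K) x - (i == k)%:R * partial i (partial j K) x).
    apply: (etrans (partialZ (U := setT) c i (sZ1 i) I)); congr (_ * _).
    apply: (etrans (partialB (U := setT) i (smooth_scale _ (sKp k)) (smooth_scale _ (sKp j)) I)).
    have E1 := partialZ (U := setT) (i == j)%:R i (sKp k) (I : setT x).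
    have E2 := partialZ (U := setT) (i == k)%:R i (sKp j) (I : setT x).
    exact: (congr2 (fun a b => a - b) E1 E2).
  rewrite (eq_bigr _ (fun i _ => E i)) -mulr_sumr sumrB.
  have H (a b a' b' : R) : a = a' -> b = b' -> a' = b' -> c * (a - b) = 0.
    by move=> -> -> ->; rewrite subrr mulr0.
  apply: (H _ _ _ _ (delta_sum j (fun i => partial i (partial k K) x))
    (delta_sum k (fun i => partial i (partial j K) x))).
  exact: (congr1 (fun f => f x) (partialC k j sK)).
have dD x : \sum_i partial i (fun x => Y i x - Z i x) x = 0.
  have E i := partialB (U := setT) i (sY i) (sZ i) (I : setT x).
  rewrite (eq_bigr _ (fun i _ => E i)) sumrB.
  have H (a b : R) : a = 0 -> b = 0 -> a - b = 0 by move=> -> ->; rewrite subrr.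
  exact: (H _ _ (dY x) (dZ x)).
have r0 : 0 < 3 * d by rewrite mulr_gt0.
have GD := closed_kills_solenoidal r0 cg closed_g sD bD dD.
have GY : \sum_i g i (Y i) = 0.
  have E i : g i (Y i) = g i (X1_adj (phi k j) i) - g i (X1_adj (phi j k) i).
    exact: (cd_sub (cg i) (sX k j i) (sX j k i)).
  rewrite (eq_bigr _ (fun i _ => E i)) sumrB.
  have H (a b : R) : a = 0 -> b = 0 -> a - b = 0 by move=> -> ->; rewrite subrr.
  exact: (H _ _ (g_line L j (shp k) (hdp k)) (g_line L k (shp j) (hdp j))).
have GZ : \sum_i g i (Z i) = c * u K.
  have E i : g i (Z i) = c * ((i == j)%:R * g i (partial k K) - (i == k)%:R * g i (partial j K)).
    apply: (etrans (cd_scale (cg i) c (sZ1 i))); congr (_ * _).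
    apply: (etrans (cd_sub (cg i) (smooth_scale _ (sKp k)) (smooth_scale _ (sKp j)))).
    have E1 := cd_scale (cg i) (i == j)%:R (sKp k).
    have E2 := cd_scale (cg i) (i == k)%:R (sKp j).
    exact: (congr2 (fun a b => a - b) E1 E2).
  rewrite (eq_bigr _ (fun i _ => E i)) -mulr_sumr sumrB.
  have H (a b a' b' : R) : a = a' -> b = b' -> c * (a - b) = c * (a' - b') by move=> -> ->.
  exact: (H _ _ _ _ (delta_sum j (fun i => g i (partial k K))) (delta_sum k (fun i => g i (partial j K)))).
have E i : g i (fun x => Y i x - Z i x) = g i (Y i) - g i (Z i) := cd_sub (cg i) (sY i) (sZ i).
rewrite (eq_bigr _ (fun i _ => E i)) sumrB GY GZ sub0r in GD.
move/eqP: GD; rewrite oppr_eq0 mulf_eq0 (negbTE c0) /= => /eqP; exact.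
Qed.

Let u_shift (h : 'rV[R]_n -> R) : R := u (fun x => 1 * h (x - x0)).

Let cu_shift : compact_distribution u_shift.
Proof.
have sio l : smooth (fun x : 'rV[R]_n => (x - x0) 0 l).
  exact: (smooth_shift (- x0) (@smooth_coord R n l)).
exact: (compact_distribution_tame cu (tame_pullback sio (@smooth_cst R n 1))).
Qed.

(** Translate [x0] to the origin and apply the rigidity of the Riesz kernel. *)
Lemma pair_curl_free h : smooth h -> g j (partial k h) = g k (partial j h).
Proof.
move=> sh; apply/eqP; rewrite -subr_eq0; apply/eqP.
have Eh : u h = u_shift (fun x => h (x + x0)).
  by rewrite /u_shift; congr u; apply/funext => x; rewrite subrK mul1r.
apply: (etrans Eh).
have sk := @smooth_riesz_kernel R n dd dd0.
apply: (riesz_kernel_rigidity (d := dd) (e := (2 * d) ^+ 2) n2 cu_shift dd0).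
- by rewrite /dd exprMn; have := dd0; rewrite /dd; lra.
- move=> k' sk' k'0; apply/eqP; rewrite subr_eq0; apply/eqP.
  apply: closed_g; first by apply: smooth_scale; exact: (smooth_shift (- x0) sk').
  move=> x l xl; rewrite k'0 ?mulr0 //; apply: le_trans (sqr_coord_le_dot _ l).
  rewrite !mxE -[X in _ <= X]real_normK ?num_real // ler_pXn2r ?nnegrE ?mulr_ge0 ?(ltW d0) //.
  by apply: le_trans (ltW xl); rewrite ler_pM2r // ler_nat.
- move=> s; have sks := smooth_partials s sk.
  have Hv h' : smooth h' -> near_supported x0 d h' -> u (partials s (cor (riesz_kernel dd) h')) = 0.
    move=> sh' hd'; have E := partials_cor_right sk s sh' (near_supported_supported hd').
    apply: (etrans (congr1 u E)).
    exact: (u_cor (smooth_partials s sh') (near_supported_partials s hd')).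
  have := unmollify (compact_distribution_partials s cu) sk d0 Hv.
  have even : (fun x => riesz_kernel dd (x0 - x)) = (fun x => riesz_kernel dd (x + - x0)).
    apply/funext => x; rewrite /riesz_kernel /regsqn.
    by rewrite -(opprB x x0) dotNl dotC dotNl opprK.
  rewrite even (partials_shift s (- x0) sk) => E; apply: etrans E; rewrite /u_shift.
  by congr u; apply/funext => x; rewrite mul1r.
- exact: (smooth_shift x0 sh).
Qed.
End Pair.
End CurlFree.

(** * Primitives of closed forms *)

Section GlobalPoincare.
Context {R : realType}.
#[local] Opaque partial antideriv.
Variables (n : nat) (g : 'I_n -> functional (R := R) n).
Hypotheses (n2 : (1 < n)%N) (cg : forall i, compact_distribution (g i)).
Hypothesis closed_g : forall h, smooth h -> forall i j, g i (partial j h) = g j (partial i h).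

(** The primitive integrates the component of index [i0]. It is a primitive because this
    component annihilates the functions [k] that do not depend on the variable of index
    [i0]: such a [k] is a derivative in a second direction [i1], and
    [g_i0 (d_i1 K) = g_i1 (d_i0 K) = 0]. *)
Theorem closed_exact : exists psi, compact_distribution psi /\
  forall i h, smooth h -> g i h = - psi (partial i h).
Proof.
pose i0 : 'I_n := Ordinal (ltnW n2); pose i1 : 'I_n := Ordinal n2.
have i10 : i0 != i1 by [].
pose J := @antideriv R n 0 i0.
exists (fun h => - g i0 (J h)); split.
  exact: (compact_distribution_opp (compact_distribution_tame (cg i0) (tame_antideriv 0 i0))).
move=> i h sh; rewrite opprK; have sJ := smooth_antideriv 0 i0 sh.
have [->|ii0] := eqVneq i i0.
  have sU := smooth_comp_upd i0 0 sh; set hU := fun x => h (upd i0 x 0) in sU.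
  have EJ : J (partial i0 h) = fun x => h x - hU x.
    by apply/funext => x; exact: antideriv_partial.
  apply: (etrans _ (esym (congr1 (g i0) EJ))); apply: (etrans _ (esym (cd_sub (cg i0) sh sU))).
  suff -> : g i0 hU = 0 by rewrite subr0.
  have sP := smooth_antideriv 0 i1 sU.
  apply: (etrans (congr1 (g i0) (esym (partial_antideriv 0 i1 sU)))).
  apply: (etrans (closed_g sP i0 i1)).
  have E1 := partial_antideriv_neq 0 sU i10.
  have E2 : partial i0 hU = fun=> 0.
    by apply/funext => x; have := partial_upd i0 i0 0 x sh; rewrite eqxx.
  have E3 : partial i0 (antideriv 0 i1 hU) = fun=> 0.
    by rewrite E1 E2; apply/funext => x; exact: antideriv0.
  by rewrite E3; exact: cd0 (cg i1).
have E1 := partial_antideriv_neq 0 sh ii0.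
apply: (etrans _ (congr1 (g i0) E1)); apply: (etrans _ (closed_g sJ i i0)).
exact: (congr1 (g i) (esym (partial_antideriv 0 i0 sh))).
Qed.
End GlobalPoincare.

(** * Matrix fields *)

Section Matrices.
Context {R : realType}.
Variable n : nat.
Implicit Types (A : 'rV[R]_n -> 'M[R]_n) (f : 'I_n -> functional (R := R) n).

Lemma smooth_det m (A : 'rV[R]_n -> 'M[R]_m) :
  (forall i j, smooth (fun x => A x i j)) -> smooth (fun x => \det (A x)).
Proof.
move=> sA; rewrite /determinant; apply: smooth_sum => s _.
apply: smooth_mul; first exact: smooth_cst.
by apply: smooth_prod => i _; exact: sA.
Qed.

(** By the rule of Cramer, the entries are cofactors divided by the determinant. *)
Lemma smooth_invmx A : (forall i j, smooth (fun x => A x i j)) -> (forall x, A x \in unitmx) ->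
  forall i j, smooth (fun x => invmx (A x) i j).
Proof.
move=> sA uA i j.
rewrite (_ : (fun x => _) = fun x => (\det (A x))^-1 * cofactor (A x) j i); last first.
  by apply/funext => x; rewrite /invmx uA !mxE.
apply: smooth_mul.
  apply: smooth_on_inv; [exact: openT|exact: smooth_det|].
  by move=> x _; have := uA x; rewrite unitmxE unitfE.
rewrite /cofactor; apply: smooth_scale; apply: smooth_det => a b.
by under eq_fun do rewrite !mxE; exact: sA.
Qed.

Lemma compact_distribution_mulmx A f : (forall i j, smooth (fun x => A x i j)) ->
  (forall i, compact_distribution (f i)) -> forall i, compact_distribution (mulmx_distr A f i).
Proof.
move=> sA cf i; apply: compact_distribution_sum => j.
exact: (compact_distribution_tame (cf j) (tame_pullback (io := id) (@smooth_coord R n) (sA i j))).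
Qed.

Lemma mulmx_distr_mul A (B : 'rV[R]_n -> 'M[R]_n) f i (h : 'rV[R]_n -> R) : (forall i j, smooth (fun x => A x i j)) ->
  (forall i j, smooth (fun x => B x i j)) -> (forall i, compact_distribution (f i)) -> smooth h ->
  (forall x, A x *m B x = 1%:M) -> mulmx_distr A (mulmx_distr B f) i h = f i h.
Proof.
move=> sA sB cf sh AB; rewrite /mulmx_distr /pairing exchange_big /=.
have E l : \sum_j f l (fun x => B x j l * (A x i j * h x)) = (i == l)%:R * f l h.
  have sF j : smooth (fun x => B x j l * (A x i j * h x)).
    exact: (smooth_mul (sB j l) (smooth_mul (sA i j) sh)).
  rewrite -(cd_sum (cf l) sF) -(cd_scale (cf l) _ sh); congr (f l); apply/funext => x.
  have <- : (A x *m B x) i l = (i == l)%:R by rewrite AB mxE.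
  rewrite mxE mulr_suml; apply: eq_bigr => j _; ring.
rewrite (eq_bigr _ (fun l _ => E l)) (bigD1 i) //= eqxx mul1r big1 ?addr0 // => l li.
by rewrite eq_sym (negbTE li) mul0r.
Qed.

Lemma mulmx_distr_eq A f (f' : 'I_n -> functional n) i (h : 'rV[R]_n -> R) : (forall i j, smooth (fun x => A x i j)) -> smooth h ->
  (forall j, eq_distr (f j) (f' j)) -> mulmx_distr A f i h = mulmx_distr A f' i h.
Proof.
by move=> sA sh ff'; apply: eq_bigr => j _; apply: ff'; exact: smooth_mul.
Qed.
End Matrices.

(** * Exactness, and the theorem *)

Section Main.
Context {R : realType}.
#[local] Opaque partial antideriv X1_adj.
Variables (n : nat).

Lemma compact_closed_ball (x0 : 'rV[R]_n) r : compact [set x : 'rV[R]_n | `|x - x0| <= r].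
Proof.
apply: (@compact_dot_set _ _ _ (`|x0| + r)).
  have -> : [set x : 'rV[R]_n | `|x - x0| <= r] = ~` [set x | r < `|x - x0|].
    apply/seteqP; split=> x /=; first by rewrite leNgt => /negP.
    by move/negP; rewrite -leNgt.
  by apply: open_closedC; exact: open_far.
by move=> x /= xr; have := ler_normD (x - x0) x0; rewrite subrK; lra.
Qed.

Lemma test_on_ball (V : set 'rV[R]_n) (x0 : 'rV[R]_n) r h : smooth h ->
  (forall x, h x != 0 -> `|x - x0| <= r) -> [set x | `|x - x0| <= r] `<=` V -> test_on V h.
Proof.
move=> sh hr BV; have cB := @compact_closed_ball x0 r.
have clB : closed [set x : 'rV[R]_n | `|x - x0| <= r].
  by apply: compact_closed => //; exact: norm_hausdorff.
have S : closure [set x | h x != 0] `<=` [set x | `|x - x0| <= r].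
  by rewrite closureE; exact: smallest_sub.
split=> //; last exact: subset_trans S BV.
exact: subclosed_compact (@closed_closure _ _) cB S.
Qed.

(** The cube of radius [r] around [x0] in [V] leaves room for mollifiers of radius [r / 3]
    and for the part of their potentials where the regularized kernel differs from the
    Riesz kernel. *)
Lemma xray_kernel_exact (g : 'I_n -> functional (R := R) n) (V : set 'rV[R]_n) :
  (1 < n)%N -> (forall i, compact_distribution (g i)) -> open V -> V !=set0 ->
  (forall i j, vanishes_on V (dcovector g i j)) -> vanishes_on_lines_meeting V (X1 g) ->
  exists psi, compact_distribution psi /\ forall i h, smooth h -> g i h = - psi (partial i h).
Proof.
move=> n2 cg oV [x0 Vx0] dg Xg.
have [r r0 hr] := (nbhs_closed_ball x0 V).1 (open_nbhs_nbhs (conj oV Vx0)).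
pose d := r / 3; have d0 : 0 < d by rewrite divr_gt0.
have rd : r = 3 * d by rewrite /d mulrC divfK.
have closed3 h : smooth h -> box_supported x0 (3 * d) h ->
    forall i j, g i (partial j h) = g j (partial i h).
  move=> sh hb i j; have t : test_on V h.
    apply: (test_on_ball (x0 := x0) (r := r)) => //.
    move=> x hx; apply: norm_le_coord (ltW r0) _ => l; rewrite !mxE leNgt rd.
    by apply/negP => /(hb x l) /eqP; rewrite (negbTE hx).
  have := dg i j h t; rewrite /dcovector /dpartial opprK addrC => /eqP.
  by rewrite subr_eq0 => /eqP.
have line0 L h j : smooth h -> near_supported x0 d h ->
    \sum_i g i (X1_adj (line_test L h j) i) = 0.
  move=> sh hd; apply: Xg; have cB := @compact_closed_ball x0 d.
  apply: (line_test_test_rel L j sh cB).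
    by move=> x xd; apply: hr; apply: (le_trans xd); rewrite rd; lra.
  by move=> y hy; rewrite /= leNgt; apply/negP => /hd /eqP; rewrite (negbTE hy).
apply: closed_exact => // h sh i j.
exact: (pair_curl_free n2 cg d0 closed3 line0 i j sh).
Qed.
End Main.

Theorem corollary1p7 (R : realType) (n : nat) (A : 'rV[R]_n -> 'M[R]_n)
    (f : 'I_n -> functional (R := R) n) (V : set 'rV[R]_n) :
  (2 <= n)%N ->
  (forall i j : 'I_n, smooth (fun x => A x i j)) ->
  (forall x : 'rV[R]_n, A x \in unitmx) ->
  (forall i : 'I_n, compact_distribution (f i)) ->
  open V -> V !=set0 ->
  (forall i j : 'I_n, vanishes_on V (dcovector (mulmx_distr A f) i j)) ->
  (vanishes_on_lines_meeting V (XA A f) <->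
   exists psi : functional (R := R) n, compact_distribution psi /\
     forall i : 'I_n,
       eq_distr (f i) (mulmx_distr (fun x => invmx (A x)) (dscalar psi) i)).
Proof.
move=> n2 sA uA cf oV V0 dAf.
have sB := smooth_invmx sA uA.
have cAf := compact_distribution_mulmx sA cf.
split=> [X0|[psi [cpsi fE]] phi [sphi _ _]].
  have [psi [cpsi E]] := xray_kernel_exact n2 cAf oV V0 dAf X0.
  exists psi; split=> // i h sh.
  rewrite -(mulmx_distr_mul i sB sA cf sh (fun x => mulVmx (uA x))).
  by apply: mulmx_distr_eq => // j k sk; exact: E.
have cd i : compact_distribution (dscalar psi i).
  exact: (compact_distribution_opp (compact_distribution_tame cpsi (tame_partial i))).
have sX i := smooth_X1_adj i sphi.
rewrite /XA /X1 /pairing (eq_bigr (fun i => - psi (partial i (X1_adj phi i)))); last first.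
  move=> i _; rewrite (mulmx_distr_eq i sA (sX i) fE).
  by rewrite (mulmx_distr_mul i sA sB cd (sX i) (fun x => mulmxV (uA x))).
rewrite sumrN -(cd_sum cpsi) => [|i]; last exact: smooth_partial.
rewrite (_ : (fun x => _) = fun=> 0); first by rewrite (cd0 cpsi) oppr0.
by apply/funext => x; exact: X1_adj_divergence.
Qed.
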